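(* Let $\mathfrak{g}$ be a complex simple finite-dimensional Lie algebra not isomorphic to $\mathfrak{sl}(2,\mathbb{C})$ and let $\lambda\in\mathfrak{h}^*$. Then the set of all weights of $W^{\mathfrak{g}}_{\mathfrak{b}}(\lambda)$ is $\{\mu_{\lambda,a};\,a\in\mathbb{Z}^\Pi\}$. Moreover, $W^{\mathfrak{g}}_{\mathfrak{b}}(\lambda)$ is a weight $\mathfrak{h}$-module with infinite-dimensional weight spaces, and for every $a\in\mathbb{Z}^\Pi$ the subset $$\{w_{\lambda,a+n_at_\theta+t};\ t\in\Lambda_+,\ a+n_at_\theta+t\in\mathbb{N}_0^{\Delta^+}\}$$ of $W^{\mathfrak{g}}_{\mathfrak{b}}(\lambda)_{\mu_{\lambda,a}}$ forms a basis of $W^{\mathfrak{g}}_{\mathfrak{b}}(\lambda)_{\mu_{\lambda,a}}$, where $n_a\in\mathbb{N}_0$ is the smallest non-negative integer satisfying $a+n_at_\theta\in\mathbb{N}_0^{\Delta^+}$.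
   Context: $\mathfrak{h}$ is a Cartan subalgebra of $\mathfrak{g}$, $\Delta^+$ a positive root system, $\Pi=\{\alpha_1,\dots,\alpha_r\}\subset\Delta^+$ the simple roots, $\mathfrak{n}=\bigoplus_{\alpha\in\Delta^+}\mathfrak{g}_\alpha$, $\overline{\mathfrak{n}}=\bigoplus_{\alpha\in\Delta^+}\mathfrak{g}_{-\alpha}$, $\mathfrak{b}=\mathfrak{h}\oplus\mathfrak{n}$, $\rho=\frac12\sum_{\alpha\in\Delta^+}\alpha$, $\theta$ the maximal root, $\Delta^+_\theta=\Delta^+\setminus\{\theta\}$. $\{f_\alpha;\,\alpha\in\Delta^+\}$ is a root basis of $\overline{\mathfrak{n}}$ ($f_\alpha\in\mathfrak{g}_{-\alpha}$) with corresponding linear coordinate functions $x_\alpha$ on $\overline{\mathfrak{n}}$, and $u(x)=\sum_{\alpha\in\Delta^+}x_\alpha f_\alpha$. The Weyl algebra $\mathcal{A}$ of $\overline{\mathfrak{n}}$ is generated by $x_\alpha,\partial_{x_\alpha}$ ($\alpha\in\Delta^+$) with the canonical commutation relations. For $\mu\in\mathfrak{h}^*$ there is a Lie algebra homomorphism $\pi_\mu\colon\mathfrak{g}\to\mathcal{A}$, $$\pi_\mu(a)=-\sum_{\alpha\in\Delta^+}\bigg[\frac{\operatorname{ad}(u(x))e^{\operatorname{ad}(u(x))}}{e^{\operatorname{ad}(u(x))}-\mathrm{id}}\,(e^{-\operatorname{ad}(u(x))}a)_{\overline{\mathfrak{n}}}\bigg]_\alpha\partial_{x_\alpha}+(\mu+\rho)\big((e^{-\operatorname{ad}(u(x))}a)_{\mathfrak{h}}\big),$$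 where $\operatorname{ad}(u(x))$ acts on $\mathbb{C}[\overline{\mathfrak{n}}]\otimes\mathfrak{g}$ (the fraction is the power series $te^t/(e^t-1)$ at the nilpotent operator $t=\operatorname{ad}(u(x))$), $[\cdot]_\alpha$ is the coordinate with respect to $f_\alpha$, and $a_{\overline{\mathfrak{n}}},a_{\mathfrak{h}}$ are the components in $\mathfrak{g}=\overline{\mathfrak{n}}\oplus\mathfrak{h}\oplus\mathfrak{n}$ (all extended $\mathbb{C}[\overline{\mathfrak{n}}]$-linearly). $W^{\mathfrak{g}}_{\mathfrak{b}}(\lambda)=\mathcal{A}/\mathcal{I}_{\rm GT}\simeq\mathbb{C}[\partial_{x_\alpha},\alpha\in\Delta^+_\theta,\,x_\theta]$, where $\mathcal{I}_{\rm GT}$ is the left ideal generated by $x_\alpha$ ($\alpha\in\Delta^+_\theta$) and $\partial_{x_\theta}$, with $\mathfrak{g}$-module structure given through $\pi_{\lambda+\rho}$. For an $\mathfrak{h}$-module $M$ and $\mu\in\mathfrak{h}^*$, $M_\mu=\{v\in M;\,hv=\mu(h)v\ \forall h\in\mathfrak{h}\}$; $\mu$ is a weight if $M_\mu\neq\{0\}$; $M$ is a weight module if $M=\bigoplus_\mu M_\mu$. $\mathbb{Z}^{\Delta^+}$, $\mathbb{Z}^{\Pi}$ and $\mathbb{N}_0^{\Delta^+}$ are sets of functions; elements of $\mathbb{Z}^\Pi$ are regarded as elements of $\mathbb{Z}^{\Delta^+}$ extended by $0$. For $a\in\mathbb{N}_0^{\Delta^+}$, $w_{\lambda,a}=\prod_{\alpha\in\Delta^+_\theta}\partial_{x_\alpha}^{a_\alpha}x_\theta^{a_\theta}\in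 W^{\mathfrak{g}}_{\mathfrak{b}}(\lambda)$. For $a\in\mathbb{Z}^{\Delta^+}$, $\mu_{\lambda,a}=-\sum_{\alpha\in\Delta^+_\theta}a_\alpha\alpha+a_\theta\theta+\lambda+\theta$. Write $\alpha=\sum_{i=1}^rm_{\alpha,i}\alpha_i$ for $\alpha\in\Delta^+$. For $\alpha\in\Delta^+\setminus\Pi$ define $t_\alpha\in\mathbb{Z}^{\Delta^+}$ by: $t_\theta(\alpha_i)=m_{\theta,i}$, $t_\theta(\theta)=1$, $t_\theta(\beta)=0$ otherwise; and for $\alpha\neq\theta$, $t_\alpha(\alpha_i)=-m_{\alpha,i}$, $t_\alpha(\alpha)=1$, $t_\alpha(\beta)=0$ otherwise. $\Lambda_+=\{\sum_{\alpha\in\Delta^+\setminus\Pi}n_\alpha t_\alpha;\,n_\alpha\in\mathbb{N}_0\}$. *)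

(* Defs.v *)
(* The field of complex numbers is R[i] for R : realType. *)
From HB Require Import structures.
From mathcomp Require Import all_boot all_order all_algebra.
From mathcomp Require Import finmap boolp reals complex.

Set Implicit Arguments.
Unset Strict Implicit.
Unset Printing Implicit Defensive.

Import GRing.Theory.
Local Open Scope ring_scope.
Local Open Scope quotient_scope.

(** * Finite-dimensional Lie algebras *)

Record lieAlgebra (K : fieldType) := LieAlgebra {
  lie_sort :> vectType K;
  lie_br : lie_sort -> lie_sort -> lie_sort;
  lie_br_linearl : forall y, linear (lie_br^~ y);
  lie_br_linearr : forall x, linear (lie_br x);
  lie_br_alt : forall x, lie_br x x = 0;
  lie_br_jacobi : forall x y z,
    lie_br x (lie_br y z) + lie_br y (lie_br z x) + lie_br z (lie_br x y) = 0 }.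

Notation "[[ x , y ]]" := (lie_br x y) (at level 0, format "[[ x ,  y ]]").

(* the dual space H^* of a subspace H *)
Notation dual H := 'Hom(subvs_of H, _^o).

Section LieAlgebra.
Variables (K : fieldType) (g : lieAlgebra K).
Implicit Types (U V H : {vspace g}) (x y : g).

Definition lie_ideal U : Prop := forall x y, y \in U -> [[x, y]] \in U.

Definition lie_subalgebra U : Prop :=
  forall x y, x \in U -> y \in U -> [[x, y]] \in U.

Definition lie_simple : Prop :=
  (exists x y, [[x, y]] != 0) /\
  (forall U, lie_ideal U -> U = 0%VS \/ U = fullv).

Definition lie_isog_sl2 : Prop :=
  exists phi : {linear g -> 'M[K]_2},
    [/\ injective phi,
        forall M : 'M[K]_2, (exists x, phi x = M) <-> \tr M = 0
      & forall x y, phi [[x, y]] = phi x *m phi y - phi y *m phi x].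

Definition lie_prod U V : {vspace g} :=
  <<[seq [[u, v]] | u <- vbasis U, v <- vbasis V]>>%VS.

Definition lie_nilpotent U : Prop :=
  exists k, iter k (lie_prod U) U = 0%VS.

(* nilpotent and self-normalising *)
Definition cartan_subalgebra H : Prop :=
  [/\ lie_subalgebra H, lie_nilpotent H
    & forall x, (forall y, y \in H -> [[x, y]] \in H) -> x \in H].

Definition rootspace H (al : dual H) : {vspace g} :=
  lker (linfun (fun x : g =>
    linfun (fun h : subvs_of H => [[vsval h, x]] - al h *: x))).

Lemma rootspaceP H (al : dual H) x :
  reflect (forall h : subvs_of H, [[vsval h, x]] = al h *: x)
          (x \in rootspace al).
Proof.
pose F x := fun h : subvs_of H => [[vsval h, x]] - al h *: x.
have linF y : linear (F y).
  move=> a u v; rewrite /F !linearP lie_br_linearl scalerDl -scalerA.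
  by rewrite opprD addrACA scalerBr.
pose FH y := HB.pack_for {linear subvs_of H -> g} (F y)
  (GRing.isLinear.Build K (subvs_of H) g *:%R (F y) (linF y)).
have FE y h : linfun (F y) h = F y h by rewrite (lfunE (FH y)).
have linG : linear (fun y => linfun (F y)).
  move=> a u v; apply/lfunP=> h; rewrite !lfunE /= !lfunE /= !FE /F.
  rewrite lie_br_linearr scalerDr opprD addrACA scalerBr !scalerA.
  by rewrite [al h * a]mulrC.
pose G := HB.pack_for {linear g -> 'Hom(subvs_of H, g)} (fun y => linfun (F y))
  (GRing.isLinear.Build K g 'Hom(subvs_of H, g) *:%R _ linG).
rewrite memv_ker (lfunE G) /=; apply: (iffP eqP) => [/lfunP Fx0 h | Fx0].
  by apply/eqP; rewrite -subr_eq0; move: (Fx0 h); rewrite FE lfunE /F /= => ->.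
by apply/lfunP=> h; rewrite FE lfunE /= /F Fx0 subrr.
Qed.
End LieAlgebra.

(** * The Weyl algebra, by generators and relations *)

Section WeylTerms.
Variables (K : comNzRingType) (I : eqType).

Inductive wterm :=
| WConst of K | WX of I | WD of I | WAdd of wterm & wterm | WMul of wterm & wterm.

(* the congruence generated by the axioms of associative unital K-algebras and
   the canonical commutation relations *)
Inductive weq : wterm -> wterm -> Prop :=
| weq_refl s : weq s s
| weq_sym s t : weq s t -> weq t s
| weq_trans s t u : weq s t -> weq t u -> weq s u
| weq_add s s' t t' : weq s s' -> weq t t' -> weq (WAdd s t) (WAdd s' t')
| weq_mul s s' t t' : weq s s' -> weq t t' -> weq (WMul s t) (WMul s' t')
| weq_addA s t u : weq (WAdd s (WAdd t u)) (WAdd (WAdd s t) u)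
| weq_addC s t : weq (WAdd s t) (WAdd t s)
| weq_add0 s : weq (WAdd (WConst 0) s) s
| weq_addN s : weq (WAdd (WMul (WConst (-1)) s) s) (WConst 0)
| weq_mulA s t u : weq (WMul s (WMul t u)) (WMul (WMul s t) u)
| weq_mul1l s : weq (WMul (WConst 1) s) s
| weq_mulDl s t u : weq (WMul (WAdd s t) u) (WAdd (WMul s u) (WMul t u))
| weq_mulDr s t u : weq (WMul s (WAdd t u)) (WAdd (WMul s t) (WMul s u))
| weq_constD a b : weq (WConst (a + b)) (WAdd (WConst a) (WConst b))
| weq_constM a b : weq (WConst (a * b)) (WMul (WConst a) (WConst b))
| weq_constC a s : weq (WMul (WConst a) s) (WMul s (WConst a))
| weq_xx i j : weq (WMul (WX i) (WX j)) (WMul (WX j) (WX i))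
| weq_dd i j : weq (WMul (WD i) (WD j)) (WMul (WD j) (WD i))
| weq_dx i j :
    weq (WMul (WD i) (WX j)) (WAdd (WMul (WX j) (WD i)) (WConst (i == j)%:R)).

HB.instance Definition _ := gen_eqMixin wterm.
HB.instance Definition _ := gen_choiceMixin wterm.

Definition weqb : rel wterm := fun s t => `[< weq s t >].

Lemma weqb_refl : reflexive weqb.
Proof. by move=> s; apply/asboolP/weq_refl. Qed.
Lemma weqb_sym : symmetric weqb.
Proof. by move=> s t; apply/asboolP/asboolP=> /weq_sym. Qed.
Lemma weqb_trans : transitive weqb.
Proof.
by move=> t s u /asboolP st /asboolP tu; apply/asboolP/(weq_trans st tu).
Qed.

Canonical weqb_equiv := EquivRel weqb weqb_refl weqb_sym weqb_trans.

(* An action of the terms on functions (I -> nat) -> K, used only to prove that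
   1 != 0 in the quotient: the monomial with exponent a has coefficient f a. *)
Let fshift (a : I -> nat) i (h : nat -> nat) : I -> nat :=
  fun k => if k == i then h (a k) else a k.

Let Xop i (f : (I -> nat) -> K) a :=
  (a i)%:R * f (fshift a i predn).
Let Dop i (f : (I -> nat) -> K) a := f (fshift a i succn).

Fixpoint weval (t : wterm) (f : (I -> nat) -> K) : (I -> nat) -> K :=
  match t with
  | WConst c => fun a => c * f a
  | WX i => Xop i f
  | WD i => Dop i f
  | WAdd s t => fun a => weval s f a + weval t f a
  | WMul s t => weval s (weval t f)
  end.

Lemma weval_linear t c f h :
  weval t (fun a => c * f a + h a) = (fun a => c * weval t f a + weval t h a).
Proof.
elim: t f h => [k|i|i|s IHs t IHt|s IHs t IHt] f h /=.
- by apply/funext=> a; rewrite mulrDr !mulrA [k * c]mulrC.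
- by apply/funext=> a; rewrite /Xop mulrDr !mulrA [_ * c]mulrC.
- by [].
- by rewrite IHs IHt; apply/funext=> a; rewrite mulrDr addrACA.
- by rewrite IHt IHs.
Qed.

Lemma weval_weq s t : weq s t -> forall f, weval s f = weval t f.
Proof.
elim=> {s t} //=.
- by move=> s t u _ IH1 _ IH2 f; rewrite IH1.
- by move=> s s' t t' _ IH1 _ IH2 f; rewrite IH1 IH2.
- by move=> s s' t t' _ IH1 _ IH2 f; rewrite IH1 IH2.
- by move=> s t u f; apply/funext=> a; rewrite addrA.
- by move=> s t f; apply/funext=> a; rewrite addrC.
- by move=> s f; apply/funext=> a; rewrite mul0r add0r.
- by move=> s f; apply/funext=> a; rewrite mulN1r addNr mul0r.
- by move=> s f; apply/funext=> a; rewrite mul1r.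
- move=> s t u f; rewrite -[LHS]/(weval s _).
  have /= := weval_linear s 1 (weval t f) (weval u f).
  set p := (fun a => 1 * _ + _); have -> : p = (fun a => weval t f a + weval u f a).
    by apply/funext=> a; rewrite /p mul1r.
  by move=> ->; apply/funext=> a; rewrite mul1r.
- by move=> a b f; apply/funext=> x; rewrite mulrDl.
- by move=> a b f; apply/funext=> x; rewrite mulrA.
- move=> c s f.
  have /= := weval_linear s c f (fun=> 0).
  have /= z := weval_linear s (-1) (fun=> 0) (fun=> 0).
  have {z}-> : weval s (fun=> 0) = (fun=> 0).
    rewrite -[X in weval s X](_ : (fun a : I -> nat => -1 * (0 : K) + 0) = _).
      by rewrite z; apply/funext=> a; rewrite mulN1r addNr.
    by apply/funext=> a; rewrite mulr0 addr0.
  set p := (fun a => c * f a + 0); have -> : p = (fun a => c * f a).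
    by apply/funext=> a; rewrite /p addr0.
  by move=> ->; apply/funext=> a; rewrite addr0.
- move=> i j f; have [->//|nij] := eqVneq i j; apply/funext=> a.
  rewrite /Xop /fshift (negbTE nij) eq_sym (negbTE nij) !mulrA.
  rewrite [_%:R * _%:R]mulrC; congr (_ * f _); apply/funext=> k.
  by case: (eqVneq k i) => [->|_]; rewrite ?(negbTE nij).
- move=> i j f; apply/funext=> a; rewrite /Dop /fshift; congr (f _).
  by apply/funext=> k; case: (k == i); case: (k == j).
- move=> i j f; apply/funext=> a; rewrite /Dop /Xop /fshift.
  have [<-|nij] := eqVneq i j.
    rewrite -natr1 mulrDl; congr (_ + _); last first.
      by congr (_ * f _); apply/funext=> k; case: (k == i).
    case ai: (a i) => [|n]; first by rewrite !mul0r.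
    congr (_ * f _); apply/funext=> k.
    by case: (eqVneq k i) => [->|//]; rewrite ai.
  rewrite mul0r addr0; congr (_ * f _); apply/funext=> k.
  by case: (eqVneq k i) => [->|//]; rewrite (negbTE nij).
Qed.

Lemma weq_one_neq0 : ~ weq (WConst 1) (WConst 0).
Proof.
move/weval_weq/(_ (fun=> 1))/(congr1 (fun h => h (fun=> 0%N))) => /eqP.
by rewrite /= mul1r mul0r oner_eq0.
Qed.

Definition weyl := {eq_quot weqb}.
HB.instance Definition _ := Choice.on weyl.
HB.instance Definition _ := EqQuotient.on weyl.
Implicit Types u v w : weyl.

Definition wcls (t : wterm) : weyl := \pi_weyl t.

Lemma wclsP s t : weq s t <-> wcls s = wcls t.
Proof.
split=> [st|/eqmodP /asboolP //]; by apply/eqmodP/asboolP.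
Qed.

Lemma wclsK u : wcls (repr u) = u.
Proof. exact: reprK. Qed.

Lemma wcls_ind (P : weyl -> Prop) : (forall t, P (wcls t)) -> forall u, P u.
Proof. by move=> PT u; rewrite -(wclsK u). Qed.

Definition wadd u v := wcls (WAdd (repr u) (repr v)).
Definition wmul u v := wcls (WMul (repr u) (repr v)).
Definition wopp u := wcls (WMul (WConst (-1)) (repr u)).
Definition wscale (c : K) u := wcls (WMul (WConst c) (repr u)).

Let weq_repr t : weq (repr (wcls t)) t.
Proof. by apply/wclsP; rewrite wclsK. Qed.

Let waddE s t : wadd (wcls s) (wcls t) = wcls (WAdd s t).
Proof. exact/wclsP/weq_add. Qed.
Let wmulE s t : wmul (wcls s) (wcls t) = wcls (WMul s t).
Proof. exact/wclsP/weq_mul. Qed.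
Let woppE s : wopp (wcls s) = wcls (WMul (WConst (-1)) s).
Proof. exact/wclsP/weq_mul/weq_repr/weq_refl. Qed.
Let wscaleE c s : wscale c (wcls s) = wcls (WMul (WConst c) s).
Proof. exact/wclsP/weq_mul/weq_repr/weq_refl. Qed.

Let waddA : associative wadd.
Proof.
elim/wcls_ind=> s; elim/wcls_ind=> t; elim/wcls_ind=> u.
by rewrite !waddE; apply/wclsP/weq_addA.
Qed.
Let waddC : commutative wadd.
Proof.
by elim/wcls_ind=> s; elim/wcls_ind=> t; rewrite !waddE; apply/wclsP/weq_addC.
Qed.
Let wadd0 : left_id (wcls (WConst 0)) wadd.
Proof. by elim/wcls_ind=> s; rewrite waddE; apply/wclsP/weq_add0. Qed.
Let waddN : left_inverse (wcls (WConst 0)) wopp wadd.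
Proof. by elim/wcls_ind=> s; rewrite woppE waddE; apply/wclsP/weq_addN. Qed.

HB.instance Definition _ := GRing.isZmodule.Build weyl waddA waddC wadd0 waddN.

Let wmulA : associative wmul.
Proof.
elim/wcls_ind=> s; elim/wcls_ind=> t; elim/wcls_ind=> u.
by rewrite !wmulE; apply/wclsP/weq_mulA.
Qed.
Let wmul1l : left_id (wcls (WConst 1)) wmul.
Proof. by elim/wcls_ind=> s; rewrite wmulE; apply/wclsP/weq_mul1l. Qed.
Let wmul1r : right_id (wcls (WConst 1)) wmul.
Proof.
elim/wcls_ind=> s; rewrite wmulE; apply/wclsP.
exact: weq_trans (weq_sym (weq_constC _ _)) (weq_mul1l _).
Qed.
Let wmulDl : left_distributive wmul wadd.
Proof.
elim/wcls_ind=> s; elim/wcls_ind=> t; elim/wcls_ind=> u.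
by rewrite !(waddE, wmulE); apply/wclsP/weq_mulDl.
Qed.
Let wmulDr : right_distributive wmul wadd.
Proof.
elim/wcls_ind=> s; elim/wcls_ind=> t; elim/wcls_ind=> u.
by rewrite !(waddE, wmulE); apply/wclsP/weq_mulDr.
Qed.
Let wone_neq0 : wcls (WConst 1) != 0.
Proof. by apply/eqP=> /wclsP/weq_one_neq0. Qed.

HB.instance Definition _ := GRing.Zmodule_isNzRing.Build weyl
  wmulA wmul1l wmul1r wmulDl wmulDr wone_neq0.

Let wscaleA a b u : wscale a (wscale b u) = wscale (a * b) u.
Proof.
elim/wcls_ind: u => s; rewrite !wscaleE; apply/wclsP.
exact: weq_trans (weq_mulA _ _ _) (weq_mul (weq_sym (weq_constM _ _)) (weq_refl _)).
Qed.
Let wscale1 : left_id 1 wscale.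
Proof. by elim/wcls_ind=> s; rewrite wscaleE; apply/wclsP/weq_mul1l. Qed.
Let wscaleDr : right_distributive wscale +%R.
Proof.
move=> a; elim/wcls_ind=> s; elim/wcls_ind=> t.
by rewrite [_ + _]waddE !wscaleE [RHS]waddE; apply/wclsP/weq_mulDr.
Qed.
Let wscaleDl u : {morph wscale^~ u : a b / a + b}.
Proof.
elim/wcls_ind: u => s a b; rewrite !wscaleE [RHS]waddE; apply/wclsP.
exact: weq_trans (weq_mul (weq_constD _ _) (weq_refl _)) (weq_mulDl _ _ _).
Qed.

HB.instance Definition _ := GRing.Zmodule_isLmodule.Build K weyl
  wscaleA wscale1 wscaleDr wscaleDl.

Let wscaleAl a u v : a *: (u * v) = (a *: u) * v.
Proof.
elim/wcls_ind: u => s; elim/wcls_ind: v => t.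
rewrite [LHS](_ : _ = wscale a (wmul (wcls s) (wcls t))) //.
rewrite [RHS](_ : _ = wmul (wscale a (wcls s)) (wcls t)) //.
by rewrite !(wmulE, wscaleE); apply/wclsP/weq_mulA.
Qed.

HB.instance Definition _ := GRing.Lmodule_isLalgebra.Build K weyl wscaleAl.

Let wscaleAr a u v : a *: (u * v) = u * (a *: v).
Proof.
elim/wcls_ind: u => s; elim/wcls_ind: v => t.
rewrite [LHS](_ : _ = wscale a (wmul (wcls s) (wcls t))) //.
rewrite [RHS](_ : _ = wmul (wcls s) (wscale a (wcls t))) //.
rewrite !(wmulE, wscaleE); apply/wclsP.
apply: weq_trans (weq_mulA _ _ _) _; apply: weq_trans (weq_sym (weq_mulA _ _ _)).
exact: weq_mul (weq_constC _ _) (weq_refl _).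
Qed.

HB.instance Definition _ := GRing.Lalgebra_isAlgebra.Build K weyl wscaleAr.

Definition wx i : weyl := wcls (WX i).
Definition wd i : weyl := wcls (WD i).

Lemma wclsD s t : wcls (WAdd s t) = wcls s + wcls t.
Proof. by rewrite [RHS]waddE. Qed.
Lemma wclsM s t : wcls (WMul s t) = wcls s * wcls t.
Proof. by rewrite [RHS]wmulE. Qed.
Lemma wclsC c : wcls (WConst c) = c%:A.
Proof.
rewrite [RHS]wscaleE; apply/wclsP.
by have := weq_constM c 1; rewrite mulr1.
Qed.

Lemma wxx i j : wx i * wx j = wx j * wx i.
Proof. by rewrite -!wclsM; apply/wclsP/weq_xx. Qed.
Lemma wdd i j : wd i * wd j = wd j * wd i.
Proof. by rewrite -!wclsM; apply/wclsP/weq_dd. Qed.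
Lemma wdx i j : wd i * wx j = wx j * wd i + (i == j)%:R%:A.
Proof.
by rewrite -wclsC -!wclsM -wclsD; apply/wclsP/weq_dx.
Qed.
End WeylTerms.

Arguments wx {K I} i.
Arguments wd {K I} i.

(** * Quotient of an algebra by the left ideal generated by a set *)

Section LeftQuotient.
Variables (K : comNzRingType) (A : algType K) (G : A -> Prop).

Inductive lideal : A -> Prop :=
| lideal_gen u : G u -> lideal u
| lideal0 : lideal 0
| lidealD u v : lideal u -> lideal v -> lideal (u + v)
| lidealM a u : lideal u -> lideal (a * u).

Definition lquotb : rel A := fun u v => `[< lideal (u - v) >].

Let lquotb_refl : reflexive lquotb.
Proof. by move=> u; apply/asboolP; rewrite subrr; apply: lideal0. Qed.
Let lidealN u : lideal u -> lideal (- u).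
Proof. by rewrite -mulN1r; apply: lidealM. Qed.
Let lquotb_sym : symmetric lquotb.
Proof. by move=> u v; apply/asboolP/asboolP=> /lidealN; rewrite opprB. Qed.
Let lquotb_trans : transitive lquotb.
Proof.
move=> v u w /asboolP uv /asboolP vw; apply/asboolP.
by rewrite -[u](subrK v) -addrA; apply: lidealD.
Qed.

Canonical lquotb_equiv := EquivRel lquotb lquotb_refl lquotb_sym lquotb_trans.

Definition lquot := {eq_quot lquotb}.
HB.instance Definition _ := Choice.on lquot.
HB.instance Definition _ := EqQuotient.on lquot.
Implicit Types p q : lquot.

Definition lcls (u : A) : lquot := \pi_lquot u.

Lemma lclsP u v : lideal (u - v) <-> lcls u = lcls v.
Proof. by split=> [uv|/eqmodP /asboolP //]; apply/eqmodP/asboolP. Qed.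

Lemma lclsK p : lcls (repr p) = p.
Proof. exact: reprK. Qed.

Lemma lcls_ind (P : lquot -> Prop) : (forall u, P (lcls u)) -> forall p, P p.
Proof. by move=> PT p; rewrite -(lclsK p). Qed.

(* the left A-module structure of A / lideal *)
Definition lact (a : A) p := lcls (a * repr p).

Lemma lactE a u : lact a (lcls u) = lcls (a * u).
Proof.
by apply/lclsP; rewrite -mulrBr; apply/lidealM/lclsP; rewrite lclsK.
Qed.

Let ladd p q := lcls (repr p + repr q).
Let lopp p := lact (-1) p.
Let lscale (c : K) p := lact c%:A p.

Let laddE u v : ladd (lcls u) (lcls v) = lcls (u + v).
Proof.
apply/lclsP; rewrite opprD addrACA.
by apply: lidealD; apply/lclsP; rewrite lclsK.
Qed.

Let laddA : associative ladd.
Proof.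
by elim/lcls_ind=> u; elim/lcls_ind=> v; elim/lcls_ind=> w; rewrite !laddE addrA.
Qed.
Let laddC : commutative ladd.
Proof. by elim/lcls_ind=> u; elim/lcls_ind=> v; rewrite !laddE addrC. Qed.
Let ladd0 : left_id (lcls 0) ladd.
Proof. by elim/lcls_ind=> u; rewrite laddE add0r. Qed.
Let laddN : left_inverse (lcls 0) lopp ladd.
Proof. by elim/lcls_ind=> u; rewrite [lopp _]lactE laddE mulN1r addNr. Qed.

HB.instance Definition _ := GRing.isZmodule.Build lquot laddA laddC ladd0 laddN.

Let lscaleA a b p : lscale a (lscale b p) = lscale (a * b) p.
Proof. by elim/lcls_ind: p => u; rewrite /lscale !lactE !mulr_algl scalerA. Qed.
Let lscale1 : left_id 1 lscale.
Proof. by elim/lcls_ind=> u; rewrite /lscale lactE mulr_algl scale1r. Qed.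
Let lscaleDr : right_distributive lscale +%R.
Proof.
move=> a; elim/lcls_ind=> u; elim/lcls_ind=> v.
by rewrite /lscale [_ + _]laddE !lactE [RHS]laddE mulrDr.
Qed.
Let lscaleDl p : {morph lscale^~ p : a b / a + b}.
Proof.
elim/lcls_ind: p => u a b.
by rewrite /lscale !lactE [RHS]laddE scalerDl mulrDl.
Qed.

HB.instance Definition _ := GRing.Zmodule_isLmodule.Build K lquot
  lscaleA lscale1 lscaleDr lscaleDl.

Lemma lcls_eq0 u : lcls u = 0 <-> lideal u.
Proof. by rewrite -{2}[u]subr0; split=> /lclsP. Qed.
Lemma lclsD u v : lcls (u + v) = lcls u + lcls v.
Proof. by rewrite [RHS]laddE. Qed.
Lemma lclsZ (c : K) u : lcls (c *: u) = c *: lcls u.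
Proof. by rewrite [RHS]lactE mulr_algl. Qed.
End LeftQuotient.

(** * Roots *)

Section Roots.
Variables (K : fieldType) (g : lieAlgebra K) (H : {vspace g}).
Implicit Types (Pi Dp : {fset dual H}) (al be : dual H).

Definition is_root al : Prop := al != 0 /\ rootspace al != 0%VS.

Definition nat_comb Pi (v : dual H) : Prop :=
  exists c : Pi -> nat, v = \sum_(i : Pi) val i *+ c i.

(* a base of the root system (Humphreys): a basis of H^* made of roots, every
   root being a combination of it with integral coefficients of one sign *)
Definition simple_roots Pi : Prop :=
  [/\ basis_of fullv (enum_fset Pi), forall al, al \in Pi -> is_root al
    & forall al, is_root al -> nat_comb Pi al \/ nat_comb Pi (- al)].

Definition positive_roots Pi Dp : Prop :=
  forall al, al \in Dp <-> is_root al /\ nat_comb Pi al.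

(* maximality for the order al <= be iff be - al is in the N-span of Pi *)
Definition maximal_root Pi al : Prop :=
  is_root al /\
  forall be, is_root be -> nat_comb Pi (be - al) -> be = al.

Definition nilpos Dp : {vspace g} := (\sum_(al : Dp) rootspace (val al))%VS.
Definition nilneg Dp : {vspace g} := (\sum_(al : Dp) rootspace (- val al))%VS.

Definition root_basis Dp (f : Dp -> g) : Prop :=
  (forall al : Dp, f al \in rootspace (- val al)) /\
  basis_of (nilneg Dp) (codom f).

Definition rho Dp : dual H := 2%:R^-1 *: \sum_(al : Dp) val al.

End Roots.

(** * The homomorphism pi_mu from g to the Weyl algebra *)

Section PiMu.
Variables (K : fieldType) (g : lieAlgebra K) (H : {vspace g}).
Variables (Dp : {fset dual H}) (f : Dp -> g).

Let A := weyl K Dp.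

(* A (x) g, in coordinates with respect to the basis (vbasis fullv) of g; it
   contains C[nbar] (x) g, the polynomial functions on nbar being the elements of
   the (commutative) subalgebra of A generated by the wx al. *)
Definition tens := {ffun 'I_(\dim {:g}) -> A}.

Definition tens_of (a : g) : tens := [ffun j => (coord (vbasis {:g}) j a)%:A].

(* scalar extension of a linear form on g, and of an endomorphism of g *)
Definition ext_form (phi : g -> K) (v : tens) : A :=
  \sum_(i < \dim {:g}) phi (vbasis {:g})`_i *: v i.
Definition ext_end (L : g -> g) (v : tens) : tens :=
  [ffun j => ext_form (fun y => coord (vbasis {:g}) j (L y)) v].

(* ad(u(x)), u(x) = \sum_al x_al f_al *)
Definition ad_u (v : tens) : tens :=
  \sum_(al : Dp) [ffun j => wx al * ext_end (lie_br (f al)) v j].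

(* The power series with coefficients c at ad(u(x)). As ad(u(x)) is given by a
   nilpotent matrix of size \dim g over a commutative domain, its powers of
   exponent > \dim g vanish. *)
Definition series_ad_u (c : nat -> K) (v : tens) : tens :=
  \sum_(k < (\dim {:g}).+1) c k *: iter k ad_u v.

End PiMu.

Section Todd.
Variable K : fieldType.

(* the first n coefficients of t e^t / (e^t - 1), obtained by solving
   (t e^t / (e^t - 1)) * ((e^t - 1) / t) = e^t *)
Fixpoint todd_seq (n : nat) : seq K :=
  if n is k.+1 then
    let s := todd_seq k in
    rcons s ((k`!%:R)^-1 - \sum_(j < k) s`_j / ((k - j).+1)`!%:R)
  else [::].

Definition todd (k : nat) : K := (todd_seq k.+1)`_k.

Lemma todd_spec k :
  \sum_(j < k.+1) todd j / ((k - j).+1)`!%:R = (k`!%:R)^-1.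
Proof.
have size_todd n : size (todd_seq n) = n by elim: n => //= n; rewrite size_rcons => ->.
have nthE n j : (j < n)%N -> (todd_seq n)`_j = todd j.
  elim: n => // n IHn; rewrite ltnS leq_eqVlt => /predU1P[->//|jn].
  by rewrite /= nth_rcons size_todd jn IHn.
rewrite big_ord_recr /= subnn (_ : 1`! = 1%N) // divr1.
have -> : todd k = (k`!%:R)^-1 - \sum_(j < k) todd j / ((k - j).+1)`!%:R.
  rewrite {1}/todd /= nth_rcons size_todd ltnn eqxx; congr (_ - _).
  by apply: eq_bigr => j _; rewrite nthE.
by rewrite addrC subrK.
Qed.

Definition exp_coef (k : nat) : K := (k`!%:R)^-1.
Definition expN_coef (k : nat) : K := (-1) ^+ k * exp_coef k.

End Todd.

Section PiMuDef.
Variables (K : fieldType) (g : lieAlgebra K) (H : {vspace g}).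
Variables (Dp : {fset dual H}) (f : Dp -> g).

(* projections along g = nbar + H + n *)
Definition proj_nilneg : 'End(g) :=
  daddv_pi (nilneg Dp) (H + nilpos Dp)%VS.
Definition proj_cartan (a : g) : subvs_of H :=
  vsproj H (daddv_pi H (nilneg Dp + nilpos Dp)%VS a).

(* coordinate of y in nbar with respect to f_al *)
Definition coord_f (al : Dp) (y : g) : K :=
  coord (codom_tuple f) (enum_rank al) y.

Definition pi_mu (mu : dual H) (a : g) : weyl K Dp :=
  let v := series_ad_u f (@expN_coef K) (tens_of Dp a) in
  - (\sum_(al : Dp)
       ext_form (coord_f al)
         (series_ad_u f (@todd K) (ext_end proj_nilneg v)) * wd al)
  + ext_form (fun y => (mu + rho Dp) (proj_cartan y)) v.

(** * The Gelfand-Tsetlin module W(lambda) *)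

Variable theta : Dp.

Definition GT_gens (u : weyl K Dp) : Prop :=
  (exists2 al : Dp, al != theta & u = wx al) \/ u = wd theta.

Definition Wmod := lquot GT_gens.

Definition Wact (lam : dual H) (a : g) (v : Wmod) : Wmod :=
  lact (pi_mu (lam + rho Dp) a) v.

Definition w_ (a : Dp -> nat) : Wmod :=
  lcls GT_gens
    ((\prod_(al : Dp | al != theta) wd al ^+ a al) * wx theta ^+ a theta).

Definition mu_ (lam : dual H) (a : Dp -> int) : dual H :=
  - (\sum_(al : Dp | al != theta) val al *~ a al) + val theta *~ a theta
  + lam + val theta.

Variables (Pi : {fset dual H}) (m : Dp -> Pi -> nat).

(* extension by zero of a function on Pi to a function on Dp *)
Definition ext0 (a : Pi -> int) (be : Dp) : int :=
  if insub (val be) is Some i then a i else 0.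

(* t_al, for al in Dp \ Pi *)
Definition t_ (al be : Dp) : int :=
  if insub (val be) is Some i then
    if al == theta then (m al i)%:Z else - (m al i)%:Z
  else (be == al)%:Z.

Definition Lambda_plus (t : Dp -> int) : Prop :=
  exists n : Dp -> nat,
    forall be, t be = \sum_(al : Dp | val al \notin Pi) (n al)%:Z * t_ al be.

Definition shift_t (a : Pi -> int) (n : nat) (be : Dp) : int :=
  ext0 a be + n%:Z * t_ theta be.

(* n is the smallest natural number with a + n t_theta in N^Dp *)
Definition least_shift (a : Pi -> int) (n : nat) : Prop :=
  (forall be, 0 <= shift_t a n be) /\
  (forall k : nat, (forall be, 0 <= shift_t a k be) -> (n <= k)%N).

Definition W_basis (a : Pi -> int) (n : nat) (v : Wmod) : Prop :=
  exists (t : Dp -> int) (b : Dp -> nat),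
    [/\ Lambda_plus t, forall be, (b be)%:Z = shift_t a n be + t be
      & v = w_ b].

End PiMuDef.

Arguments W_basis {K g H Dp} theta {Pi} m a n v.

(** * Bases of subspaces, weights *)

Section Bases.
Variables (K : fieldType) (V : lmodType K).
Implicit Types (B S : V -> Prop).

Definition in_span B (v : V) : Prop :=
  exists (s : seq V) (c : V -> K),
    (forall x, x \in s -> B x) /\ v = \sum_(x <- s) c x *: x.

Definition lin_indep B : Prop :=
  forall (s : seq V) (c : V -> K), uniq s -> (forall x, x \in s -> B x) ->
    \sum_(x <- s) c x *: x = 0 -> forall x, x \in s -> c x = 0.

(* B is a basis of the subspace S *)
Definition subspace_basis S B : Prop :=
  [/\ forall v, B v -> S v, lin_indep B & forall v, S v -> in_span B v].

Definition infinite_dim S : Prop :=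
  ~ exists s : seq V, forall v, S v -> in_span (fun x => x \in s) v.

End Bases.

Section Weights.
Variables (K : fieldType) (g : lieAlgebra K) (H : {vspace g}).
Variables (V : lmodType K) (act : subvs_of H -> V -> V).

Definition weight_space (mu : dual H) (v : V) : Prop :=
  forall h, act h v = (mu h : K) *: v.

Definition is_weight (mu : dual H) : Prop :=
  exists2 v, weight_space mu v & v != 0.

(* V is the direct sum of its weight spaces *)
Definition weight_module : Prop :=
  (forall v, exists (s : seq (dual H)) (c : dual H -> V),
     (forall mu, mu \in s -> weight_space mu (c mu)) /\
     v = \sum_(mu <- s) c mu) /\
  (forall (s : seq (dual H)) (c : dual H -> V), uniq s ->
     (forall mu, mu \in s -> weight_space mu (c mu)) ->
     \sum_(mu <- s) c mu = 0 -> forall mu, mu \in s -> c mu = 0).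

End Weights.

(* Main.v *)
From HB Require Import structures.
Require Import Defs.
From mathcomp Require Import all_boot all_order all_algebra.
From mathcomp Require Import finmap boolp reals complex.
From mathcomp Require Import ring.

(** Every h in the Cartan subalgebra H acts on W(lambda) by the
    Euler operator
      pi(h) = sum_al al(h) x_al d_al + (lambda + 2 rho)(h),
    which is diagonal in the monomials w_b: modulo the left ideal, x_al d_al
    acts on d_al^n by -(n + 1) and x_theta d_theta on x_theta^n by n. So w_b
    has weight mu_b, and since the w_b form a basis of W(lambda), the weight
    space of mu has as basis the w_b with mu_b = mu. The rest is to solve
    mu_b = mu_a for a in Z^Pi and b in N^Dp. Comparing coordinates in the
    base Pi, this says b = a + sum_(al not in Pi) b_al t_al; nonnegativity of b
    at the simple roots forces b_theta >= n_a, whence b lies in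
    a + n_a t_theta + Lambda_+.

    Two facts about g enter this count: theta is not simple, so that t_theta
    exists and moves b within a weight space without end, and every simple root
    occurs in theta, so that a + n t_theta is nonnegative for large n.

    The formula for pi(h) (pi_mu_cartan) rests on ad(u(x)) h =
    sum_al al(h) x_al f_al. This lies in the negative part, which ad(u(x))
    preserves and on which it is nilpotent, so the two power series in pi_mu
    combine to the product of t e^t / (e^t - 1) and (e^(-t) - 1) / t, which
    is -1 (conv_todd).

    That the negative part is preserved, and is complementary to H and the
    positive part, needs the triangular decomposition of g by genuine root
    spaces and the symmetry of the set of roots. Both are derived here from
    simplicity. For x in g and an additive map phi of the field, the polynomial
    in ad x that acts by phi(c) on the generalised eigenspace for c is a
    derivation (spectral_derivation). With phi the complex conjugation, the
    trace of ad x times this derivation is the sum of the |c|^2; if the Killing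
    form vanished, this would be 0, so the eigenvalues of ad x and hence all
    roots would be 0; as the roots span the dual of H, so would be H
    (killing_nonzero). Hence the Killing form is nondegenerate, every derivation
    is inner, and with phi the identity the semisimple part of ad h is ad s
    with s in H; roots do not separate s from h, so ad h is semisimple
    (ad_cartan_semisimple). The Killing form also pairs the root spaces of al
    and -al (root_opp).

    The two facts on theta come from U(nbar) e_theta = g
    (highest_root_generates): all weights lie below theta, in particular the
    simple roots. If theta were simple, it would be the only positive root
    and g would be sl2 (highest_root_not_simple).

    Linear independence of the w_b is seen in the Fock representation: after
    exchanging x_al and d_al for al <> theta, all generators of the left ideal
    become derivatives, W(lambda) maps to polynomials, and w_b goes to a nonzero
    multiple of the monomial of exponent b (wcoef_w_). *)

Set Implicit Arguments.
Unset Strict Implicit.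
Unset Printing Implicit Defensive.
Import Order.TTheory GRing.Theory Num.Theory.
Local Open Scope ring_scope.

(** * Polynomials in a matrix and generalised eigenvectors *)

Section Jordan.
Variables (K : numClosedFieldType) (n : nat) (A : 'M[K]_n.+1).
Implicit Types (p q : {poly K}) (v : 'rV[K]_n.+1) (phi : K -> K).

Lemma trig_mulmx m (S T : 'M[K]_m) : is_trig_mx S -> is_trig_mx T ->
  is_trig_mx (S *m T) /\ forall i, (S *m T) i i = S i i * T i i.
Proof.
move=> /is_trig_mxP St /is_trig_mxP Tt; split.
  apply/is_trig_mxP=> i j ij; rewrite mxE big1 // => l _.
  have [il|li] := ltnP i l; first by rewrite St ?mul0r.
  by rewrite Tt ?mulr0 // (leq_ltn_trans li).
move=> i; rewrite mxE (bigD1 i) //= big1 ?addr0 // => l li.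
have [il|il] := ltnP i l; first by rewrite St ?mul0r.
by rewrite Tt ?mulr0 // ltn_neqAle il andbT.
Qed.

Lemma horner_mx_trig (T : 'M[K]_n.+1) p : is_trig_mx T ->
  is_trig_mx (horner_mx T p) /\ forall i, horner_mx T p i i = p.[T i i].
Proof.
move=> Tt; elim/poly_ind: p => [|p c [IH1 IH2] ].
  by rewrite rmorph0; split; [exact: mx0_is_trig | move=> i; rewrite mxE horner0].
rewrite rmorphD rmorphM /= horner_mx_X horner_mx_C.
have [M1 M2] := trig_mulmx IH1 Tt; split=> [|i].
  apply/is_trig_mxP=> i j ij; rewrite mxE (is_trig_mxP M1) // mxE.
  by rewrite -val_eqE /= (ltn_eqF ij) addr0.
by rewrite mxE M2 IH2 hornerMXaddC !mxE eqxx.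
Qed.

(** Schur triangularisation: the t i are the diagonal entries, which are also
    the roots of the characteristic polynomial, with multiplicities. *)
Lemma trace_horner : exists t : 'I_n.+1 -> K,
  (forall p, \tr (horner_mx A p) = \sum_i p.[t i])
  /\ horner_mx A (\prod_i ('X - (t i)%:P)) = 0.
Proof.
have [P /unitarymx_unit Pu] := Schur A (ltn0Sn n).
rewrite /similar_to /= conjumx // => Tt.
set T := P *m A *m invmx P in Tt.
have AE : A = invmx P *m T *m P by rewrite /T !mulmxA mulVmx // mul1mx mulmxKV.
have hE p : horner_mx A p = invmx P *m horner_mx T p *m P.
  by rewrite {1}AE horner_mx_uconjC.
exists (fun i => T i i); split=> [p|].
  rewrite hE mxtrace_mulC mulmxA mulmxV // mul1mx; apply: eq_bigr => i _.
  by case: (horner_mx_trig p Tt).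
by rewrite hE -char_poly_trig // Cayley_Hamilton mulmx0 mul0mx.
Qed.

Lemma horner_mx_mulmx p q :
  horner_mx A (p * q) = horner_mx A p *m horner_mx A q.
Proof. exact: rmorphM. Qed.

Definition killed p v := v *m horner_mx A p = 0.

Lemma coprimep_XsubC_exp_prod k (s : seq K) c : c \notin s ->
  coprimep (('X - c%:P) ^+ k) (\prod_(d <- s) ('X - d%:P) ^+ k).
Proof.
move=> cs; apply: coprimep_expl.
elim: s cs => [|d s IHs]; first by rewrite big_nil coprimep1.
rewrite inE negb_or big_cons coprimepMr => /andP[cd /IHs->]; rewrite andbT.
by apply/coprimep_expr; rewrite coprimep_XsubC root_XsubC eq_sym.
Qed.

Lemma killed_dvd p q v : p %| q -> killed p v -> killed q v.
Proof.
by case/dvdpP=> r ->; rewrite /killed mulrC horner_mx_mulmx mulmxA => ->; rewrite mul0mx.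
Qed.

Lemma killed_coprime p q v : coprimep p q -> killed (p * q) v ->
  exists v1 v2, [/\ killed p v1, killed q v2 & v = v1 + v2].
Proof.
case/Bezout_eq1_coprimepP=> [ [a b] /= ab1] pqv.
exists (v *m horner_mx A (b * q)), (v *m horner_mx A (a * p)); split.
- rewrite /killed -mulmxA -horner_mx_mulmx.
  by apply: killed_dvd pqv; rewrite -mulrA dvdp_mull // mulrC.
- rewrite /killed -mulmxA -horner_mx_mulmx.
  by apply: killed_dvd pqv; rewrite -mulrA dvdp_mull.
by rewrite -mulmxDr -rmorphD /= addrC ab1 rmorph1 mulmx1.
Qed.

Lemma killed_coprime0 p q v : coprimep p q -> killed p v -> killed q v -> v = 0.
Proof.
case/Bezout_eq1_coprimepP=> [ [a b] /= ab1] pv qv.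
rewrite -[v]mulmx1 -[1%:M](rmorph1 (horner_mx A)) -ab1 rmorphD /= mulmxDr.
by rewrite !(killed_dvd (dvdp_mull _ (dvdpp _))) // addr0.
Qed.

Definition gen_eig k c v := killed (('X - c%:P) ^+ k) v.

Lemma killed_ind k (s : seq K) (P : 'rV[K]_n.+1 -> Prop) v : uniq s ->
  P 0 -> (forall u w, P u -> P w -> P (u + w)) ->
  (forall c u, gen_eig k c u -> P u) ->
  killed (\prod_(c <- s) ('X - c%:P) ^+ k) v -> P v.
Proof.
move=> + P0 PD Pg; elim: s v => [|c s IHs] v /=.
  by move=> _; rewrite big_nil /killed rmorph1 mulmx1 => ->.
case/andP=> cs us; rewrite big_cons => /killed_coprime[].
  exact: coprimep_XsubC_exp_prod.
by move=> v1 [v2 [/Pg P1 /(IHs _ us) P2 ->] ]; apply: PD.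
Qed.

(** Chinese remaindering at the powers of the distinct factors X - c. *)
Lemma interpolation k phi (s : seq K) : uniq s ->
  exists p, forall c, c \in s -> ('X - c%:P) ^+ k %| p - (phi c)%:P.
Proof.
elim: s => [|c s IHs] /=; first by exists 0.
case/andP=> cs /IHs[p pP].
have : coprimep (\prod_(d <- s) ('X - d%:P) ^+ k) (('X - c%:P) ^+ k).
  by rewrite coprimep_sym coprimep_XsubC_exp_prod.
set Q := \prod_(d <- s) _ => /Bezout_eq1_coprimepP[ [a b] /= ab1].
exists (p + a * Q * ((phi c)%:P - p)) => d; rewrite inE => /predU1P[->|ds].
  have -> : p + a * Q * ((phi c)%:P - p) - (phi c)%:P
     = (p - (phi c)%:P) * b * ('X - c%:P) ^+ k.
    have -> : a * Q = 1 - b * ('X - c%:P) ^+ k by rewrite -ab1 addrK.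
    rewrite mulrBl mul1r -mulrA mulrBl mulrC.
    by ring.
  by rewrite dvdp_mull.
rewrite addrAC dvdp_addr ?pP // mulrAC dvdp_mull //.
by rewrite /Q (perm_big _ (perm_to_rem ds)) big_cons /= dvdp_mulr.
Qed.

(** The t i are the eigenvalues of A. The polynomial p interpolates phi to
    high order at each of them, so p(A) acts by phi c on the generalised
    eigenspace for c; functions of A obtained in this way replace the Jordan
    decomposition. *)
Lemma spectral_polynomials : exists t : 'I_n.+1 -> K,
  [/\ forall (P : 'rV[K]_n.+1 -> Prop) v,
        P 0 -> (forall u w, P u -> P w -> P (u + w)) ->
        (forall c u, gen_eig n.+1 c u -> P u) -> P v,
      forall k c v, gen_eig k c v -> v != 0 -> exists i, c = t i
    & forall k phi, exists p,
        (forall c v, gen_eig k c v -> v *m horner_mx A p = phi c *: v) /\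
        \tr (A *m horner_mx A p) = \sum_i t i * phi (t i)].
Proof.
have [t [trt chit] ] := trace_horner.
pose s := [seq t i | i <- enum 'I_n.+1].
have chiE : \prod_i ('X - (t i)%:P) = \prod_(c <- s) ('X - c%:P).
  by rewrite big_map big_enum.
have dvds : \prod_i ('X - (t i)%:P)
    %| \prod_(c <- undup s) ('X - c%:P) ^+ n.+1.
  rewrite chiE [X in X %| _](_ : _ = \prod_(c <- undup s) ('X - c%:P) ^+ count_mem c s).
    elim: (undup s) => [|c r IHr]; rewrite ?big_nil // !big_cons.
    apply: dvdp_mul => //; apply: dvdp_exp2l.
    by rewrite (leq_trans (count_size _ _)) // size_map size_enum_ord.
  by rewrite -big_undup_iterop_count.
have kills v : killed (\prod_i ('X - (t i)%:P)) v by rewrite /killed chit mulmx0.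
have eigt k c v : gen_eig k c v -> v != 0 -> exists i, c = t i.
  move=> cv; have [|] := boolP (c \in s); first by case/mapP=> i _ ->; exists i.
  move=> cs; rewrite (killed_coprime0 _ cv (kills v)) ?eqxx // chiE.
  have := @coprimep_XsubC_exp_prod 1 s c cs.
  rewrite expr1 => /coprimep_expl->//.
exists t; split=> // [P v P0 PD Pg|k phi].
  by apply: (killed_ind (undup_uniq s) P0 PD Pg); apply: killed_dvd (kills v).
have [p pP] := interpolation k.+1 phi (undup_uniq s); exists p; split=> [c v cv|].
  have [->|v0] := eqVneq v 0; first by rewrite mul0mx scaler0.
  have [i ci] := eigt _ _ _ cv v0.
  have /pP dvp : c \in undup s by rewrite mem_undup ci map_f ?mem_enum.
  have : killed (p - (phi c)%:P) v.
    by apply: killed_dvd cv; apply: dvdp_trans dvp; apply: dvdp_exp2l.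
  rewrite /killed rmorphB /= horner_mx_C mulmxBr mul_mx_scalar => /eqP.
  by rewrite subr_eq0 => /eqP.
rewrite -[X in X *m _](horner_mx_X A) -horner_mx_mulmx trt; apply: eq_bigr => i _.
have /pP : t i \in undup s by rewrite mem_undup map_f ?mem_enum.
rewrite exprS => /dvdpP[q]; rewrite mulrCA => /(congr1 (horner^~ (t i))).
rewrite hornerM hornerXsubC subrr mul0r hornerD hornerN hornerC => /eqP.
by rewrite subr_eq0 hornerM hornerX => /eqP->.
Qed.

End Jordan.

(** * Finite-dimensional vector spaces *)

Section VectorSpaces.
Import VectorInternalTheory.
Variables (K : fieldType) (V : vectType K).

(** A subspace of maximal dimension among those on which P holds. *)
Lemma vspace_of_closed (P : V -> Prop) : P 0 ->
  (forall a u v, P u -> P v -> P (a *: u + v)) ->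
  exists U : {vspace V}, forall x, x \in U <-> P x.
Proof.
move=> P0 PD.
pose Q d := `[< exists2 U : {vspace V}, \dim U = d & forall x, x \in U -> P x >].
have exQ : exists d, Q d.
  exists 0%N; apply/asboolP; exists 0%VS; first exact: dimv0.
  by move=> x; rewrite memv0 => /eqP->.
have leQ d : Q d -> (d <= \dim {:V})%N.
  by case/asboolP=> U <- _; apply/dimvS/subvf.
case: (ex_maxnP exQ leQ) => d /asboolP[U dU UP] dmax; exists U => x.
split=> [/UP //|Px].
have : Q (\dim (<[x]> + U))%VS.
  apply/asboolP; exists (<[x]> + U)%VS => // _ /memv_addP[_ /vlineP[a ->] [u /UP Pu ->] ].
  exact: PD.
move/dmax; rewrite -dU => le.
have /eqP-> : (U == <[x]> + U)%VS by rewrite eqEdim addvSr.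
by apply: subvP (addvSl _ _) _ (memv_line _).
Qed.

(** The size is a successor so that square matrices form a nonzero ring. *)
Lemma vspace_coordinates : (0 < \dim {:V})%N ->
  exists n (r : {linear V -> 'rV[K]_n.+1}) (r' : {linear 'rV[K]_n.+1 -> V}),
    cancel r r' /\ cancel r' r.
Proof.
have d_gen d (r : {linear V -> 'rV[K]_d}) (r' : {linear 'rV[K]_d -> V}) :
   (0 < d)%N -> cancel r r' -> cancel r' r ->
   exists n (r : {linear V -> 'rV[K]_n.+1}) (r' : {linear 'rV[K]_n.+1 -> V}),
    cancel r r' /\ cancel r' r.
  by case: d r r' => // d r r' _ rK r'K; exists d, r, r'.
rewrite dimvf => d0; apply: (d_gen _ v2r r2v d0).
  exact: v2rK.
exact: r2vK.
Qed.

End VectorSpaces.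

(** * Lie brackets *)

Section Brackets.
Variables (K : fieldType) (g : lieAlgebra K).
Implicit Types x y z : g.

HB.instance Definition _ x :=
  GRing.isLinear.Build K g g *:%R (lie_br x) (lie_br_linearr x).

Lemma brDl x y z : [[x + y, z]] = [[x, z]] + [[y, z]].
Proof. by have := lie_br_linearl z 1 x y; rewrite !scale1r. Qed.

Lemma br_antisym x y : [[x, y]] = - [[y, x]].
Proof.
have := lie_br_alt (x + y).
rewrite brDl !linearD /= !lie_br_alt add0r addr0 => /eqP.
by rewrite addr_eq0 => /eqP.
Qed.

Lemma brDr z x y : [[z, x + y]] = [[z, x]] + [[z, y]].
Proof. exact: linearD. Qed.
Lemma br0l x : [[0, x]] = 0.
Proof. by rewrite br_antisym linear0 oppr0. Qed.
Lemma br0r x : [[x, 0]] = 0.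
Proof. exact: linear0. Qed.
Lemma brZl a x y : [[a *: x, y]] = a *: [[x, y]].
Proof. by have := lie_br_linearl y a x 0; rewrite !addr0 br0l addr0. Qed.
Lemma brZr a x y : [[x, a *: y]] = a *: [[x, y]].
Proof. exact: linearZ. Qed.
Lemma brNl x y : [[- x, y]] = - [[x, y]].
Proof. by rewrite -scaleN1r brZl scaleN1r. Qed.
Lemma brNr x y : [[x, - y]] = - [[x, y]].
Proof. exact: linearN. Qed.

Lemma br_suml (I : finType) (F : I -> g) y :
  [[\sum_i F i, y]] = \sum_i [[F i, y]].
Proof. by rewrite (big_morph (fun x => [[x, y]]) (fun u v => brDl u v y) (br0l y)). Qed.

(** The Jacobi identity, read as: ad x is a derivation. *)
Lemma br_derivation x y z : [[x, [[y, z]] ]] = [[ [[x, y]], z]] + [[y, [[x, z]] ]].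
Proof.
have /eqP := lie_br_jacobi x y z; rewrite -addrA addr_eq0 => /eqP->.
by rewrite opprD addrC [ [[z, _]] ]br_antisym opprK [ [[z, x]] ]br_antisym brNr opprK.
Qed.

Lemma lie_prod_ind (U V : {vspace g}) (P : g -> Prop) : P 0 ->
  (forall a u v, P u -> P v -> P (a *: u + v)) ->
  (forall u v, u \in U -> v \in V -> P [[u, v]]) ->
  forall x, x \in lie_prod U V -> P x.
Proof.
move=> P0 PD Pbr x; rewrite /lie_prod; set s := [seq _ | _ <- _, _ <- _].
move=> xs; rewrite (coord_span (X := in_tuple s) xs).
elim/big_ind: _ => // [u v|i _]; first by rewrite -{2}[u]scale1r; apply: PD.
rewrite -[_ *: _]addr0; apply: PD => //.
have : s`_i \in s by rewrite mem_nth.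
by case/allpairsP=> -[u v] [/= /vbasis_mem uU /vbasis_mem vV ->]; apply: Pbr.
Qed.

Lemma mem_lie_prod (U V : {vspace g}) u v : u \in U -> v \in V ->
  [[u, v]] \in lie_prod U V.
Proof.
move=> /coord_vbasis -> /coord_vbasis ->.
rewrite linear_sum /=; apply: memv_suml => j _; rewrite brZr; apply: memvZ.
rewrite br_antisym linear_sum /= -sumrN; apply: memv_suml => i _.
rewrite brZr -scalerN -br_antisym; apply: memvZ; apply: memv_span.
by apply: allpairs_f; rewrite mem_nth ?size_tuple.
Qed.

Hypothesis g_simple : lie_simple g.

(** The derived algebra is a nonzero ideal. *)
Lemma simple_perfect x : x \in lie_prod {:g} {:g}.
Proof.
have [ [a [b ab0] ] ideals] := g_simple.
have : lie_ideal (lie_prod {:g} {:g}).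
  by move=> u v _; apply: mem_lie_prod; apply: memvf.
case/ideals=> [L0|->]; last exact: memvf.
by case/negP: ab0; rewrite -memv0 -L0 mem_lie_prod ?memvf.
Qed.

End Brackets.

(** * The Killing form and derivations attached to eigenvalues *)

Section Killing.
Variables (K : numClosedFieldType) (g : lieAlgebra K).
Variables (n : nat) (r : {linear g -> 'rV[K]_n.+1}).
Variables (r' : {linear 'rV[K]_n.+1 -> g}).
Hypotheses (rK : cancel r r') (r'K : cancel r' r).
Implicit Types (x y z : g) (c d : K).

(** Matrices act on row vectors on the right, so products are reversed with
    respect to the composition of endomorphisms. *)
Definition ad_mx x : 'M[K]_n.+1 := lin1_mx (r \o lie_br x \o r').

Lemma mul_ad_mx x y : r y *m ad_mx x = r [[x, y]].
Proof. by rewrite mul_rV_lin1 /= rK. Qed.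

Lemma mx_ext (M N : 'M[K]_n.+1) : (forall y, r y *m M = r y *m N) -> M = N.
Proof.
move=> MN; apply/row_matrixP=> i; rewrite !rowE.
by rewrite -[delta_mx _ _]r'K MN.
Qed.

Lemma ad_mx_linear : linear ad_mx.
Proof.
by move=> a x y; apply/matrixP=> i j; rewrite !mxE /= brDl brZl linearP !mxE.
Qed.

HB.instance Definition _ := GRing.isLinear.Build K g 'M[K]_n.+1 *:%R ad_mx ad_mx_linear.

Lemma ad_mx_br x y : ad_mx [[x, y]] = ad_mx y *m ad_mx x - ad_mx x *m ad_mx y.
Proof.
apply: mx_ext => z; rewrite mulmxBr !mulmxA !mul_ad_mx br_derivation.
by rewrite linearD /= addrK.
Qed.

Definition killing_form x y : K := \tr (ad_mx x *m ad_mx y).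

Lemma killing_sym x y : killing_form x y = killing_form y x.
Proof. exact: mxtrace_mulC. Qed.

Lemma killing_linearr x : linear (killing_form x : g -> K^o).
Proof. by move=> a u v; rewrite /killing_form linearP mulmxDr -scalemxAr linearP. Qed.

HB.instance Definition _ x :=
  GRing.isLinear.Build K g K^o *:%R (killing_form x : g -> K^o) (killing_linearr x).

Lemma killing_linearl a x y z : killing_form (a *: x + y) z = a * killing_form x z + killing_form y z.
Proof. by rewrite killing_sym killing_linearr !(killing_sym z). Qed.

Lemma killing_invariant x y z : killing_form [[x, y]] z = killing_form x [[y, z]].
Proof.
rewrite /killing_form !ad_mx_br mulmxBl mulmxBr !linearB /= !mulmxA; congr (_ - _).
by rewrite mxtrace_mulC !mulmxA mxtrace_mulC !mulmxA.
Qed.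

(** Invariance of the trace, for a matrix D that need not be inner. *)
Lemma trace_br_der (D : 'M[K]_n.+1) y z :
  \tr (ad_mx [[y, z]] *m D) = \tr (ad_mx y *m (D *m ad_mx z - ad_mx z *m D)).
Proof.
rewrite ad_mx_br mulmxBl mulmxBr !linearB /= !mulmxA; congr (_ - _).
by rewrite -[ad_mx z *m ad_mx y *m D]mulmxA mxtrace_mulC.
Qed.

Let shift x c y := [[x, y]] - c *: y.

Let shift_iter_linear x c k :
  (forall u v, iter k (shift x c) (u + v) = iter k (shift x c) u + iter k (shift x c) v)
  /\ iter k (shift x c) 0 = 0.
Proof.
elim: k => [|k [IH1 IH2] ] //=; split=> [u v|].
  by rewrite IH1 /shift brDr scalerDr opprD addrACA.
by rewrite IH2 /shift br0r scaler0 subrr.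
Qed.

Let gen_eig_iter x c k y :
  gen_eig (ad_mx x) k c (r y) <-> iter k (shift x c) y = 0.
Proof.
suff -> : gen_eig (ad_mx x) k c (r y) <-> r (iter k (shift x c) y) = 0.
  by split=> [/(congr1 r')|->]; rewrite ?linear0 // rK.
rewrite /gen_eig /killed; suff -> : r y *m horner_mx (ad_mx x) (('X - c%:P) ^+ k) =
  r (iter k (shift x c) y) by [].
elim: k y => [|k IHk] y; first by rewrite rmorph1 mulmx1.
rewrite exprS horner_mx_mulmx mulmxA rmorphB /= horner_mx_X horner_mx_C.
rewrite mulmxBr mul_mx_scalar mul_ad_mx -linearZ -linearB /= IHk.
by rewrite -iterS iterSr.
Qed.

(** The Leibniz rule: (ad x - c - d) [y, z] =
    [(ad x - c) y, z] + [y, (ad x - d) z], iterated j + k times. *)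
Lemma gen_eig_br x c d j k y z :
  gen_eig (ad_mx x) j c (r y) -> gen_eig (ad_mx x) k d (r z) ->
  gen_eig (ad_mx x) (j + k) (c + d) (r [[y, z]]).
Proof.
move=> /gen_eig_iter yj /gen_eig_iter zk; apply/gen_eig_iter.
have [m] := ubnP (j + k); elim: m j k y z yj zk => // m IHm j k y z yj zk.
rewrite ltnS => jkm.
case: j => [|j] in yj jkm *; first by rewrite -[y]/(iter 0 (shift x c) y) yj br0l
  (shift_iter_linear _ _ _).2.
case: k => [|k] in zk jkm *; first by rewrite -[z]/(iter 0 (shift x d) z) zk br0r
  (shift_iter_linear _ _ _).2.
have -> : iter (j.+1 + k.+1) (shift x (c + d)) [[y, z]] =
  iter (j + k.+1) (shift x (c + d)) ([[shift x c y, z]] + [[y, shift x d z]]).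
  rewrite addSn iterSr; congr iter; rewrite /shift br_derivation.
  by rewrite brDl brDr brNl brNr brZl brZr scalerDl addrACA opprD.
rewrite (shift_iter_linear _ _ _).1 (IHm j k.+1) //; last by rewrite -iterSr.
by rewrite add0r addnS -addSn (IHm j.+1 k) // -?iterSr // addSn -addnS.
Qed.

Definition derivation_mx (D : 'M[K]_n.+1) := forall y z,
  r [[y, z]] *m D = r [[r' (r y *m D), z]] + r [[y, r' (r z *m D)]].

Lemma ad_mx_der D z : derivation_mx D ->
  ad_mx (r' (r z *m D)) = ad_mx z *m D - D *m ad_mx z.
Proof.
move=> derD; apply: mx_ext => y; rewrite mulmxBr !mulmxA !mul_ad_mx derD.
by rewrite -[r y *m D]r'K mul_ad_mx !r'K addrK.
Qed.

(** The bracket of generalised eigenvectors for c and d is one for c + d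
    (gen_eig_br), and phi is additive, so the map acting by phi c on the
    generalised eigenspace of ad x for c is a derivation. *)
Lemma spectral_derivation x phi : {morph phi : c d / c + d} ->
  exists D (t : 'I_n.+1 -> K),
  [/\ derivation_mx D,
      forall k c y, (k <= n.+1)%N -> gen_eig (ad_mx x) k c (r y) -> r y *m D = phi c *: r y,
      \tr (ad_mx x *m D) = \sum_i t i * phi (t i),
      forall c y, [[x, y]] = c *: y -> y != 0 -> exists i, c = t i
    & forall (P : g -> Prop) y, P 0 -> (forall u v, P u -> P v -> P (u + v)) ->
      (forall c u, gen_eig (ad_mx x) n.+1 c (r u) -> P u) -> P y].
Proof.
move=> phiD.
(* the bracket of two generalised eigenvectors of order n.+1 has order n.+1 + n.+1 *)
have [t [tind teig /(_ (n.+1 + n.+1)%N phi)[p [pphi ptr] ] ] ] := spectral_polynomials (ad_mx x).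
have indg (P : g -> Prop) y : P 0 -> (forall u v, P u -> P v -> P (u + v)) ->
    (forall c u, gen_eig (ad_mx x) n.+1 c (r u) -> P u) -> P y.
  move=> P0 PD Pg; rewrite -[y]rK; move: (r y) => v.
  apply: (tind (fun v => P (r' v))) => [|u w Pu Pw|c u cu]; first by rewrite linear0.
    by rewrite linearD; apply: PD.
  by apply: (Pg c); rewrite r'K.
exists (horner_mx (ad_mx x) p), t; split=> //; last first.
- move=> c y xy y0; have : r y != 0 by rewrite -(inj_eq (can_inj rK)) linear0 in y0 *.
  by apply: (teig 1%N); apply/gen_eig_iter; rewrite /= /shift xy subrr.
- move=> k c y kn yc; apply: pphi; apply: killed_dvd yc; apply: dvdp_exp2l.
  exact: leq_trans kn (leq_addr _ _).
move=> y z; set D := horner_mx _ _.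
have Dg c u : gen_eig (ad_mx x) n.+1 c (r u) -> r' (r u *m D) = phi c *: u.
  move=> cu; rewrite /D (pphi c) ?linearZ /= ?rK //.
  by apply: killed_dvd cu; apply: dvdp_exp2l; apply: leq_addr.
apply: (indg (fun y => r [[y, z]] *m D = r [[r' (r y *m D), z]] + r [[y, r' (r z *m D)]]));
  [by rewrite !(br0l, br0r, linear0, mul0mx) addr0| |].
  by move=> u v IHu IHv; rewrite !(brDl, linearD, mulmxDl) /= IHu IHv addrACA.
move=> c u cu.
apply: (indg (fun z => r [[u, z]] *m D = r [[r' (r u *m D), z]] + r [[u, r' (r z *m D)]]));
  [by rewrite !(br0l, br0r, linear0, mul0mx) addr0| |].
  by move=> a b IHa IHb; rewrite !(brDr, linearD, mulmxDl) /= IHa IHb addrACA.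
move=> d v dv; have -> : r [[u, v]] *m D = phi (c + d) *: r [[u, v]].
  by apply: pphi; apply: gen_eig_br.
by rewrite phiD scalerDl (Dg c u cu) (Dg d v dv) brZl brZr !linearZ.
Qed.

End Killing.

Section RootSpaces.
Variables (K : fieldType) (g : lieAlgebra K) (H : {vspace g}).
Implicit Types (al be : 'Hom(subvs_of H, K^o)) (x y : g) (h : subvs_of H).

Lemma rootspace_br al be x y : x \in rootspace al -> y \in rootspace be ->
  [[x, y]] \in rootspace (al + be).
Proof.
move=> /rootspaceP xal /rootspaceP ybe; apply/rootspaceP=> h.
by rewrite br_derivation xal ybe brZl brZr -scalerDl !lfunE.
Qed.

Lemma root_neq0 al : is_root al -> exists2 x, x \in rootspace al & x != 0.
Proof. by case=> _; rewrite -vpick0 => al0; exists (vpick (rootspace al)); rewrite ?memv_pick. Qed.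

Lemma is_rootP al x : al != 0 -> x \in rootspace al -> x != 0 -> is_root al.
Proof. by move=> al0 xal x0; split=> //; apply: contraNneq x0 => al1; rewrite al1 memv0 in xal. Qed.

End RootSpaces.

(** * Semisimplicity of the adjoint action of a Cartan subalgebra *)

Section Cartan.
Variables (K : numClosedFieldType) (g : lieAlgebra K).
Hypothesis g_simple : lie_simple g.
Variables (n : nat) (r : {linear g -> 'rV[K]_n.+1}).
Variables (r' : {linear 'rV[K]_n.+1 -> g}).
Hypotheses (rK : cancel r r') (r'K : cancel r' r).
Variable H : {vspace g}.
Hypothesis H_cartan : cartan_subalgebra H.
Hypothesis roots_separate :
  forall h : subvs_of H, (forall al, is_root al -> al h = 0) -> h = 0.
Implicit Types (al be : 'Hom(subvs_of H, K^o)) (x y : g) (h : subvs_of H).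

Local Notation adm := (ad_mx r r').
Local Notation kappa := (killing_form r r').

Lemma cartan_selfnormalizing x : (forall y, y \in H -> [[x, y]] \in H) -> x \in H.
Proof. by case: H_cartan => _ _; apply. Qed.

(** Let D be the spectral derivation of ad h for the complex conjugation. If the
    form vanished, z |-> tr (ad z D) would vanish on brackets, hence on the
    perfect algebra g; at z = h this trace is the sum of the |c|^2 over the
    eigenvalues c of ad h. So all roots would vanish on H, forcing H = 0,
    which is not self-normalising. *)
Lemma killing_nonzero : ~ (forall x y, kappa x y = 0).
Proof.
move=> k0.
have nilp h al : is_root al -> al h = 0.
  case/root_neq0=> x /rootspaceP/(_ h) hx x0.
  have [D [t [derD _ trD /(_ _ _ hx x0)[i ->] _] ] ] :=
    spectral_derivation rK r'K (vsval h) (@rmorphD _ _ (@Num.conj K)).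
  suff tr0 z : \tr (adm z *m D) = 0.
    move: trD; rewrite tr0 => /esym/eqP; rewrite psumr_eq0 => [|j _]; last exact: mul_conjC_ge0.
    by move/allP/(_ i (mem_index_enum _)); rewrite mul_conjC_eq0 => /eqP.
  apply: (lie_prod_ind (P := fun z => \tr (adm z *m D) = 0)) (simple_perfect g_simple z).
  - by rewrite linear0 mul0mx linear0.
  - by move=> a u v u0 v0; rewrite linearP mulmxDl -scalemxAl linearP /= u0 v0 mulr0 addr0.
  move=> u v _ _; rewrite (trace_br_der rK r'K) -[_ - _]opprB -(ad_mx_der rK r'K v derD).
  rewrite mulmxN linearN /=; apply/eqP; rewrite oppr_eq0; apply/eqP.
  exact: k0.
have h0 h : h = 0 by apply: roots_separate => al; apply: nilp.
have H0 y : y \in H -> y = 0.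
  by move=> yH; have := h0 (Subvs yH) => /(congr1 vsval).
have [ [a [b] ] + _] := g_simple; case/negP; apply/eqP.
rewrite (H0 a) ?br0l //; apply: cartan_selfnormalizing => y /H0->.
by rewrite br0r mem0v.
Qed.

(** The radical of an invariant form is an ideal. *)
Lemma killing_nondegenerate x : (forall y, kappa x y = 0) -> x = 0.
Proof.
have [U UP] : exists U : {vspace g}, forall x, x \in U <-> forall y, kappa x y = 0.
  apply: vspace_of_closed => [y|a u v u0 v0 y]; last by rewrite killing_linearl u0 v0 mulr0 addr0.
  by rewrite killing_sym linear0.
have [_ /(_ U)[| U0 | Uf] ] := g_simple.
- by move=> u v /UP v0; apply/UP => y; rewrite killing_sym -killing_invariant // killing_sym v0.
- by move/UP; rewrite U0 memv0 => /eqP.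
by case: killing_nonzero => u; apply/UP; rewrite Uf memvf.
Qed.

(** Every root vanishes on brackets of elements of H, and roots separate H. *)
Lemma cartan_commutes x y : x \in H -> y \in H -> [[x, y]] = 0.
Proof.
move=> xH yH; have [/(_ _ _ xH yH) xyH _ _] := H_cartan.
suff /(congr1 vsval) : Subvs xyH = 0 by [].
apply: roots_separate => al /root_neq0[z /rootspaceP zal z0].
have := br_derivation x y z; rewrite [ [[ [[x, y]], z]] ](zal (Subvs xyH)).
rewrite [ [[y, z]] ](zal (Subvs yH)) [ [[x, z]] ](zal (Subvs xH)) !brZr.
rewrite [ [[y, z]] ](zal (Subvs yH)) [ [[x, z]] ](zal (Subvs xH)) !scalerA mulrC.
move/eqP; rewrite -subr_eq subrr eq_sym scaler_eq0 (negbTE z0) orbF.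
by move/eqP.
Qed.

(** As the Killing form is nondegenerate, z |-> tr (D ad z) is kappa s for some s.
    For E = D - ad s, kappa (E x) y = tr (E ad [x, y]) = 0 by invariance, so
    E = 0. *)
Lemma derivation_inner D : derivation_mx r r' D -> exists s, D = adm s.
Proof.
move=> derD.
pose M : 'M[K]_n.+1 := \matrix_(i, j) kappa (r' (delta_mx 0 i)) (r' (delta_mx 0 j)).
have ME x : r x *m M = \row_j kappa x (r' (delta_mx 0 j)).
  apply/rowP=> j; rewrite !mxE killing_sym -{2}[x]rK [in RHS](matrix_sum_delta (r x)) big_ord1.
  rewrite !linear_sum /=; apply: eq_bigr => i _.
  by rewrite !linearZ /= mxE killing_sym.
have [N MN] : exists N, N *m M = 1%:M.
  apply/row_fullP; rewrite row_full_unit -row_free_unit; apply: inj_row_free => v.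
  rewrite -[v]r'K ME => v0; rewrite (killing_nondegenerate (x := r' v)) ?linear0 // => y.
  rewrite -[y]rK (matrix_sum_delta (r y)) big_ord1 !linear_sum big1 //= => j _.
  by rewrite !linearZ /=; move/rowP/(_ j): v0; rewrite !mxE => ->; rewrite scaler0.
pose l := \row_j \tr (D *m adm (r' (delta_mx 0 j))); pose s := r' (l *m N).
have sP y : kappa s y = \tr (D *m adm y).
  have : r s *m M = l by rewrite r'K -mulmxA MN mulmx1.
  rewrite ME => sl; rewrite -[y]rK (matrix_sum_delta (r y)) big_ord1 !linear_sum /=.
  apply: eq_bigr => j _.
  by rewrite !linearZ /=; move/rowP/(_ j): sl; rewrite !mxE => ->.
exists s; apply: (mx_ext r'K) => x.
suff /eqP : r' (r x *m D) - [[s, x]] = 0.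
  by rewrite subr_eq0 => /eqP e; rewrite (mul_ad_mx rK) -e r'K.
apply: killing_nondegenerate => y; apply/eqP.
rewrite killing_sym linearB subr_eq0 /= -killing_sym -[X in _ == X]killing_sym; apply/eqP.
rewrite (killing_invariant rK r'K) sP (ad_mx_br rK r'K) /killing_form (ad_mx_der rK r'K _ derD).
rewrite mulmxBl mulmxBr !linearB /= !mulmxA; congr (_ - _).
by rewrite [RHS]mxtrace_mulC mulmxA.
Qed.

(** The semisimple part of ad h is a derivation, hence ad s with s in the
    self-normalising H. Every root takes the same value on s and on h, so
    s = h, and the generalised eigenvectors of ad h are eigenvectors. *)
Lemma ad_cartan_semisimple h (P : g -> Prop) : P 0 ->
  (forall u v, P u -> P v -> P (u + v)) ->
  (forall c u, [[vsval h, u]] = c *: u -> P u) -> forall y, P y.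
Proof.
move=> P0 PD Pe y.
have [D [_ [derD geigD _ _ indg] ] ] :=
  spectral_derivation rK r'K (vsval h) (phi := id) (fun _ _ => erefl).
have [s Ds] := derivation_inner derD.
have sE c u k : (k <= n.+1)%N ->
    gen_eig (adm (vsval h)) k c (r u) -> [[s, u]] = c *: u.
  move=> kn cu; apply: (can_inj rK).
  by rewrite -(mul_ad_mx rK) -Ds (geigD k c) // linearZ.
have sE1 c u : [[vsval h, u]] = c *: u -> [[s, u]] = c *: u.
  move=> hu; apply: (sE _ _ 1%N) => //.
  rewrite /gen_eig /killed expr1 rmorphB /= horner_mx_X horner_mx_C mulmxBr.
  by rewrite mul_mx_scalar (mul_ad_mx rK) hu linearZ subrr.
have sH : s \in H.
  apply: cartan_selfnormalizing => z zH.
  by rewrite (sE1 0) ?scale0r ?mem0v // cartan_commutes // subvsP.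
have sh : Subvs sH = h.
  apply/eqP; rewrite -subr_eq0; apply/eqP/roots_separate => al.
  case/root_neq0=> x /rootspaceP xal x0.
  have /eqP := xal (Subvs sH); rewrite /= (sE1 _ _ (xal h)) -subr_eq0 -scalerBl.
  rewrite scaler_eq0 (negbTE x0) orbF subr_eq0 => /eqP e.
  by rewrite linearB /= e subrr.
apply: indg => // c u cu; apply: (Pe c).
by rewrite -(sE _ _ _ (leqnn _) cu) -sh.
Qed.

Lemma ad_mx_diagonalizable h : diagonalizable (adm (vsval h)).
Proof.
have [_ [t [_ _ _ teig _] ] ] :=
  spectral_derivation rK r'K (vsval h) (phi := id) (fun _ _ => erefl).
pose s := undup [seq t i | i <- enum 'I_n.+1].
apply/diagonalizableP; exists s; first exact: undup_uniq.
apply: mxminpoly_min; apply: (mx_ext r'K) => y; rewrite mulmx0; move: y.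
apply: (ad_cartan_semisimple (h := h)) => [|u v Pu Pv|c u hu].
- by rewrite linear0 mul0mx.
- by rewrite linearD mulmxDl Pu Pv addr0.
have [->|u0] := eqVneq u 0; first by rewrite linear0 mul0mx.
have [i ci] := teig _ _ hu u0.
have cs : c \in s by rewrite mem_undup ci map_f ?mem_enum.
rewrite (perm_big _ (perm_to_rem cs)) big_cons horner_mx_mulmx mulmxA.
rewrite rmorphB /= horner_mx_X horner_mx_C mulmxBr mul_mx_scalar (mul_ad_mx rK).
by rewrite hu linearZ subrr mul0mx.
Qed.

Lemma weight_basis : exists (e : 'I_n.+1 -> g) (w : 'I_n.+1 -> 'Hom(subvs_of H, K^o)),
  (forall j, e j \in rootspace (w j)) /\
  forall x, exists c : 'I_n.+1 -> K, x = \sum_j c j *: e j.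
Proof.
have [P Pu /allP Pdiag] : codiagonalizable [seq adm b | b <- vbasis H].
  apply/codiagonalizableP; split=> [_ _ /mapP[b bH ->] /mapP[b' b'H ->]|_ /mapP[b bH ->] ].
    apply/eqP; rewrite eq_sym /comm_mx -subr_eq0 -(ad_mx_br rK r'K).
    by rewrite cartan_commutes ?vbasis_mem // linear0.
  exact: (ad_mx_diagonalizable (Subvs (vbasis_mem bH))).
have diagH h : is_diag_mx (P *m adm (vsval h) *m invmx P).
  rewrite (coord_vbasis (subvsP h)) linear_sum mulmx_sumr mulmx_suml.
  apply/is_diag_mxP => i j ij; rewrite summxE big1 // => k _.
  rewrite linearZ /= -scalemxAr -scalemxAl mxE.
  have := Pdiag (adm (vbasis H)`_k); rewrite map_f ?mem_nth ?size_tuple // => /(_ isT).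
  by rewrite /similar_to /= conjumx // => /is_diag_mxP->; rewrite ?mulr0.
pose e j := r' (row j P); pose w_fun j h : K := (P *m adm (vsval h) *m invmx P) j j.
have w_lin j : linear (w_fun j : subvs_of H -> K^o).
  move=> a u v; rewrite /w_fun !linearP /=.
  by rewrite mulmxDl -scalemxAl !mxE.
pose wl j := GRing.isLinear.Build K (subvs_of H) K^o *:%R _ (w_lin j).
pose wL j := HB.pack_for {linear subvs_of H -> K^o} (w_fun j) (wl j).
exists e, (fun j => linfun (wL j)); split=> [j|x].
  apply/rootspaceP=> h; rewrite lfunE /=; apply: (can_inj rK).
  rewrite linearZ /= -(mul_ad_mx rK) !r'K.
  have : P *m adm (vsval h) = diag_mx (\row_k (P *m adm (vsval h) *m invmx P) k k) *m P.
    rewrite -[LHS](mulmxKV Pu); congr (_ *m _); apply/matrixP => i; move=> k.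
    rewrite !mxE; have [->|ik] := eqVneq i k; first by rewrite mulr1n.
    by rewrite mulr0n; move/is_diag_mxP: (diagH h) => /(_ i k ik); rewrite mxE.
  by move/(congr1 (row j)); rewrite !row_mul row_diag_mx -scalemxAl -rowE mxE.
exists (fun j => (r x *m invmx P) 0 j); apply: (can_inj rK).
rewrite -[LHS](mulmxKV Pu) {1}(row_sum_delta (r x *m invmx P)).
rewrite mulmx_suml linear_sum; apply: eq_bigr => j _.
by rewrite linearZ /= r'K -scalemxAl rowE.
Qed.

End Cartan.

(** * Independence of weight vectors *)

Section WeightVectors.
Variables (K : fieldType) (g : lieAlgebra K) (H : {vspace g}) (V : lmodType K).
Variable act : subvs_of H -> V -> V.
Hypothesis act_linear : forall h, linear (act h).

(** Induction on s: applying act h - mu h, for mu the first weight, removes one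
    term and multiplies each other one by a scalar nonzero for a suitable h. *)
Lemma weight_vectors_independent (s : seq 'Hom(subvs_of H, K^o))
    (c : 'Hom(subvs_of H, K^o) -> V) : uniq s ->
  (forall mu, mu \in s -> weight_space act mu (c mu)) ->
  \sum_(mu <- s) c mu = 0 -> forall mu, mu \in s -> c mu = 0.
Proof.
elim: s c => // mu s IHs c /= /andP[mus us] cw.
rewrite big_cons => c0.
have act0 h : act h 0 = 0 by have := act_linear h (-1) 0 0; rewrite scaler0 addr0 scaleN1r addNr.
have actD h u v : act h (u + v) = act h u + act h v.
  by have := act_linear h 1 u v; rewrite !scale1r.
have actZ h a u : act h (a *: u) = a *: act h u.
  by have := act_linear h a u 0; rewrite !addr0 act0 addr0.
have cs0 nu : nu \in s -> c nu = 0.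
  move=> nus; have numu : nu != mu by apply: contraNneq mus => <-.
  have [h nuh] : exists h, nu h != mu h.
    apply/not_existsP => e; case/eqP: numu; apply/lfunP => h.
    by apply/eqP; apply: contra_notT (e h).
  have := IHs (fun nu => (nu h - mu h) *: c nu) us; apply: contraPeq => cnu.
  move=> /(_ _ _ nu nus) IH; have /eqP : (nu h - mu h) *: c nu = 0.
    apply: IH => [ka kas h'|].
      by rewrite actZ cw ?inE ?kas ?orbT // !scalerA mulrC.
    have : act h (c mu + \sum_(j <- s) c j) - mu h *: (c mu + \sum_(j <- s) c j) = 0.
      by rewrite c0 act0 scaler0 subrr.
    rewrite actD cw ?inE ?eqxx // scalerDr opprD addrACA subrr add0r => e0; rewrite -[RHS]e0.
    rewrite scaler_sumr (big_morph _ (actD h) (act0 h)) -sumrB.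
    by apply: eq_big_seq => ka kas; rewrite scalerBl cw // inE kas orbT.
  by rewrite scaler_eq0 subr_eq0 (negbTE nuh) (negbTE cnu).
move=> nu; rewrite inE => /predU1P[->|/cs0 //].
by move: c0; rewrite big_seq big1 ?addr0.
Qed.

End WeightVectors.

Section SumsOfRootSpaces.
Variables (K : fieldType) (g : lieAlgebra K) (H : {vspace g}).
Implicit Types (al be mu : 'Hom(subvs_of H, K^o)) (s : seq 'Hom(subvs_of H, K^o)).

Lemma rootspaces_independent s (c : 'Hom(subvs_of H, K^o) -> g) : uniq s ->
  (forall mu, mu \in s -> c mu \in rootspace mu) ->
  \sum_(mu <- s) c mu = 0 -> forall mu, mu \in s -> c mu = 0.
Proof.
move=> us cs; apply: (weight_vectors_independent (act := fun h x => [[vsval h, x]])) => //.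
  by move=> h; apply: lie_br_linearr.
by move=> mu /cs /rootspaceP.
Qed.

Lemma mem_sum_rootspaces s x : x \in (\sum_(mu <- s) rootspace mu)%VS ->
  exists c : 'Hom(subvs_of H, K^o) -> g, (forall mu, c mu \in rootspace mu) /\
    x = \sum_(mu <- undup s) c mu.
Proof.
elim: s x => [|al s IHs] x.
  rewrite big_nil memv0 => /eqP->; exists (fun=> 0).
  by split=> [mu|]; rewrite ?mem0v // big_nil.
rewrite big_cons => /memv_addP[y yal [_ /IHs[c [cr ->] ] ->] ] /=.
case: ifP => als.
  exists (fun mu => c mu + if mu == al then y else 0); split=> [mu|].
    by case: eqP => [->|_]; rewrite memvD ?cr ?mem0v.
  rewrite big_split /= addrC; congr (_ + _).
  rewrite (bigD1_seq al) ?mem_undup ?undup_uniq //= ?eqxx big1 ?addr0 // => be.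
  by move/negbTE->.
exists (fun mu => if mu == al then y else c mu); split=> [mu|].
  by case: eqP => [->|_]; rewrite ?cr.
rewrite big_cons eqxx; congr (_ + _); rewrite !big_seq; apply: eq_bigr => be.
by rewrite mem_undup; case: eqP => // ->; rewrite als.
Qed.

Lemma disjoint_sums_rootspaces s1 s2 : (forall mu, mu \in s1 -> mu \notin s2) ->
  ((\sum_(mu <- s1) rootspace mu) :&: (\sum_(mu <- s2) rootspace mu) = 0)%VS.
Proof.
move=> s12; apply/eqP; rewrite -subv0; apply/subvP => x.
rewrite memv_cap memv0 => /andP[/mem_sum_rootspaces[c [cr xc] ] /mem_sum_rootspaces[d [dr xd] ] ].
pose e mu := if mu \in s1 then c mu else - d mu.
have e0 mu : mu \in undup s1 ++ undup s2 -> e mu = 0.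
  apply: rootspaces_independent => [|nu _|].
  - rewrite cat_uniq !undup_uniq andbT; apply/hasPn => nu.
    by rewrite !mem_undup; apply: contraTN => /s12.
  - by rewrite /e; case: ifP; rewrite ?memvN.
  rewrite big_cat /= (eq_big_seq c) => [|nu]; last by rewrite mem_undup /e => ->.
  rewrite -xc [X in _ + X](eq_big_seq (fun nu => - d nu)) => [|nu].
    by rewrite sumrN -xd subrr.
  by rewrite mem_undup /e; case: ifP => // /s12/negbTE->.
rewrite xc big_seq big1 // => mu; rewrite mem_undup => mus.
by have := e0 mu; rewrite mem_cat mem_undup mus /e mus => ->.
Qed.

Lemma rootspace_in_sum s mu x : x \in rootspace mu -> x != 0 ->
  x \in (\sum_(mu <- s) rootspace mu)%VS -> mu \in s.
Proof.
move=> xmu x0 xs; apply: contraNT x0 => mus.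
have /disjoint_sums_rootspaces D : forall nu, nu \in [:: mu] -> nu \notin s.
  by move=> nu; rewrite inE => /eqP->.
by rewrite -memv0 -D big_seq1 memv_cap xmu.
Qed.

Lemma rootspace_sub_nilneg (Dp : {fset 'Hom(subvs_of H, K^o)}) (al : Dp) x :
  x \in rootspace (- val al) -> x \in nilneg Dp.
Proof. by move=> xal; apply: subvP xal; rewrite (sumv_sup al). Qed.

Lemma rootspace_sub_nilpos (Dp : {fset 'Hom(subvs_of H, K^o)}) (al : Dp) x :
  x \in rootspace (val al) -> x \in nilpos Dp.
Proof. by move=> xal; apply: subvP xal; rewrite (sumv_sup al). Qed.

End SumsOfRootSpaces.

(** * Integral combinations of simple roots *)

Section NatCombs.
Variables (K : numFieldType) (g : lieAlgebra K) (H : {vspace g}).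
Variables (Pi : {fset 'Hom(subvs_of H, K^o)}).
Hypothesis Pi_simple : simple_roots Pi.
Implicit Types (al be v w : 'Hom(subvs_of H, K^o)).

Lemma simple_roots_free (k : Pi -> K) :
  \sum_(i : Pi) k i *: val i = 0 -> forall i, k i = 0.
Proof.
have [/andP[_ fr] _ _] := Pi_simple.
pose k' x := if insub x is Some i then k i else 0.
have -> : \sum_(i : Pi) k i *: val i = \sum_(i : Pi) k' (val i) *: val i.
  by apply: eq_bigr => i _; rewrite /k' valK.
rewrite -(big_seq_fsetE _ Pi predT (fun x => k' x *: x)) /=.
rewrite (big_nth 0) big_mkord => /(freeP (X := in_tuple Pi) fr) k0 i.
have iPi : (index (val i) Pi < size Pi)%N by rewrite index_mem (valP i).
have := k0 (Ordinal iPi); rewrite /= nth_index ?(valP i) //.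
by rewrite /k' valK.
Qed.

Lemma simple_coef_inj (k l : Pi -> K) :
  \sum_(i : Pi) k i *: val i = \sum_(i : Pi) l i *: val i -> k =1 l.
Proof.
move=> e i; apply/eqP; rewrite -subr_eq0; apply/eqP.
apply: (simple_roots_free (k := fun i => k i - l i)).
by under eq_bigr do rewrite scalerBl; rewrite sumrB e subrr.
Qed.

Lemma nat_comb_scale (c : Pi -> nat) :
  \sum_(i : Pi) val i *+ c i = \sum_(i : Pi) (c i)%:R *: val i.
Proof. by apply: eq_bigr => i _; rewrite scaler_nat. Qed.

Lemma nat_combD v w : nat_comb Pi v -> nat_comb Pi w -> nat_comb Pi (v + w).
Proof.
move=> [c ->] [d ->]; exists (fun i => c i + d i)%N.
by rewrite -big_split; apply: eq_bigr => i _; rewrite mulrnDr.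
Qed.

Lemma nat_comb_pointed v : nat_comb Pi v -> nat_comb Pi (- v) -> v = 0.
Proof.
move=> [c vc] [d vd].
have cd i : (c i + d i)%:R = 0 :> K.
  apply: (simple_roots_free (k := fun i => (c i + d i)%:R)).
  rewrite -nat_comb_scale; under eq_bigr do rewrite mulrnDr.
  by rewrite big_split /= -vc -vd subrr.
rewrite vc big1 // => i _; have /eqP := cd i.
by rewrite pnatr_eq0 addn_eq0 => /andP[/eqP->].
Qed.

(** The simple roots span the dual of H. *)
Lemma simple_roots_separate (h : subvs_of H) :
  (forall al, is_root al -> al h = 0) -> h = 0.
Proof.
move=> h0; have [bas roots _] := Pi_simple.
rewrite (coord_vbasis (memvf h)) big1 // => i _.
suff -> : coord (vbasis {: subvs_of H}) i h = 0 by rewrite scale0r.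
pose F : 'Hom(subvs_of H, K^o) := linfun (coord (vbasis {: subvs_of H}) i : subvs_of H -> K^o).
have -> : coord (vbasis {: subvs_of H}) i h = F h by rewrite lfunE.
rewrite (coord_basis (X := in_tuple Pi) bas (memvf F)) sum_lfunE big1 // => j _.
by rewrite lfunE /= h0 ?scaler0 //; apply: roots; rewrite mem_nth.
Qed.

End NatCombs.

(** * Triangular decomposition *)

Section Structure.
Variables (K : numClosedFieldType) (g : lieAlgebra K).
Hypothesis g_simple : lie_simple g.
Variable H : {vspace g}.
Hypothesis H_cartan : cartan_subalgebra H.
Variables (Pi Dp : {fset 'Hom(subvs_of H, K^o)}).
Hypothesis Pi_simple : simple_roots Pi.
Hypothesis Dp_positive : positive_roots Pi Dp.
Implicit Types (mu : 'Hom(subvs_of H, K^o)) (x y z : g) (h : subvs_of H).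

Lemma simple_coordinates : exists n (r : {linear g -> 'rV[K]_n.+1})
    (r' : {linear 'rV[K]_n.+1 -> g}), cancel r r' /\ cancel r' r.
Proof.
apply: vspace_coordinates; rewrite lt0n dimv_eq0; have [ [x [y] ] + _] := g_simple.
by apply: contraNneq => g0; rewrite -memv0 -g0 memvf.
Qed.

Lemma invariant_form : exists kap : g -> g -> K,
  [/\ forall x, linear (kap x : g -> K^o), forall x y, kap x y = kap y x,
      forall x y z, kap [[x, y]] z = kap x [[y, z]]
    & forall x, (forall y, kap x y = 0) -> x = 0].
Proof.
have [n [r [r' [rK r'K] ] ] ] := simple_coordinates.
exists (killing_form r r'); split.
- exact: killing_linearr.
- exact: killing_sym.
- exact: killing_invariant.
- exact: (killing_nondegenerate g_simple rK r'K H_cartan (simple_roots_separate Pi_simple)).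
Qed.

Lemma cartan_abelian x y : x \in H -> y \in H -> [[x, y]] = 0.
Proof. exact: (cartan_commutes H_cartan (simple_roots_separate Pi_simple)). Qed.

Lemma weight_sum : exists W : seq 'Hom(subvs_of H, K^o),
  forall x, x \in (\sum_(mu <- W) rootspace mu)%VS.
Proof.
have [n [r [r' [rK r'K] ] ] ] := simple_coordinates.
have [e [w [ew span] ] ] :=
  weight_basis g_simple rK r'K H_cartan (simple_roots_separate Pi_simple).
exists [seq w i | i <- index_enum 'I_n.+1] => x.
have [c ->] := span x; rewrite big_map; apply: memv_sumr => j _.
by rewrite memvZ.
Qed.

Lemma rootspace0 : rootspace (0 : 'Hom(subvs_of H, K^o)) = H.
Proof.
apply/vspaceP=> x; apply/rootspaceP/idP => [x0|xH h]; last first.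
  by rewrite cartan_abelian ?subvsP // lfunE /= scale0r.
apply: (cartan_selfnormalizing H_cartan) => y yH; rewrite br_antisym.
by have := x0 (Subvs yH); rewrite lfunE /= scale0r => ->; rewrite oppr0 mem0v.
Qed.

(** For x in the root space of al, choose a weight vector y of weight mu with
    kappa x y <> 0. Invariance gives (al + mu)(h) kappa x y = 0, so mu = - al. *)
Lemma root_opp (al : 'Hom(subvs_of H, K^o)) : is_root al -> is_root (- al).
Proof.
move=> al_root; have [kap [kl ks ki knd] ] := invariant_form.
have [x xal x0] := root_neq0 al_root; case: al_root => al0 _.
have [W WP] := weight_sum.
have [y kxy] : exists y, kap x y != 0.
  apply/not_existsP => ky; case/eqP: x0; apply: knd => y.
  by apply/eqP; apply: contra_notT (ky y).
have kadd (u v : g) : kap x (u + v) = kap x u + kap x v.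
  by have := kl x 1 u v; rewrite !scale1r.
have k0 : kap x 0 = 0 by apply: (addrI (kap x 0)); rewrite -kadd !addr0.
have kZ z c (u : g) : kap z (c *: u) = c * kap z u.
  have kz0 : kap z 0 = 0 by have := kl z (-1) 0 0; rewrite scaler0 addr0 scaleN1r addNr.
  by have := kl z c u 0; rewrite kz0 !addr0.
have [c [cr yE] ] := mem_sum_rootspaces (WP y).
have [mu kmu] : exists mu, kap x (c mu) != 0.
  apply/not_existsP => kc; case/eqP: kxy.
  rewrite yE (big_morph _ kadd k0) big1 // => mu _.
  by apply/eqP; apply: contra_notT (kc mu).
suff muE : mu = - al.
  apply: (is_rootP (x := c mu)); rewrite ?oppr_eq0 -?muE //.
  by apply: contraNneq kmu => ->; rewrite k0.
apply/eqP; rewrite -subr_eq0 opprK addrC; apply/eqP/lfunP => h.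
have : kap [[vsval h, x]] (c mu) + kap x [[vsval h, c mu]] = 0.
  rewrite -ki [ [[x, _]] ]br_antisym.
  have -> : kap (- [[vsval h, x]]) (c mu) = - kap [[vsval h, x]] (c mu).
    by rewrite ks -scaleN1r kZ mulN1r ks.
  exact: subrr.
rewrite (rootspaceP _ _ (cr mu)) (rootspaceP _ _ xal) ks !kZ -ks -mulrDl => /eqP.
by rewrite mulf_eq0 (negbTE kmu) orbF !lfunE => /eqP.
Qed.

Lemma posP (al : Dp) : is_root (val al) /\ nat_comb Pi (val al).
Proof. exact/Dp_positive/valP. Qed.

Lemma pos_neq0 (al : Dp) : val al != 0.
Proof. by have [ [] ] := posP al. Qed.

Lemma pos_add_neq0 (al be : Dp) : val al + val be != 0.
Proof.
apply: contraNneq (pos_neq0 al) => ab0; apply/eqP.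
apply: (nat_comb_pointed Pi_simple); first by case: (posP al).
move/eqP: ab0; rewrite addrC addr_eq0 => /eqP <-.
by case: (posP be).
Qed.

Lemma nilnegE : nilneg Dp = (\sum_(mu <- [seq - val al | al <- index_enum Dp]) rootspace mu)%VS.
Proof. by rewrite big_map. Qed.

Lemma nilposE : nilpos Dp = (\sum_(mu <- [seq val al | al <- index_enum Dp]) rootspace mu)%VS.
Proof. by rewrite big_map. Qed.

Lemma nilneg_disjoint : (nilneg Dp :&: (H + nilpos Dp) = 0)%VS.
Proof.
have -> : (H + nilpos Dp)%VS = (\sum_(mu <- (0%R : 'Hom(subvs_of H, K^o))
    :: [seq val al | al <- index_enum Dp]) rootspace mu)%VS.
  by rewrite big_cons rootspace0 nilposE.
rewrite nilnegE; apply: disjoint_sums_rootspaces => _ /mapP[al _ ->]; rewrite inE oppr_eq0 (negbTE (pos_neq0 al)) /=.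
apply/mapP=> -[be _ /eqP]; rewrite eq_sym -addr_eq0.
by rewrite (negbTE (pos_add_neq0 _ _)).
Qed.

Lemma cartan_disjoint : (H :&: (nilneg Dp + nilpos Dp) = 0)%VS.
Proof.
have HE : H = (\sum_(mu <- [:: (0%R : 'Hom(subvs_of H, K^o))]) rootspace mu)%VS.
  by rewrite big_seq1 rootspace0.
rewrite [X in (X :&: _)%VS]HE.
rewrite nilnegE nilposE -big_cat; apply: disjoint_sums_rootspaces => mu.
rewrite inE => /eqP->; rewrite mem_cat negb_or.
by apply/andP; split; apply/mapP=> -[al _ /eqP]; rewrite eq_sym ?oppr_eq0 (negbTE (pos_neq0 al)).
Qed.

Lemma triangular x : x \in (nilneg Dp + (H + nilpos Dp))%VS.
Proof.
have [W WP] := weight_sum; apply: subvP (WP x).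
elim/big_ind: _ => [|U V UP VP|mu _]; [exact: sub0v|by rewrite subv_add UP|].
have [->|mu0] := eqVneq mu 0.
  by rewrite rootspace0; apply: subv_trans (addvSl _ _) (addvSr _ _).
have [muR|] := eqVneq (rootspace mu) 0%VS; first by rewrite muR sub0v.
move=> mur; have [_ _ /(_ mu (conj mu0 mur)) [pos|neg] ] := Pi_simple.
  have muD : mu \in Dp by apply/Dp_positive.
  apply/subvP => y ymu; apply: subvP (addvSr _ _) _ _; apply: subvP (addvSr _ _) _ _.
  exact: (rootspace_sub_nilpos (al := FSetSub muD)).
have muD : - mu \in Dp by apply/Dp_positive; split=> //; apply: root_opp.
apply/subvP => y ymu; apply: subvP (addvSl _ _) _ _.
by apply: (rootspace_sub_nilneg (al := FSetSub muD)); rewrite /= opprK.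
Qed.

(** Symmetry of the set of roots is needed here: it is - (al + be) that is seen
    to be a root, and al + be that has to be positive. *)
Lemma neg_rootspace_br (al be : Dp) x y :
  x \in rootspace (- val al) -> y \in rootspace (- val be) -> [[x, y]] != 0 ->
  exists2 ga : Dp, val ga = val al + val be & [[x, y]] \in rootspace (- val ga).
Proof.
move=> xal ybe xy0; have := rootspace_br xal ybe; rewrite -opprD => xyr.
have gaR : is_root (- (val al + val be)).
  by apply: is_rootP xyr xy0; rewrite oppr_eq0 pos_add_neq0.
have gaD : val al + val be \in Dp.
  apply/Dp_positive; split; first by rewrite -[_ + _]opprK; apply: root_opp.
  by apply: nat_combD; [case: (posP al) | case: (posP be)].
by exists (FSetSub gaD).
Qed.

End Structure.

(** * The highest root *)

Section HighestRoot.
Variables (K : numClosedFieldType) (g : lieAlgebra K).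
Hypothesis g_simple : lie_simple g.
Variable H : {vspace g}.
Hypothesis H_cartan : cartan_subalgebra H.
Variables (Pi Dp : {fset 'Hom(subvs_of H, K^o)}).
Hypothesis Pi_simple : simple_roots Pi.
Hypothesis Dp_positive : positive_roots Pi Dp.
Variable theta : Dp.
Hypothesis theta_max : maximal_root Pi (val theta).
Implicit Types (mu : 'Hom(subvs_of H, K^o)) (x y z : g) (h : subvs_of H).

(** The sum al + theta would be a root above theta. *)
Lemma highest_root_br (al : Dp) x y : x \in rootspace (val al) ->
  y \in rootspace (val theta) -> [[x, y]] = 0.
Proof.
move=> xal yth; apply/eqP/contraT => xy0.
have [_ max] := theta_max.
have root : is_root (val al + val theta).
  apply: is_rootP (rootspace_br xal yth) xy0.
  exact: (pos_add_neq0 Pi_simple Dp_positive).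
have := max _ root; rewrite addrK => /(_ (posP Dp_positive al).2) /eqP.
by rewrite -subr_eq0 addrK (negbTE (pos_neq0 Dp_positive al)).
Qed.

(** This is U(nbar) e = g, stated by stable subspaces. A minimal nbar-stable
    subspace U of V containing e is an ideal: the u in U sent into U by H + n
    form an nbar-stable subspace containing e, hence all of U. *)
Lemma highest_root_generates (V : {vspace g}) e :
  e \in rootspace (val theta) -> e != 0 -> e \in V ->
  (forall y v, y \in nilneg Dp -> v \in V -> [[y, v]] \in V) -> V = fullv.
Proof.
move=> eth e0 eV Vst.
pose stable d (U : {vspace g}) := [/\ \dim U = d, (U <= V)%VS, e \in U &
  forall y v, y \in nilneg Dp -> v \in U -> [[y, v]] \in U].
have exQ : exists d, `[< exists U, stable d U >].
  by exists (\dim V); apply/asboolP; exists V; split.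
case: (ex_minnP exQ) => d /asboolP[U [dU UV eU Ust] ] dmin.
pose P u := u \in U /\ forall b, b \in (H + nilpos Dp)%VS -> [[b, u]] \in U.
have [U' U'P] : exists U' : {vspace g}, forall u, u \in U' <-> P u.
  apply: vspace_of_closed => [|a u v [uU ub] [vU vb] ].
    by split=> [|b _]; rewrite ?br0r mem0v.
  by split=> [|b bb]; rewrite ?brDr ?brZr memvD ?memvZ ?ub ?vb.
have U'U : (U' <= U)%VS by apply/subvP=> u /U'P[].
have eU' : e \in U'.
  apply/U'P; split=> // _ /memv_addP[h hH [_ /memv_sumP[x xr ->] ->] ].
  rewrite brDl br_suml big1 => [|al _]; last by apply: highest_root_br eth; apply: xr.
  by rewrite addr0 (rootspaceP _ _ eth (Subvs hH)) memvZ.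
have U'st y v : y \in nilneg Dp -> v \in U' -> [[y, v]] \in U'.
  move=> yn /U'P[vU vb]; apply/U'P; split=> [|b bb]; first exact: Ust.
  rewrite br_derivation memvD //; last by apply: Ust => //; apply: vb.
  have /memv_addP[y' y'n [b' b'b ->] ] :=
    triangular g_simple H_cartan Pi_simple Dp_positive [[b, y]].
  by rewrite brDl memvD //; [exact: Ust | exact: vb].
have UE : U' = U.
  apply/eqP; rewrite eqEdim U'U dU dmin //; apply/asboolP; exists U'; split=> //.
  exact: subv_trans U'U UV.
have [_ /(_ U)[| U0 | Uf] ] := g_simple; last 1 first.
- by apply/eqP; rewrite eqEsubv subvf -Uf UV.
- move=> x u uU.
  have /memv_addP[y yn [b bb ->] ] := triangular g_simple H_cartan Pi_simple Dp_positive x.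
  rewrite brDl memvD //; first exact: Ust.
  by move: uU; rewrite -{1}UE => /U'P[_]; apply.
by move: eU; rewrite U0 memv0 (negbTE e0).
Qed.

(** The sum of the root spaces of weight below theta is nbar-stable and contains
    e_theta, so it is g. *)
Lemma below_highest_root mu x : x \in rootspace mu -> x != 0 ->
  nat_comb Pi (val theta - mu).
Proof.
move=> xmu x0.
have [e eth e0] := root_neq0 (posP Dp_positive theta).1.
have [W WP] := weight_sum g_simple H_cartan Pi_simple.
pose S := [seq mu <- W | `[< nat_comb Pi (val theta - mu) >] ].
suff VE : (\sum_(mu <- S) rootspace mu)%VS = fullv.
  have : mu \in S by apply: rootspace_in_sum xmu x0 _; rewrite VE memvf.
  by rewrite mem_filter => /andP[/asboolP].
apply: (highest_root_generates eth e0).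
  have thS : val theta \in S.
    rewrite mem_filter (rootspace_in_sum eth e0 (WP e)) andbT; apply/asboolP.
    by exists (fun=> 0%N); rewrite subrr big1.
  by rewrite (big_rem _ thS) /=; apply: subvP (addvSl _ _) _ eth.
move=> y v /memv_sumP[u ur ->] /mem_sum_rootspaces[c [cr ->] ].
rewrite br_suml; apply: memv_suml => al _; rewrite linear_sum big_seq /=.
apply: memv_suml => nu; rewrite mem_undup mem_filter => /andP[/asboolP nuth _].
have br := rootspace_br (ur al isT) (cr nu).
have [->|br0] := eqVneq [[u al, c nu]] 0; first exact: mem0v.
have nuS : - val al + nu \in S.
  rewrite mem_filter (rootspace_in_sum br br0 (WP _)) andbT; apply/asboolP.
  rewrite opprD opprK addrCA; apply: nat_combD => //.
  exact: (posP Dp_positive al).2.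
by rewrite (big_rem _ nuS) /=; apply: subvP (addvSl _ _) _ br.
Qed.

Variable m : Dp -> Pi -> nat.
Hypothesis m_coef : forall al : Dp, val al = \sum_(i : Pi) val i *+ m al i.

(** The simple roots are below theta. *)
Lemma highest_root_support i : (0 < m theta i)%N.
Proof.
have [_ /(_ (val i) (valP i))/root_neq0[x xi x0] _] := Pi_simple.
have [c cE] := below_highest_root xi x0.
have : val theta = val i + \sum_(j : Pi) val j *+ c j by rewrite -cE addrC subrK.
rewrite m_coef nat_comb_scale.
have -> : val i + \sum_(j : Pi) val j *+ c j = \sum_(j : Pi) ((j == i) + c j)%:R *: val j.
  under [RHS]eq_bigr do rewrite natrD scalerDl scaler_nat scaler_nat.
  rewrite big_split /=; congr (_ + _); rewrite (bigD1 i) //= eqxx big1 ?addr0 ?mulr1n //.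
  by move=> j /negbTE->.
move/(simple_coef_inj Pi_simple)/(_ i)/eqP; rewrite eqxx eqr_nat => /eqP->.
by [].
Qed.

End HighestRoot.

Section RootBasis.
Variables (K : fieldType) (g : lieAlgebra K) (H : {vspace g}).
Variables (Dp : {fset 'Hom(subvs_of H, K^o)}) (f : Dp -> g).
Hypothesis f_basis : root_basis f.

Lemma codom_nth (al : Dp) : (codom_tuple f)`_(enum_rank al) = f al.
Proof. by rewrite /= nth_codom enum_rankK. Qed.

Lemma coord_fE (al be : Dp) : coord_f f al (f be) = (al == be)%:R.
Proof.
have [_ /andP[_ fr] ] := f_basis.
rewrite /coord_f -codom_nth coord_free //.
by rewrite eq_sym (inj_eq enum_rank_inj).
Qed.

Lemma nilneg_coord y : y \in nilneg Dp -> y = \sum_(al : Dp) coord_f f al y *: f al.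
Proof.
have [_ bas] := f_basis => yn.
rewrite {1}(coord_basis (X := codom_tuple f) bas yn).
rewrite (reindex enum_rank) /=; last by exists enum_val => i _; rewrite ?enum_rankK ?enum_valK.
by apply: eq_bigr => al _; rewrite codom_nth.
Qed.

Lemma root_basis_neq0 al : f al != 0.
Proof.
apply/eqP => fal; have := coord_fE al al; rewrite fal /coord_f linear0 eqxx => /eqP.
by rewrite eq_sym oner_eq0.
Qed.

End RootBasis.

(** * Rank one *)

Section TypeA1.
Variables (K : fieldType) (g : lieAlgebra K) (e h f : g).
Hypotheses (he : [[h, e]] = 2 *: e) (hf : [[h, f]] = - (2 *: f)) (ef : [[e, f]] = h).
Hypothesis basis_ehf : basis_of fullv [:: e; h; f].

Lemma sl2_triple_isog : lie_isog_sl2 g.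
Proof.
pose X := [tuple e; h; f].
have frX : free X by case/andP: basis_ehf.
pose A := coord X 0 : g -> K; pose B := coord X 1 : g -> K; pose D := coord X 2 : g -> K.
pose L (a b d : K) := a *: e + b *: h + d *: f.
have xL x : x = L (A x) (B x) (D x).
  rewrite {1}(coord_basis (X := X) basis_ehf (memvf x)) /L !big_ord_recl big_ord0 addr0 addrA.
  by congr (_ *: _ + _ *: _ + _ *: _); congr (coord X _ x); apply: val_inj.
have coordL (i : 'I_3) a b d : coord X i (L a b d) = [:: a; b; d]`_i.
  have -> : L a b d = \sum_(j < 3) [:: a; b; d]`_j *: X`_j.
    by rewrite !big_ord_recl big_ord0 addr0 addrA.
  exact: coord_sum_free.
have AL a b d : A (L a b d) = a by rewrite /A coordL.
have BL a b d : B (L a b d) = b by rewrite /B coordL.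
have DL a b d : D (L a b d) = d by rewrite /D coordL.
pose mat (a b d : K) : 'M[K]_2 := \matrix_(i, j)
  if i == 0 then (if j == 0 then b else a) else (if j == 0 then d else - b).
pose phi_fun x := mat (A x) (B x) (D x).
have phi_lin : linear phi_fun.
  move=> c x y; rewrite /phi_fun /A /B /D !linearP /=; apply/matrixP=> i j.
  by rewrite !mxE; case: ifP => _; case: ifP => _; rewrite ?opprD ?mulrN.
pose phi := HB.pack_for {linear g -> 'M[K]_2} phi_fun
  (GRing.isLinear.Build K g 'M[K]_2 *:%R phi_fun phi_lin).
have phiE x : phi x = mat (A x) (B x) (D x) by [].
have inj a b d a' b' d' : mat a b d = mat a' b' d' -> L a b d = L a' b' d'.
  move/matrixP=> E; have := E 1 0; have := E 0 1; have := E 0 0.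
  by rewrite !mxE /= => -> -> ->.
have ord2 (i : 'I_2) : i = 0 \/ i = 1.
  by case: i => [ [|[|//] ] ip]; [left|right]; apply: val_inj.
exists phi; split=> [x y|M|x y].
- by rewrite !phiE => /inj; rewrite -!xL.
- split=> [ [x <-]|trM].
    by rewrite phiE /mxtrace !big_ord_recl big_ord0 !mxE /= addr0 subrr.
  exists (L (M 0 1) (M 0 0) (M 1 0)); rewrite phiE AL BL DL.
  have t11 : M 1 1 = - M 0 0.
    apply/eqP; rewrite eq_sym eqr_oppLR -addr_eq0 -trM /mxtrace !big_ord_recl.
    by rewrite big_ord0 addr0; apply/eqP; congr (_ + M _ _); apply: val_inj.
  apply/matrixP=> i j; rewrite mxE.
  by case: (ord2 i) => ->; case: (ord2 j) => -> /=; rewrite ?t11 ?opprK.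
have brE : [[x, y]] = L (2 * (B x * A y - A x * B y)) (A x * D y - D x * A y)
    (2 * (D x * B y - B x * D y)).
  have LD a b d a' b' d' : L a b d + L a' b' d' = L (a + a') (b + b') (d + d').
    by rewrite /L addrACA [in LHS](addrACA (a *: e)) -!scalerDl.
  have LZ c a b d : c *: L a b d = L (c * a) (c * b) (c * d).
    by rewrite /L !scalerDr !scalerA.
  have L0 : 0 = L 0 0 0 by rewrite /L !scale0r !addr0.
  have eh : [[e, h]] = L (- 2) 0 0.
    by rewrite br_antisym he /L !scale0r !addr0 scaleNr.
  have he' : [[h, e]] = L 2 0 0 by rewrite he /L !scale0r !addr0.
  have hf' : [[h, f]] = L 0 0 (- 2) by rewrite hf /L !scale0r !add0r scaleNr.
  have fh : [[f, h]] = L 0 0 2 by rewrite br_antisym hf /L !scale0r !add0r opprK.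
  have ef' : [[e, f]] = L 0 1 0 by rewrite ef /L !scale0r scale1r add0r addr0.
  have fe : [[f, e]] = L 0 (- 1) 0.
    by rewrite br_antisym ef /L !scale0r scaleN1r add0r addr0.
  rewrite {1}[x]xL {1}[y]xL {1 2}/L.
  rewrite !(brDl, brDr, brZl, brZr) !lie_br_alt he' hf' ef' eh fh fe L0 !(LZ, LD).
  by congr L; ring.
rewrite !phiE brE AL BL DL; apply/matrixP=> i j; rewrite !mxE !big_ord_recl !big_ord0 !mxE.
by case: (ord2 i) => ->; case: (ord2 j) => -> /=; ring.
Qed.

End TypeA1.

Section NotSimple.
Variables (K : numClosedFieldType) (g : lieAlgebra K).
Hypothesis g_simple : lie_simple g.
Variable H : {vspace g}.
Hypothesis H_cartan : cartan_subalgebra H.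
Variables (Pi Dp : {fset 'Hom(subvs_of H, K^o)}).
Hypothesis Pi_simple : simple_roots Pi.
Hypothesis Dp_positive : positive_roots Pi Dp.
Variable theta : Dp.
Hypothesis theta_max : maximal_root Pi (val theta).
Variable f : Dp -> g.
Hypothesis f_basis : root_basis f.
Variable m : Dp -> Pi -> nat.
Hypothesis m_coef : forall al : Dp, val al = \sum_(i : Pi) val i *+ m al i.

Lemma simple_coef_pos (al : Dp) (i : Pi) : val al = val i -> forall j, m al j = (j == i).
Proof.
move=> ali; have e : \sum_(j : Pi) (m al j)%:R *: val j = \sum_(j : Pi) (j == i)%:R *: val j.
  rewrite -nat_comb_scale -m_coef ali (bigD1 i) //= eqxx scale1r big1 ?addr0 // => j.
  by move/negbTE->; rewrite scale0r.
by move=> j; have /eqP := simple_coef_inj Pi_simple e j; rewrite eqr_nat => /eqP.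
Qed.

(** If theta is simple it is the only simple root, since all of them occur in
    it; then positive roots are its multiples, hence above it, hence equal to it by
    maximality. *)
Lemma highest_root_rank1 : val theta \in Pi -> forall al, al = theta.
Proof.
move=> thPi; pose i0 : Pi := FSetSub thPi.
have all_i j : j = i0.
  have := highest_root_support g_simple H_cartan Pi_simple Dp_positive theta_max m_coef j.
  by rewrite (@simple_coef_pos theta i0) //; case: eqP.
move=> al; apply: val_inj; have [_ max] := theta_max; apply: max.
  by case: (posP Dp_positive al).
exists (fun=> (m al i0).-1).
have E (c : Pi -> nat) : \sum_(i : Pi) val i *+ c i = val theta *+ c i0.
  rewrite (bigD1 i0) //= big1 ?addr0 // => j.
  by rewrite (all_i j) eqxx.
rewrite E; move: (m_coef al); rewrite E => alE.
have := pos_neq0 Dp_positive al; rewrite alE.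
by case: (m al i0) => [|k _]; rewrite ?mulr0n ?eqxx //= mulrSr addrK.
Qed.

(** Otherwise <e> + H + <f theta> is nbar-stable, hence equal to g. Here H is a
    line, since theta separates its points, spanned by [e, f theta], which is
    nonzero as <f theta> is not an ideal; rescaling gives an sl2-triple. *)
Lemma highest_root_not_simple : ~ lie_isog_sl2 g -> val theta \notin Pi.
Proof.
move=> not_sl2; apply/negP => thPi; apply: not_sl2.
have one := highest_root_rank1 thPi.
have [_ Pi_roots Pi_pm] := Pi_simple.
have [e eth e0] := root_neq0 (posP Dp_positive theta).1.
pose f0 := f theta; have fth : f0 \in rootspace (- val theta) by case: f_basis => + _; apply.
have f00 : f0 != 0 := root_basis_neq0 f_basis theta.
have nil_f y : y \in nilneg Dp -> exists c, y = c *: f0.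
  move/(nilneg_coord f_basis) => {1}->; exists (coord_f f theta y).
  by rewrite (bigD1 theta) //= big1 ?addr0 // => al; rewrite (one al) eqxx.
have inH x : x \in rootspace (0 : 'Hom(subvs_of H, K^o)) -> x \in H.
  by rewrite (rootspace0 H_cartan Pi_simple).
have span x : x \in (<[e]> + H + <[f0]>)%VS.
  rewrite (highest_root_generates g_simple H_cartan Pi_simple Dp_positive theta_max
    (V := (<[e]> + H + <[f0]>)%VS) eth e0) ?memvf //.
    by apply: subvP (memv_line e); apply: subv_trans (addvSl _ _) (addvSl _ _).
  move=> y v /nil_f[c ->] /memv_addP[_ /memv_addP[_ /vlineP[a ->] [h hH ->] ] [_ /vlineP[b ->] ->] ].
  rewrite brZl memvZ // !brDr !brZr lie_br_alt scaler0 addr0 memvD //; last first.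
    apply: subvP (addvSr _ _) _ _; rewrite br_antisym (rootspaceP _ _ fth (Subvs hH)).
    by rewrite -scaleNr memvZ // memv_line.
  apply: subvP (addvSl _ _) _ _; apply: subvP (addvSr _ _) _ _; rewrite memvZ //.
  by apply: inH; have := rootspace_br fth eth; rewrite addNr.
have theta_inj (h : subvs_of H) : val theta h = 0 -> h = 0.
  move=> th0; apply: (simple_roots_separate Pi_simple) => al al_root.
  have [al0 _] := al_root.
  have [pos|neg] := Pi_pm al al_root.
    have alD : al \in Dp by apply/Dp_positive.
    by have := one (FSetSub alD) => /(congr1 val) /= ->.
  have alD : - al \in Dp.
    by apply/Dp_positive; split=> //; apply: (root_opp g_simple H_cartan Pi_simple).
  have := one (FSetSub alD) => /(congr1 val) /= e'.
  by rewrite -[al]opprK e' lfunE /= th0 oppr0.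
have efH : [[e, f0]] \in H by apply: inH; have := rootspace_br eth fth; rewrite addrN.
pose h0 := Subvs efH; pose c := val theta h0.
have c0 : c != 0.
  apply/eqP => /theta_inj /(congr1 vsval) /= ef0.
  have [ [a [b ab0] ] ideals] := g_simple.
  have [| fv0 | fvf] := ideals <[f0]>%VS.
  - move=> x y /vlineP[k ->]; rewrite brZr memvZ //.
    have /memv_addP[_ /memv_addP[_ /vlineP[a' ->] [h hH ->] ] [_ /vlineP[b' ->] ->] ] := span x.
    rewrite !(brDl, brZl) ef0 lie_br_alt !scaler0 add0r addr0.
    by rewrite (rootspaceP _ _ fth (Subvs hH)) memvZ // memv_line.
  - by move: f00; rewrite -memv0 -fv0 memv_line.
  have /vlineP[k ak] : a \in <[f0]>%VS by rewrite fvf memvf.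
  have /vlineP[l bl] : b \in <[f0]>%VS by rewrite fvf memvf.
  by case/eqP: ab0; rewrite ak bl brZl brZr lie_br_alt !scaler0.
(* the factor 2 / c makes h act on e' by 2 *)
pose h := (2 / c) *: [[e, f0]]; pose e' := (2 / c) *: e.
have hH x al : x \in rootspace al -> [[h, x]] = (2 / c * al h0) *: x.
  by move=> xal; rewrite brZl (rootspaceP _ _ xal h0) scalerA.
apply: (@sl2_triple_isog _ _ e' h f0).
- by rewrite brZr (hH _ _ eth) mulfVK // scalerA mulrC -scalerA.
- by rewrite (hH _ _ fth) lfunE /= mulrN mulfVK // scaleNr.
- by rewrite brZl.
have e'0 : e' != 0 by rewrite scaler_eq0 mulf_eq0 pnatr_eq0 invr_eq0 (negbTE c0).
have h'0 : h != 0.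
  rewrite scaler_eq0 mulf_eq0 pnatr_eq0 invr_eq0 (negbTE c0) /=.
  by apply: contraNneq c0 => ef0; rewrite /c (_ : h0 = 0) ?linear0 //; apply: val_inj.
have hin : h \in rootspace (0 : 'Hom(subvs_of H, K^o)).
  by rewrite (rootspace0 H_cartan Pi_simple) memvZ.
have e'th : e' \in rootspace (val theta) by rewrite memvZ.
rewrite /basis_of eqEsubv subvf; apply/andP; split; last first.
  apply/(freeP (X := [tuple e'; h; f0])) => k.
  rewrite !big_ord_recl big_ord0 addr0 /= => k0.
  pose cc mu := if mu == val theta then k ord0 *: e' else
    if mu == 0 then k (lift ord0 ord0) *: h else k (lift ord0 (lift ord0 ord0)) *: f0.
  have th0 := pos_neq0 Dp_positive theta.
  have nth : (- val theta == val theta) = false.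
    by rewrite eq_sym -addr_eq0; apply/negbTE/(pos_add_neq0 Pi_simple Dp_positive).
  have cc0 mu : mu \in [:: val theta; 0; - val theta] -> cc mu = 0.
    apply: rootspaces_independent => [|nu|].
    - rewrite /= !inE negb_or th0 eq_sym nth eq_sym oppr_eq0 th0; by [].
    - rewrite !inE => /or3P[] /eqP->; rewrite /cc ?eqxx.
      + by rewrite memvZ.
      + by rewrite eq_sym (negbTE th0) memvZ.
      by rewrite nth oppr_eq0 (negbTE th0) memvZ.
    rewrite !big_cons big_nil addr0 /cc eqxx eq_sym (negbTE th0) eqxx nth oppr_eq0.
    by rewrite (negbTE th0).
  have := cc0 (- val theta); have := cc0 0; have := cc0 (val theta).
  rewrite /cc !inE !eqxx !orbT nth oppr_eq0 (eq_sym 0) (negbTE th0) /=.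
  move=> /(_ isT)/eqP; rewrite scaler_eq0 (negbTE e'0) orbF => /eqP k1.
  move=> /(_ isT)/eqP; rewrite scaler_eq0 (negbTE h'0) orbF => /eqP k2.
  move=> /(_ isT)/eqP; rewrite scaler_eq0 (negbTE f00) orbF => /eqP k3.
  case=> [ [|[|[|//] ] ] ip]; [rewrite -[RHS]k1|rewrite -[RHS]k2|rewrite -[RHS]k3];
    congr (k _); exact: val_inj.
apply/subvP => x _.
have /memv_addP[_ /memv_addP[_ /vlineP[a ->] [hx hxH ->] ] [_ /vlineP[b ->] ->] ] := span x.
have -> : hx = (val theta (Subvs hxH) / 2) *: h.
  suff /(congr1 vsval) : Subvs hxH = (val theta (Subvs hxH) / c) *: h0.
    by rewrite /= => {1}->; rewrite scalerA mulrA divfK ?pnatr_eq0.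
  apply/eqP; rewrite -subr_eq0; apply/eqP/theta_inj.
  by rewrite linearB linearZ /= -/c [_ *: c]divfK // subrr.
have -> : e = (c / 2) *: e'.
  by rewrite scalerA mulrA divfK ?pnatr_eq0 // divff // scale1r.
have gen y : y \in [:: e'; h; f0] -> y \in <<[:: e'; h; f0]>>%VS by apply: memv_span.
clearbody e' h.
by apply: memvD; [apply: memvD|]; rewrite !memvZ //; apply: gen; rewrite !inE ?eqxx ?orbT.
Qed.

End NotSimple.

(** * The quotient of the Weyl algebra and its monomial basis *)

Section WeylModule.
Variables (K : numFieldType) (g : lieAlgebra K) (H : {vspace g}).
Variables (Dp : {fset 'Hom(subvs_of H, K^o)}) (theta : Dp).
Local Opaque wadd wmul wopp wscale lact lcls.
Local Notation A := (weyl K Dp).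
Local Notation W := (Wmod theta).
Implicit Types (i j : Dp) (b : Dp -> nat) (r : seq Dp) (u v : A).

Definition inc b i j := (b j + (j == i))%N.
Definition dec b i j := (b j - (j == i))%N.

Lemma inc_same b i : inc b i i = (b i).+1.
Proof. by rewrite /inc eqxx addn1. Qed.
Lemma inc_other b i j : j != i -> inc b i j = b j.
Proof. by rewrite /inc => /negbTE->; rewrite addn0. Qed.
Lemma dec_same b i : dec b i i = (b i).-1.
Proof. by rewrite /dec eqxx subn1. Qed.
Lemma dec_other b i j : j != i -> dec b i j = b j.
Proof. by rewrite /dec => /negbTE->; rewrite subn0. Qed.

Definition deriv_monomial r b : A := \prod_(j <- r | j != theta) wd j ^+ b j.

Lemma eq_deriv_monomial r b b' : {in r, b =1 b'} -> deriv_monomial r b = deriv_monomial r b'.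
Proof.
by move=> bb'; rewrite /deriv_monomial big_seq_cond [RHS]big_seq_cond; apply: eq_bigr => j /andP[/bb'->].
Qed.

Lemma deriv_monomial_cons j r b :
  deriv_monomial (j :: r) b = if j != theta then wd j ^+ b j * deriv_monomial r b else deriv_monomial r b.
Proof. by rewrite /deriv_monomial big_cons. Qed.

Lemma wd_deriv_monomial r b i : uniq r -> i \in r -> i != theta ->
  wd i * deriv_monomial r b = deriv_monomial r (inc b i).
Proof.
move=> + + ith; elim: r => //= j r IHr /andP[jr ur].
rewrite inE !deriv_monomial_cons => /predU1P[e|ir].
  rewrite -e ith mulrA inc_same exprS; congr (_ * _).
  apply: eq_deriv_monomial => k kr; rewrite inc_other //.
  by apply: contraNneq jr => ki; rewrite -e -ki.
have ji : j != i by apply: contraNneq jr => ->.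
case: ifP => jth; last exact: IHr.
have /commrX c : GRing.comm (wd i) (wd j : A) := wdd _ _ _.
by rewrite mulrA c -mulrA (IHr ur ir) (inc_other b ji).
Qed.

Lemma wx_wd_exp i j k : wx i * (wd j : A) ^+ k = wd j ^+ k * wx i - (wd j ^+ k.-1) *+ (k * (j == i)).
Proof.
elim: k => [|k IHk]; first by rewrite mul0n mulr0n subr0 mulr1 mul1r.
have wxd : wx i * wd j = wd j * wx i - (j == i)%:R :> A.
  by rewrite wdx scaler_nat addrK.
rewrite exprSr mulrA IHk mulrBl -mulrA wxd mulrBr mulrA -exprSr mulr_natr -addrA -opprD.
congr (_ - _); rewrite mulSn mulrnDr; congr (_ + _).
by case: k {IHk} => [|k] /=; rewrite ?mul0n ?mulr0n ?mul0r // mulrnAl -exprSr.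
Qed.

(** The product of booleans and b i is the exponent of d_i in the monomial,
    so that the correction vanishes when d_i does not occur. *)
Lemma wx_deriv_monomial r b i : uniq r ->
  wx i * deriv_monomial r b = deriv_monomial r b * wx i
    - deriv_monomial r (dec b i) *+ ((i \in r) * (i != theta) * b i).
Proof.
elim: r => [|j r IHr] /=; first by rewrite /deriv_monomial !big_nil mul0n mulr0n subr0 mulr1 mul1r.
case/andP=> jr ur; rewrite inE !deriv_monomial_cons.
have [->|jth] := eqVneq j theta.
  rewrite /= IHr //; congr (_ - _ *+ _).
  by have [->|//] := eqVneq i theta; rewrite !muln0.
rewrite /= mulrA wx_wd_exp mulrBl -mulrA IHr // mulrBr mulrA.
case: (eqVneq i j) jr jth => [<-|ij] jr jth.
  have E : deriv_monomial r (dec b i) = deriv_monomial r b.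
    by apply: eq_deriv_monomial => k kr; rewrite dec_other //; apply: contraNneq jr => <-.
  rewrite (negbTE jr) jth /= !mul0n mulr0n mulr0 subr0 !muln1 !mul1n.
  by rewrite mulrnAl dec_same E.
rewrite muln0 mulr0n mul0r subr0 /=; congr (_ - _).
have ji : j != i by rewrite eq_sym.
by rewrite mulrnAr (dec_other b ji).
Qed.

Lemma w_E b : w_ theta b = lcls (GT_gens theta) (deriv_monomial (index_enum Dp) b * wx theta ^+ b theta).
Proof. by []. Qed.

Lemma eq_w_ b b' : b =1 b' -> w_ theta b = w_ theta b'.
Proof. by move=> /funext->. Qed.

Lemma lactM (a b : A) (p : W) : lact (a * b) p = lact a (lact b p).
Proof. by rewrite -(lclsK p); move: (repr p) => u; rewrite [lact b _]lactE lactE lactE mulrA. Qed.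
Lemma lactDl (a b : A) (p : W) : lact (a + b) p = lact a p + lact b p.
Proof. by rewrite -(lclsK p); move: (repr p) => u; rewrite !lactE mulrDl lclsD. Qed.
Lemma lactDr (a : A) (p q : W) : lact a (p + q) = lact a p + lact a q.
Proof. by rewrite -(lclsK p) -(lclsK q); move: (repr p) (repr q) => u v; rewrite -lclsD !lactE mulrDr lclsD. Qed.
Lemma lactZl c (a : A) (p : W) : lact (c *: a) p = c *: lact a p.
Proof. by rewrite -(lclsK p); move: (repr p) => u; rewrite !lactE -scalerAl lclsZ. Qed.
Lemma lactZr c (a : A) (p : W) : lact a (c *: p) = c *: lact a p.
Proof. by rewrite -(lclsK p); move: (repr p) => u; rewrite -lclsZ !lactE -scalerAr lclsZ. Qed.
Lemma lact1 (p : W) : lact 1 p = p.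
Proof. by rewrite -(lclsK p); move: (repr p) => u; rewrite lactE mul1r. Qed.
Lemma lact_linear (a : A) : linear (lact a : W -> W).
Proof. by move=> c u v; rewrite lactDr lactZr. Qed.
Lemma lact0 (a : A) : lact a (0 : W) = 0.
Proof. by rewrite -[X in lact _ X](scale0r 0) lactZr scale0r. Qed.
Lemma lact_suml (I : finType) (F : I -> A) (p : W) :
  lact (\sum_i F i) p = \sum_i lact (F i) p.
Proof.
rewrite (big_morph (fun a => lact a p) (fun a a' => lactDl a a' p) (_ : lact 0 p = 0)) //.
by rewrite -(scale0r 1) lactZl scale0r.
Qed.

Let lcls_x i u : i != theta -> lcls (GT_gens theta) (u * wx i) = 0.
Proof. by move=> ith; apply/lcls_eq0/lidealM/lideal_gen; left; exists i. Qed.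
Let lcls_d u : lcls (GT_gens theta) (u * wd theta) = 0.
Proof. by apply/lcls_eq0/lidealM/lideal_gen; right. Qed.

Lemma commr_wd_deriv_monomial i r b : GRing.comm (wd i) (deriv_monomial r b).
Proof. by apply: commr_prod => j _; apply/commrX/wdd. Qed.

Lemma wd_w_ i b : i != theta -> lact (wd i) (w_ theta b) = w_ theta (inc b i).
Proof.
move=> ith; have thi : theta != i by rewrite eq_sym.
rewrite !w_E lactE mulrA (wd_deriv_monomial _ (index_enum_uniq _) (mem_index_enum i) ith).
by rewrite (inc_other b thi).
Qed.

Lemma wx_w_ i b : i != theta ->
  lact (wx i) (w_ theta b) = - ((b i)%:R *: w_ theta (dec b i)).
Proof.
move=> ith; rewrite !w_E lactE mulrA (wx_deriv_monomial _ _ (index_enum_uniq _)) mem_index_enum ith mul1n mulrBl.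
have /commrX c : GRing.comm (wx i) (wx theta : A) := wxx _ _ _.
rewrite -mulrA c mulrA lclsD (lcls_x _ ith) add0r -scaleN1r lclsZ scaleN1r.
have thi : theta != i by rewrite eq_sym.
by rewrite mulrnAl -scaler_nat lclsZ (dec_other b thi).
Qed.

Lemma wx_theta_w_ b : lact (wx theta) (w_ theta b) = w_ theta (inc b theta).
Proof.
rewrite !w_E lactE mulrA (wx_deriv_monomial _ _ (index_enum_uniq _)) eqxx muln0 mul0n mulr0n subr0.
rewrite -mulrA -exprS inc_same; congr (lcls _ (_ * _)).
rewrite /deriv_monomial; apply: eq_bigr => j jth.
by rewrite inc_other.
Qed.

Lemma wd_theta_w_ b : lact (wd theta) (w_ theta b) = (b theta)%:R *: w_ theta (dec b theta).
Proof.
rewrite !w_E lactE mulrA commr_wd_deriv_monomial -mulrA.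
have wdx k : wd theta * (wx theta : A) ^+ k = wx theta ^+ k * wd theta + wx theta ^+ k.-1 *+ k.
  elim: k => [|k IHk]; first by rewrite mulr0n addr0 mulr1 mul1r.
  rewrite exprSr mulrA IHk mulrDl -mulrA wdx eqxx scale1r mulrDr mulrA mulr1 -exprSr.
  rewrite -addrA; congr (_ + _); rewrite mulrS; congr (_ + _).
  by case: k {IHk} => [|k] /=; rewrite ?mulr0n ?mul0r // mulrnAl -exprSr.
rewrite wdx mulrDr mulrA lclsD lcls_d add0r dec_same mulrnAr -scaler_nat lclsZ.
congr (_ *: lcls _ (_ * _)); apply: eq_bigr => j jth.
by rewrite dec_other.
Qed.

(** The shift by 1 comes from d x = x d + 1: x kills the vacuum, d does not. *)
Lemma xd_w_ i b : i != theta ->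
  lact (wx i * wd i) (w_ theta b) = - ((b i).+1%:R *: w_ theta b).
Proof.
move=> ith; rewrite lactM wd_w_ // wx_w_ // inc_same; congr (- (_ *: _)).
by apply: eq_w_ => j; rewrite /dec /inc addnK.
Qed.

Lemma xd_theta_w_ b : lact (wx theta * wd theta) (w_ theta b) = (b theta)%:R *: w_ theta b.
Proof.
rewrite lactM wd_theta_w_ lactZr wx_theta_w_.
case bth : (b theta) => [|k]; first by rewrite !scale0r.
congr (_ *: _); apply: eq_w_ => j; rewrite /dec /inc.
by case: eqP => [->|_]; rewrite ?bth ?subn0 ?addn0 // subn1 addn1.
Qed.

(** The span of the w_b is stable under all x_al and d_al, and contains 1. *)
Lemma w_span (P : W -> Prop) : P 0 -> (forall c b (v : W), P v -> P (c *: w_ theta b + v)) ->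
  forall v : W, P v.
Proof.
move=> P0 PD.
pose comb (v : W) := exists s : seq (K * (Dp -> nat)), v = \sum_(x <- s) x.1 *: w_ theta x.2.
have comb_closed c b (v : W) : comb v -> comb (c *: w_ theta b + v).
  by case=> s ->; exists ((c, b) :: s); rewrite big_cons.
suff all_comb (v : W) : comb v.
  move=> v'; have [s ->] := all_comb v'; elim: s => [|x s IHs]; first by rewrite big_nil.
  by rewrite big_cons; apply: PD.
have comb0 : comb 0 by exists [::]; rewrite big_nil.
have combZ c (p : W) : comb p -> comb (c *: p).
  case=> s ->; exists [seq (c * x.1, x.2) | x <- s]; rewrite scaler_sumr big_map.
  by apply: eq_bigr => x _; rewrite scalerA.
have combD (p q : W) : comb p -> comb q -> comb (p + q).
  by case=> s -> [t ->]; exists (s ++ t); rewrite big_cat.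
have combw c b : comb (c *: w_ theta b) by rewrite -[_ *: _]addr0; apply: comb_closed.
have act_comb (a : A) : (forall b, comb (lact a (w_ theta b))) -> forall p : W, comb p -> comb (lact a p).
  move=> aw p [s ->]; elim: s => [|x s IHs]; first by rewrite big_nil lact0.
  by rewrite big_cons lactDr lactZr; apply: combD => //; apply: combZ.
have w1 : lcls (GT_gens theta) 1 = w_ theta (fun=> 0%N).
  by rewrite w_E /deriv_monomial big1 ?mul1r // => j _; rewrite expr0.
rewrite -(lclsK v); move: (repr v) => u; rewrite -[u]mulr1 -lactE w1 -{1}(wclsK u).
have : comb (w_ theta (fun=> 0%N)) by rewrite -[w_ _ _]scale1r.
elim: (repr u) (w_ _ _) => [c|i|i|s IHs t IHt|s IHs t IHt] p cp.
- by rewrite wclsC lactZl lact1; apply: combZ.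
- apply: act_comb cp => b; have [->|ith] := eqVneq i theta.
    by rewrite wx_theta_w_ -[w_ _ _]scale1r.
  by rewrite wx_w_ // -scaleNr.
- apply: act_comb cp => b; have [->|ith] := eqVneq i theta; first by rewrite wd_theta_w_.
  by rewrite wd_w_ // -[w_ _ _]scale1r.
- by rewrite wclsD lactDl; apply: combD; [apply: IHs|apply: IHt].
by rewrite wclsM lactM; apply: IHs; apply: IHt.
Qed.

Lemma w_span_uniq (v : W) : exists (l : seq {ffun Dp -> nat}) (d : {ffun Dp -> nat} -> K),
  uniq l /\ v = \sum_(b <- l) d b *: w_ theta b.
Proof.
move: v; apply: w_span => [|c b _ [l [d [ul ->] ] ] ].
  by exists [::], (fun=> 0); rewrite big_nil.
pose b' := [ffun i => b i]; have wb : w_ theta b = w_ theta b'.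
  by apply: eq_w_ => i; rewrite ffunE.
have [bl|bl] := boolP (b' \in l).
  exists l, (fun a => d a + (if a == b' then c else 0)); split=> //.
  under [RHS]eq_bigr do rewrite scalerDl.
  rewrite big_split /= addrC; congr (_ + _).
  rewrite (bigD1_seq b') //= eqxx big1 ?addr0 ?wb // => a /negbTE->.
  by rewrite scale0r.
exists (b' :: l), (fun a => if a == b' then c else d a); split; first by rewrite /= bl.
rewrite big_cons eqxx wb; congr (_ + _); apply: eq_big_seq => a al.
by case: eqP al => // ->; rewrite (negbTE bl).
Qed.

(** The partial Fourier transform x_al |-> - d_al, d_al |-> x_al for al <> theta. It
    is an automorphism of the Weyl algebra sending the generators of the left
    ideal to the d_al, up to sign. *)
Fixpoint fourier (t : wterm K Dp) : wterm K Dp :=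
  match t with
  | WConst c => WConst _ c
  | WX i => if i == theta then WX _ i else WMul (WConst _ (-1)) (WD _ i)
  | WD i => if i == theta then WD _ i else WX _ i
  | WAdd s t => WAdd (fourier s) (fourier t)
  | WMul s t => WMul (fourier s) (fourier t)
  end.

Let fourier_x i : wcls (fourier (WX _ i)) = (if i == theta then wx i else - wd i) :> A.
Proof. by rewrite /=; case: eqP => // _; rewrite wclsM wclsC scaleN1r mulN1r. Qed.
Let fourier_d i : wcls (fourier (WD _ i)) = (if i == theta then wd i else wx i) :> A.
Proof. by rewrite /=; case: eqP. Qed.
Let wxd i j : i != j -> wx i * wd j = wd j * wx i :> A.
Proof. by move=> ij; rewrite wdx eq_sym (negbTE ij) scale0r addr0. Qed.

Lemma fourier_weq s t : weq s t -> wcls (fourier s) = wcls (fourier t) :> A.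
Proof.
elim=> {s t} /=; try by move=> *; rewrite ?(wclsD, wclsM); congruence.
- by move=> s t u; rewrite !wclsD addrA.
- by move=> s t; rewrite !wclsD addrC.
- by move=> s; rewrite wclsD wclsC scale0r add0r.
- by move=> s; rewrite wclsD wclsM !wclsC scaleN1r mulN1r addNr scale0r.
- by move=> s t u; rewrite !wclsM mulrA.
- by move=> s; rewrite wclsM wclsC scale1r mul1r.
- by move=> s t u; rewrite !(wclsD, wclsM) mulrDl.
- by move=> s t u; rewrite !(wclsD, wclsM) mulrDr.
- by move=> a b; rewrite wclsD !wclsC scalerDl.
- by move=> a b; rewrite wclsM !wclsC mulr_algl scalerA.
- by move=> a s; rewrite !wclsM wclsC mulr_algl mulr_algr.
- move=> i j; rewrite !wclsM !fourier_x; case: (eqVneq i theta) => ith; case: (eqVneq j theta) => jth.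
  + exact: wxx.
  + by rewrite mulrN mulNr (@wxd i j) // ith eq_sym.
  + by rewrite mulrN mulNr (@wxd j i) // jth eq_sym.
  by rewrite !mulrNN wdd.
- move=> i j; rewrite !wclsM !fourier_d; case: (eqVneq i theta) => ith; case: (eqVneq j theta) => jth.
  + exact: wdd.
  + by rewrite (@wxd j i) ?ith.
  + by rewrite (@wxd i j) ?jth.
  exact: wxx.
move=> i j; rewrite wclsD !wclsM wclsC fourier_x fourier_d.
case: (eqVneq i theta) => ith; case: (eqVneq j theta) => jth.
- exact: wdx.
- by rewrite mulrN mulNr wdd ith eq_sym (negbTE jth) scale0r addr0.
- by rewrite wxx jth (negbTE ith) scale0r addr0.
by rewrite mulrN mulNr wdx opprD eq_sym subrK.
Qed.

(** The Fock representation on power series, twisted by the Fourier transform.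
    The function phi gives the coefficients with respect to the divided powers
    x^a / a!. *)
Definition fock (u : A) (phi : (Dp -> nat) -> K) : (Dp -> nat) -> K :=
  weval (fourier (repr u)) phi.

Lemma fock_wcls t phi : fock (wcls t) phi = weval (fourier t) phi.
Proof.
apply: weval_weq; apply/wclsP; apply: fourier_weq; apply/wclsP.
exact: wclsK.
Qed.

Lemma fockD u v phi : fock (u + v) phi = (fun a => fock u phi a + fock v phi a).
Proof. by rewrite -(wclsK u) -(wclsK v) -wclsD !fock_wcls. Qed.

Lemma fockM u v phi : fock (u * v) phi = fock u (fock v phi).
Proof. by rewrite -(wclsK u) -(wclsK v) -wclsM !fock_wcls. Qed.

Lemma fockZ c u phi : fock (c *: u) phi = (fun a => c * fock u phi a).
Proof. by rewrite -mulr_algl -wclsC fockM fock_wcls. Qed.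

Lemma fock_zero u : fock u (fun=> 0) = (fun=> 0).
Proof.
have := weval_linear (fourier (repr u)) 0 (fun=> 0) (fun=> 0).
have -> : (fun a : Dp -> nat => 0 * 0 + 0) = (fun=> 0) :> (_ -> K).
  by apply/funext => a; rewrite mul0r addr0.
have := weval_linear (fourier (repr u)) (-1) (fun=> 0) (fun=> 0).
have -> : (fun a : Dp -> nat => -1 * 0 + 0) = (fun=> 0) :> (_ -> K).
  by apply/funext => a; rewrite mulr0 addr0.
move=> e _; rewrite /fock e; apply/funext => a; rewrite mulN1r addNr //.
Qed.

Definition delta b (a : Dp -> nat) : K := [forall i, a i == b i]%:R.
(** The elements that the Fourier transform sends to multiplication by x_i. *)
Definition creator i : A := if i == theta then wx i else wd i.

Lemma fock_creator i phi a :
  fock (creator i) phi a = (a i)%:R * phi (fun k => if k == i then (a k).-1 else a k).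
Proof.
by rewrite /creator; case: eqP => ith; rewrite fock_wcls /=; case: eqP.
Qed.

Lemma fock_creator_delta i c b :
  fock (creator i) (fun a => c * delta b a) = (fun a => (c * (b i).+1%:R) * delta (inc b i) a).
Proof.
apply/funext => a; rewrite fock_creator /delta.
case ai: (a i) => [|k].
  rewrite mul0r; case: forallP => [/(_ i)|_]; last by rewrite mulr0.
  by rewrite inc_same ai.
have -> : [forall j, (if j == i then (a j).-1 else a j) == b j] = [forall j, a j == inc b i j].
  apply: eq_forallb => j; have [->|ji] := eqVneq j i; last by rewrite inc_other.
  by rewrite ai inc_same.
case: forallP => [/(_ i)|_]; last by rewrite !mulr0.
by rewrite ai inc_same => /eqP->; rewrite !mulr1 mulrC.
Qed.

(** After the Fourier transform the generators of the ideal differentiate, and so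
    kill constants. *)
Lemma fock_lideal u : lideal (GT_gens theta) u -> fock u (delta (fun=> 0%N)) = (fun=> 0).
Proof.
elim=> {u} [u| |u v _ IHu _ IHv|a u _ IHu].
- have z (i : Dp) a : delta (fun=> 0%N) (fun k => if k == i then (a k).+1 else a k) = 0.
    by rewrite /delta; case: forallP => // /(_ i); rewrite eqxx.
  case=> [ [i ith ->]|->]; rewrite fock_wcls /= ?eqxx ?(negbTE ith) /=; apply/funext => a.
    by rewrite z mulr0.
  exact: z.
- by rewrite -(scale0r 0) fockZ; apply/funext => a; rewrite mul0r.
- by rewrite fockD IHu IHv; apply/funext => a; rewrite addr0.
by rewrite fockM IHu fock_zero.
Qed.

(** Up to a nonzero factor depending on b, the coordinate along w_b. *)
Definition wcoef (v : W) : (Dp -> nat) -> K := fock (repr v) (delta (fun=> 0%N)).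

Lemma wcoef_lcls u : wcoef (lcls (GT_gens theta) u) = fock u (delta (fun=> 0%N)).
Proof.
have : lideal (GT_gens theta) (repr (lcls (GT_gens theta) u) - u).
  by apply/lclsP; rewrite lclsK.
move/fock_lideal => e; apply/funext => a; rewrite /wcoef.
move/(congr1 (fun F => F a)): e; rewrite -scaleN1r fockD fockZ mulN1r => /eqP.
by rewrite subr_eq0 => /eqP.
Qed.

Lemma wcoef_linear c (v w : W) a : wcoef (c *: v + w) a = c * wcoef v a + wcoef w a.
Proof.
rewrite -(lclsK v) -(lclsK w) -lclsZ -lclsD !wcoef_lcls.
by rewrite fockD fockZ.
Qed.

Lemma wcoef0 a : wcoef 0 a = 0.
Proof. by have := wcoef_linear (-1) 0 0 a; rewrite scaler0 addr0 mulN1r addNr. Qed.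

Lemma wcoef_lact u (v : W) : wcoef (lact u v) = fock u (wcoef v).
Proof. by rewrite -(lclsK v) lactE !wcoef_lcls fockM. Qed.

(** The Fourier transform of w_b is the monomial of exponent b; in divided powers
    the constant c is a product of factorials. *)
Lemma wcoef_w_ b : exists2 c, c != 0 & wcoef (w_ theta b) = (fun a => c * delta b a).
Proof.
have [k] := ubnP (\sum_i b i)%N; elim: k b => // k IHk b; rewrite ltnS => bk.
have [b0|] := boolP [forall i, b i == 0%N].
  exists 1; rewrite ?oner_neq0 //.
  have bE : b =1 (fun=> 0%N) by move=> i; apply/eqP/(forallP b0).
  rewrite (eq_w_ bE) w_E /deriv_monomial big1 ?mul1r ?expr0 //.
  rewrite wcoef_lcls -[1](scale1r 1) -wclsC fock_wcls /=; apply/funext => a.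
  rewrite /delta; congr (_ * (_ : bool)%:R).
  by apply: eq_forallb => i; rewrite bE.
rewrite negb_forall => /existsP[i bi].
have bE : b =1 inc (dec b i) i.
  move=> j; rewrite /inc /dec; case: eqP => [->|]; last by rewrite subn0 addn0.
  by rewrite subnK // lt0n.
have [|c c0 cE] := IHk (dec b i).
  apply: leq_trans bk; rewrite (bigD1 i) //= [X in (_ < X)%N](bigD1 i) //=.
  rewrite dec_same (eq_bigr b) => [|j ji]; last by rewrite dec_other.
  by rewrite ltn_add2r prednK // lt0n.
exists (c * (dec b i i).+1%:R); first by rewrite mulf_neq0 ?pnatr_eq0.
rewrite (eq_w_ bE); have -> : w_ theta (inc (dec b i) i) = lact (creator i) (w_ theta (dec b i)).
  by rewrite /creator; case: eqP => [->|/eqP ith]; rewrite ?wx_theta_w_ ?wd_w_.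
rewrite wcoef_lact cE fock_creator_delta; apply/funext => a; congr (_ * _).
by rewrite /delta; congr (_ : bool)%:R; apply: eq_forallb => j; rewrite -bE.
Qed.

End WeylModule.

(** * The power series identity behind the homomorphism *)

Section ToddSeries.
Variable K : numFieldType.
Implicit Types a b c : nat -> K.

(** Coefficients of the product of two power series; associativity and
    commutativity are borrowed from truncated polynomials. *)
Definition conv a b k := \sum_(j < k.+1) a j * b (k - j)%N.

Lemma conv_poly M a b k : (k < M)%N ->
  conv a b k = ((\poly_(i < M) a i) * (\poly_(i < M) b i))`_k.
Proof.
move=> kM; rewrite coefM; apply: eq_bigr => j _.
rewrite !coef_poly (leq_ltn_trans _ kM) ?(leq_ltn_trans _ kM) ?leq_subr //.
by rewrite -ltnS.
Qed.

Lemma eq_conv a a' b b' k : a =1 a' -> b =1 b' -> conv a b k = conv a' b' k.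
Proof. by move=> aa' bb'; apply: eq_bigr => j _; rewrite aa' bb'. Qed.

Lemma convC a b k : conv a b k = conv b a k.
Proof. by rewrite !(@conv_poly k.+1) // mulrC. Qed.

Lemma convA a b c k : conv a (conv b c) k = conv (conv a b) c k.
Proof.
rewrite !(@conv_poly k.+1) //; set A := \poly_(i < _) a i; set C := \poly_(i < _) c i.
transitivity ((A * ((\poly_(i < k.+1) b i) * C))`_k).
  rewrite !coefM; apply: eq_bigr => j _; congr (_ * _).
  by rewrite coef_poly ltnS leq_subr (@conv_poly k.+1) // ltnS leq_subr.
rewrite mulrA !coefM; apply: eq_bigr => j _; congr (_ * _).
by rewrite coef_poly ltn_ord (@conv_poly k.+1).
Qed.

(** The binomial expansion of (1 - 1)^k. *)
Lemma conv_expN_exp k : conv (@expN_coef K) (@exp_coef K) k = (k == 0%N)%:R.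
Proof.
have -> : (k == 0%N)%:R = (k`!%:R)^-1 * (1 - 1) ^+ k :> K.
  by case: k => [|k]; rewrite subrr ?expr0n /= ?mulr0 // invr1 mulr1.
rewrite exprBn mulr_sumr; apply: eq_bigr => j _.
rewrite /expN_coef /exp_coef !expr1n !mulr1 -[_ *+ 'C(_, _)]mulr_natr [RHS]mulrCA -mulrA; congr (_ * _).
have jk : (j <= k)%N by rewrite -ltnS.
have kf : k`!%:R = ('C(k, j) * (j`! * (k - j)`!))%:R :> K by rewrite bin_fact.
rewrite kf !natrM invfM mulrAC mulVf ?mul1r ?invfM //.
by rewrite pnatr_eq0 -lt0n bin_gt0.
Qed.

(** With B = (e^t - 1) / t, the series with coefficients expN_coef k.+1 is
    (e^(-t) - 1) / t = - e^(-t) B, while the Todd series times B is e^t. *)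
Lemma conv_todd k :
  conv (@todd K) (fun i => expN_coef K i.+1) k = - (k == 0%N)%:R.
Proof.
pose B i : K := (i.+1`!%:R)^-1.
have E i : expN_coef K i.+1 = - conv (@expN_coef K) B i.
  have := conv_expN_exp i.+1; rewrite /conv big_ord_recr /= subnn => /eqP.
  rewrite addrC addr_eq0 {1}/exp_coef fact0 invr1 mulr1 => /eqP->; congr (- _).
  by apply: eq_bigr => j _; rewrite /exp_coef /B subSn // -ltnS.
have -> : conv (@todd K) (fun i => expN_coef K i.+1) k
    = - conv (@todd K) (conv (@expN_coef K) B) k.
  by rewrite /conv -sumrN; apply: eq_bigr => j _; rewrite E mulrN.
congr (- _); rewrite convA -conv_expN_exp.
transitivity (conv (conv (@expN_coef K) (@todd K)) B k).
  by apply: eq_conv => // i; rewrite convC.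
rewrite -convA; apply: eq_conv => // i.
by rewrite /conv /B /exp_coef -todd_spec.
Qed.

End ToddSeries.

(** * The Cartan subalgebra in the Weyl algebra *)

Section PureTensors.
Variables (K : numFieldType) (g : lieAlgebra K) (H : {vspace g}).
Variables (Dp : {fset 'Hom(subvs_of H, K^o)}) (f : Dp -> g).
Local Opaque wadd wmul wopp wscale.
Local Notation A := (weyl K Dp).
Local Notation T := (tens Dp).
Implicit Types (P : A) (x y : g) (v w : T).

(** The pure tensor P (x) y. *)
Definition pure P y : T := [ffun j => coord (vbasis {:g}) j y *: P].

Lemma tens_of_pure y : tens_of Dp y = pure 1 y.
Proof. by apply/ffunP => j; rewrite !ffunE. Qed.

Lemma pureZr P c y : pure P (c *: y) = pure (c *: P) y.
Proof. by apply/ffunP => j; rewrite !ffunE linearZ /= scalerA mulrC. Qed.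

Lemma ext_form_linear (phi : g -> K) c v w :
  ext_form phi (c *: v + w) = c *: ext_form phi v + ext_form phi w.
Proof.
rewrite /ext_form scaler_sumr -big_split; apply: eq_bigr => j _ /=.
by rewrite !ffunE scalerDr !scalerA mulrC.
Qed.

Lemma ext_form0 (phi : g -> K) : ext_form phi (0 : T) = 0.
Proof. by rewrite /ext_form big1 // => j _; rewrite ffunE scaler0. Qed.

Lemma ext_form_pure (phi : g -> K) P y : linear (phi : g -> K^o) ->
  ext_form phi (pure P y) = phi y *: P.
Proof.
move=> philin; pose L := HB.pack_for {linear g -> K^o} (phi : g -> K^o)
  (GRing.isLinear.Build K g K^o *:%R (phi : g -> K^o) philin).
have -> : phi y = L y by [].
rewrite {2}(coord_vbasis (memvf y)) linear_sum scaler_suml.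
apply: eq_bigr => j _; rewrite ffunE scalerA linearZ /=.
by rewrite mulrC.
Qed.

Lemma ext_end_linear (L : g -> g) c v w :
  ext_end L (c *: v + w) = c *: ext_end L v + ext_end L w.
Proof. by apply/ffunP => j; rewrite !ffunE ext_form_linear. Qed.

Lemma ext_end_pure (L : {linear g -> g}) P y : ext_end L (pure P y) = pure P (L y).
Proof.
apply/ffunP => j; rewrite !ffunE ext_form_pure // => c u v.
by rewrite !linearP.
Qed.

Lemma ad_u_linear c v w : ad_u f (c *: v + w) = c *: ad_u f v + ad_u f w.
Proof.
rewrite /ad_u scaler_sumr -big_split; apply: eq_bigr => al _ /=.
apply/ffunP => j; rewrite !ffunE ext_form_linear mulrDr; congr (_ + _).
by rewrite scalerAr.
Qed.

Lemma ad_u_pure P y : ad_u f (pure P y) = \sum_(al : Dp) pure (wx al * P) [[f al, y]].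
Proof.
apply: eq_bigr => al _; rewrite ext_end_pure.
by apply/ffunP => j; rewrite !ffunE scalerAr.
Qed.

Lemma ad_u0 : ad_u f 0 = 0.
Proof. by have := ad_u_linear (-1) 0 0; rewrite scaler0 addr0 scaleN1r addNr. Qed.

Lemma iter_ad_u_linear k c v w :
  iter k (ad_u f) (c *: v + w) = c *: iter k (ad_u f) v + iter k (ad_u f) w.
Proof. by elim: k => //= k ->; rewrite ad_u_linear. Qed.

Lemma iter_ad_u_suml k (I : Type) (r : seq I) (c : I -> K) (F : I -> T) :
  iter k (ad_u f) (\sum_(i <- r) c i *: F i) = \sum_(i <- r) c i *: iter k (ad_u f) (F i).
Proof.
elim: r => [|i r IHr]; last by rewrite !big_cons iter_ad_u_linear IHr.
by rewrite !big_nil; elim: k => //= k ->; rewrite ad_u0.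
Qed.

End PureTensors.

Section CartanAction.
Variables (K : numFieldType) (g : lieAlgebra K) (H : {vspace g}).
Variables (Dp : {fset 'Hom(subvs_of H, K^o)}) (f : Dp -> g).
Hypothesis f_basis : root_basis f.
Hypothesis neg_br : forall (al be : Dp) x y,
  x \in rootspace (- val al) -> y \in rootspace (- val be) -> [[x, y]] != 0 ->
  exists2 ga : Dp, val ga = val al + val be & [[x, y]] \in rootspace (- val ga).
Variable ht : Dp -> nat.
Hypothesis ht_lt : forall al be ga : Dp, val ga = val al + val be -> (ht be < ht ga)%N.
Hypothesis neg_disjoint : (nilneg Dp :&: (H + nilpos Dp) = 0)%VS.
Hypothesis cartan_disjoint : (H :&: (nilneg Dp + nilpos Dp) = 0)%VS.
Local Opaque wadd wmul wopp wscale.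
Local Notation A := (weyl K Dp).
Local Notation T := (tens Dp).
Local Notation N := (\dim {:g}).
Implicit Types (P : A) (x y : g) (v w : T) (h : subvs_of H).

(** Heights strictly increase under brackets but have no evident bound; the number
    of roots of smaller height does, and it increases along with the height. *)
Definition height_rank (al : Dp) := #|[set be : Dp | (ht be < ht al)%N]|.

Lemma height_rank_bound al : (height_rank al < N)%N.
Proof.
have [_ bas] := f_basis.
have : (#|[set: Dp]| <= N)%N.
  by rewrite cardsT -(size_basis (X := codom_tuple f) bas) dimvS // subvf.
apply: leq_trans; apply: proper_card; apply/properP.
by split; [exact: subsetT | exists al; rewrite ?inE // ltnn].
Qed.

Lemma height_rank_lt (al be : Dp) : (ht al < ht be)%N -> (height_rank al < height_rank be)%N.
Proof.
move=> ab; apply: proper_card; apply/properP; split.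
  by apply/subsetP => ga; rewrite !inE => /ltn_trans; apply.
by exists al; rewrite inE ?ltnn.
Qed.

(** The filtration of A (x) nbar by rank: sums of P (x) y with y of weight - al and
    k <= height_rank al. *)
Inductive neg_tens (k : nat) : T -> Prop :=
| neg_tens0 : neg_tens k 0
| neg_tensD v w : neg_tens k v -> neg_tens k w -> neg_tens k (v + w)
| neg_tens_pure P al y : (k <= height_rank al)%N -> y \in rootspace (- val al) -> neg_tens k (pure P y).

Lemma neg_tens_sum k (I : finType) (F : I -> T) : (forall i, neg_tens k (F i)) -> neg_tens k (\sum_i F i).
Proof.
by move=> FT; elim/big_ind: _ => [|v w|i _]; [exact: neg_tens0|exact: neg_tensD|exact: FT].
Qed.

Lemma f_root al : f al \in rootspace (- val al).
Proof. by case: f_basis => + _; apply. Qed.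

Lemma pure0 P : pure P 0 = 0.
Proof. by apply/ffunP => j; rewrite !ffunE linear0 scale0r. Qed.

(** Bracketing with f_be raises the height. *)
Lemma neg_tens_ad_u k v : neg_tens k v -> neg_tens k.+1 (ad_u f v).
Proof.
elim=> {v} [|v w _ IHv _ IHw|P al y kal yal].
- by rewrite ad_u0; apply: neg_tens0.
- have := ad_u_linear f 1 v w; rewrite !scale1r => ->; exact: neg_tensD.
rewrite ad_u_pure; apply: neg_tens_sum => be.
have [->|br0] := eqVneq [[f be, y]] 0; first by rewrite pure0; apply: neg_tens0.
have [ga gaE br] := neg_br (f_root be) yal br0.
by apply: (neg_tens_pure _ _ br); apply: leq_ltn_trans kal (height_rank_lt (ht_lt gaE)).
Qed.

Lemma neg_tens_top v : neg_tens N v -> v = 0.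
Proof.
elim=> {v} [//|v w _ -> _ ->|P al y]; first by rewrite addr0.
by rewrite leqNgt height_rank_bound.
Qed.

Lemma neg_tens_iter k l v : neg_tens k v -> neg_tens (l + k) (iter l (ad_u f) v).
Proof. by move=> kv; elim: l => //= l IHl; apply: neg_tens_ad_u. Qed.

Lemma neg_tens_proj k v : neg_tens k v -> ext_end (proj_nilneg Dp) v = v.
Proof.
elim=> {v} [|v w _ IHv _ IHw|P al y _ yal].
- by apply/ffunP => j; rewrite !ffunE ext_form0.
- have := ext_end_linear (proj_nilneg Dp) 1 v w; rewrite !scale1r => ->.
  by rewrite IHv IHw.
rewrite ext_end_pure; congr pure; apply: daddv_pi_id => //.
exact: rootspace_sub_nilneg yal.
Qed.

Lemma proj_cartan_linear : linear (@proj_cartan K g H Dp).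
Proof. by move=> c u v; rewrite /proj_cartan !linearP. Qed.

Lemma proj_cartan_neg y : y \in nilneg Dp -> proj_cartan Dp y = 0.
Proof.
move=> yn; rewrite /proj_cartan; suff -> : daddv_pi H (nilneg Dp + nilpos Dp)%VS y = 0.
  exact: linear0.
have := daddv_pi_add cartan_disjoint (w := y).
have yin : y \in (nilneg Dp + nilpos Dp)%VS by apply: subvP (addvSl _ _) _ yn.
rewrite (daddv_pi_id _ yin) ?[((nilneg Dp + _) :&: _)%VS]capvC // => /(_ (subvP (addvSr _ _) _ yin)).
by move/(canRL (addrK _)); rewrite subrr.
Qed.

Lemma proj_cartan_id h : proj_cartan Dp (vsval h) = h.
Proof. by rewrite /proj_cartan daddv_pi_id ?subvsP // vsvalK. Qed.

Lemma proj_nilneg_cartan h : proj_nilneg Dp (vsval h) = 0.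
Proof.
have hin : vsval h \in (H + nilpos Dp)%VS by apply: subvP (addvSl _ _) _ (subvsP h).
have := daddv_pi_add neg_disjoint (w := vsval h).
rewrite (daddv_pi_id _ hin) ?[((H + _) :&: _)%VS]capvC // => /(_ (subvP (addvSr _ _) _ hin)).
by move/(canRL (addrK _)); rewrite subrr.
Qed.

Lemma neg_tens_cartan k v (mu : 'Hom(subvs_of H, K^o)) : neg_tens k v ->
  ext_form (fun y => mu (proj_cartan Dp y)) v = 0.
Proof.
elim=> {v} [|v w _ IHv _ IHw|P al y _ yal].
- exact: ext_form0.
- have := ext_form_linear (fun y => mu (proj_cartan Dp y)) 1 v w.
  by rewrite !scale1r => ->; rewrite IHv IHw addr0.
rewrite ext_form_pure => [|c u v]; last by rewrite proj_cartan_linear linearP.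
by rewrite proj_cartan_neg ?(rootspace_sub_nilneg yal) // linear0 scale0r.
Qed.

(** The value of ad(u(x)) at h, see ad_u_cartan. *)
Definition ad_u_h h : T := \sum_(al : Dp) pure (wx al) (val al h *: f al).

Lemma ad_u_cartan h : ad_u f (tens_of Dp (vsval h)) = ad_u_h h.
Proof.
rewrite tens_of_pure ad_u_pure; apply: eq_bigr => al _; rewrite mulr1.
rewrite br_antisym (rootspaceP _ _ (f_root al)) lfunE /= scaleNr opprK.
by [].
Qed.

Lemma ad_u_h_neg h : neg_tens 0 (ad_u_h h).
Proof. by apply: neg_tens_sum => al; apply: (neg_tens_pure _ (al := al)); rewrite ?memvZ ?f_root. Qed.

Lemma expN_cartan h : series_ad_u f (@expN_coef K) (tens_of Dp (vsval h)) =
  tens_of Dp (vsval h) + \sum_(k < N) expN_coef K k.+1 *: iter k (ad_u f) (ad_u_h h).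
Proof.
have e0 : expN_coef K 0 = 1 by rewrite /expN_coef /exp_coef fact0 invr1 mulr1.
rewrite /series_ad_u big_ord_recl e0 scale1r; congr (_ + _); apply: eq_bigr => k _.
by rewrite lift0 iterSr ad_u_cartan.
Qed.

(** With Y = ad(u(x)) h, the left-hand side is the product of the Todd series and
    (e^(-t) - 1) / t at t = ad(u(x)), applied to Y. Powers of t of exponent at
    least dim g kill Y, so only the coefficients computed by conv_todd
    matter, whatever the truncation. *)
Lemma todd_expN_cartan h :
  series_ad_u f (@todd K) (\sum_(k < N) expN_coef K k.+1 *: iter k (ad_u f) (ad_u_h h)) = - ad_u_h h.
Proof.
pose Y m := iter m (ad_u f) (ad_u_h h).
have Y0 m : (N <= m)%N -> Y m = 0.
  move=> Nm; apply: neg_tens_top; have := neg_tens_iter m (ad_u_h_neg h); rewrite addn0 -/(Y m).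
  elim=> [|v w _ Hv _ Hw|P al y mal yal]; [exact: neg_tens0|exact: neg_tensD|].
  by apply: (neg_tens_pure _ _ yal); apply: leq_trans Nm mal.
(* evaluation of a polynomial at ad(u(x)), applied to ad(u(x)) h *)
pose Psi (p : {poly K}) : T := \sum_(m < N) p`_m *: Y m.
have PsiD p q : Psi (p + q) = Psi p + Psi q.
  by rewrite -big_split; apply: eq_bigr => m _; rewrite coefD scalerDl.
have Psi0 : Psi 0 = 0 by rewrite /Psi big1 // => m _; rewrite coef0 scale0r.
have PsiX c m : Psi (c *: 'X^m) = c *: Y m.
  have [mN|Nm] := ltnP m N.
    rewrite /Psi (bigD1 (Ordinal mN)) //= coefZ coefXn eqxx mulr1 big1 ?addr0 // => j jm.
    by rewrite coefZ coefXn -val_eqE in jm *; rewrite (negbTE jm) mulr0 scale0r.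
  rewrite (Y0 _ Nm) scaler0 /Psi big1 // => j _.
  by rewrite coefZ coefXn ltn_eqF ?mulr0 ?scale0r // (leq_trans (ltn_ord j)).
pose pT := \poly_(i < N.+1) todd K i; pose pE := \poly_(i < N) expN_coef K i.+1.
have -> : series_ad_u f (@todd K) (\sum_(k < N) expN_coef K k.+1 *: Y k) = Psi (pT * pE).
  rewrite /pT /pE !poly_def mulr_suml (big_morph Psi PsiD Psi0); apply: eq_bigr => j _.
  rewrite iter_ad_u_suml scaler_sumr mulr_sumr (big_morph Psi PsiD Psi0).
  apply: eq_bigr => k _; rewrite -[in RHS]scalerAl -[in RHS]scalerAr [in RHS]scalerA -exprD PsiX.
  by rewrite scalerA /Y iterD.
have cE m : (m < N)%N -> (pT * pE)`_m = - (m == 0%N)%:R.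
  move=> mN; rewrite -conv_todd coefM; apply: eq_bigr => j _; rewrite !coef_poly.
  have jN : (j < N.+1)%N by apply: leq_trans (ltn_ord j) _; rewrite ltnS ltnW.
  by rewrite jN (leq_ltn_trans (leq_subr _ _) mN).
have [N0|N0] := posnP N.
  have ad_u_h0 : ad_u_h h = 0 by rewrite -[LHS]/(Y 0%N) Y0 // N0.
  rewrite ad_u_h0 oppr0 /Psi big1 // => j _.
  by have jN := ltn_ord j; rewrite [X in (_ < X)%N]N0 in jN.
rewrite /Psi (bigD1 (Ordinal N0)) //= cE // scaleN1r big1 ?addr0 // => j j0.
by rewrite cE // -val_eqE in j0 *; rewrite (negbTE j0) oppr0 scale0r.
Qed.

Lemma coord_f_linear al : linear (coord_f f al : g -> K^o).
Proof. by move=> c u v; rewrite /coord_f linearP. Qed.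

Lemma coord_ad_u_h al h : ext_form (coord_f f al) (ad_u_h h) = val al h *: wx al.
Proof.
have add v w : ext_form (coord_f f al) (v + w) = ext_form (coord_f f al) v + ext_form (coord_f f al) w.
  by have := ext_form_linear (coord_f f al) 1 v w; rewrite !scale1r.
have cZ be (c : K) : coord_f f al (c *: f be) = c * (al == be)%:R.
  by rewrite -(coord_fE f_basis) /coord_f linearZ.
rewrite /ad_u_h (big_morph _ add (ext_form0 _ _)) (bigD1 al) //= big1 => [|be beal].
  rewrite ext_form_pure; last exact: coord_f_linear.
  by rewrite cZ eqxx mulr1 addr0.
rewrite ext_form_pure; last exact: coord_f_linear.
by rewrite cZ eq_sym (negbTE beal) mulr0 scale0r.
Qed.

(** Only h itself contributes to the component along H, and only the term
    -Y of todd_expN_cartan to the component along nbar. *)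
Lemma pi_mu_cartan (mu : 'Hom(subvs_of H, K^o)) h :
  pi_mu f mu (vsval h) =
  \sum_(al : Dp) val al h *: (wx al * wd al) + ((mu + rho Dp) h : K)%:A.
Proof.
rewrite /pi_mu expN_cartan.
set S := \sum_(k < _) _.
have Sneg : neg_tens 0 S.
  rewrite /S; elim/big_ind: _ => [|v w|k _]; [exact: neg_tens0|exact: neg_tensD|].
  have := neg_tens_iter k (ad_u_h_neg h); rewrite addn0 => kY.
  suff neg0 v : neg_tens k v -> neg_tens 0 (expN_coef K k.+1 *: v) by apply: neg0.
  elim=> {v} [|v w _ IHv _ IHw|P al y _ yal]; first by rewrite scaler0; apply: neg_tens0.
    by rewrite scalerDr; apply: neg_tensD.
  have -> : expN_coef K k.+1 *: pure P y = pure P (expN_coef K k.+1 *: y).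
    by rewrite pureZr; apply/ffunP => j; rewrite !ffunE !scalerA mulrC.
  by apply: (neg_tens_pure _ (al := al)); rewrite ?memvZ.
have -> : ext_end (proj_nilneg Dp) (tens_of Dp (vsval h) + S) = S.
  have := ext_end_linear (proj_nilneg Dp) 1 (tens_of Dp (vsval h)) S.
  rewrite !scale1r => ->; rewrite (neg_tens_proj Sneg) tens_of_pure ext_end_pure /=.
  by rewrite proj_nilneg_cartan pure0 add0r.
rewrite todd_expN_cartan; congr (_ + _).
  rewrite -sumrN; apply: eq_bigr => al _.
  have := ext_form_linear (coord_f f al) (-1) (ad_u_h h) 0.
  rewrite scaleN1r addr0 ext_form0 addr0 => ->.
  by rewrite coord_ad_u_h scaleN1r mulNr opprK scalerAl.
have := ext_form_linear (fun y => (mu + rho Dp) (proj_cartan Dp y)) 1 (tens_of Dp (vsval h)) S.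
rewrite !scale1r => ->; rewrite (neg_tens_cartan _ Sneg) addr0 tens_of_pure ext_form_pure.
  by rewrite proj_cartan_id.
by move=> c u v; rewrite proj_cartan_linear linearP.
Qed.

End CartanAction.

(** * Spans and sums over sequences *)

Section SeqSums.
Variables (I J : eqType) (V : nmodType).

Lemma sum_by_value (l : seq I) (p : I -> J) (F : I -> V) :
  \sum_(i <- l) F i = \sum_(j <- undup [seq p i | i <- l]) \sum_(i <- l | p i == j) F i.
Proof.
rewrite (exchange_big_dep xpredT) //=; apply: eq_big_seq => i il.
rewrite big_mkcond (bigD1_seq (p i)) ?undup_uniq ?mem_undup ?map_f //= eqxx.
by rewrite big1 ?addr0 // => j; rewrite eq_sym => /negbTE->.
Qed.

End SeqSums.

Lemma in_span_sum (K : fieldType) (V : lmodType K) (B : V -> Prop) (I : eqType)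
    (l : seq I) (d : I -> K) (x : I -> V) :
  (forall i, i \in l -> d i != 0 -> B (x i)) -> in_span B (\sum_(i <- l) d i *: x i).
Proof.
move=> Bx; pose l' := [seq i <- l | d i != 0].
exists (undup [seq x i | i <- l']), (fun y => \sum_(i <- l' | x i == y) d i); split.
  move=> y; rewrite mem_undup => /mapP[j]; rewrite mem_filter => /andP[dj jl] ->.
  exact: Bx.
have -> : \sum_(i <- l) d i *: x i = \sum_(i <- l') d i *: x i.
  rewrite big_filter [RHS]big_mkcond; apply: eq_bigr => i _.
  by case: eqP => // ->; rewrite scale0r.
rewrite (sum_by_value _ x); apply: eq_bigr => y _.
by rewrite scaler_suml; apply: eq_bigr => i /eqP->.
Qed.

(** * Exponents with a given weight *)

Section WeightCombinatorics.
Variables (K : numFieldType) (g : lieAlgebra K) (H : {vspace g}).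
Variables (Pi Dp : {fset 'Hom(subvs_of H, K^o)}) (theta : Dp).
Hypothesis Pi_simple : simple_roots Pi.
Hypothesis Pi_Dp : forall i : Pi, val i \in Dp.
Hypothesis theta_Pi : val theta \notin Pi.
Variable m : Dp -> Pi -> nat.
Hypothesis m_coef : forall al : Dp, val al = \sum_(i : Pi) val i *+ m al i.
Hypothesis m_simple : forall (al : Dp) (i : Pi), val al = val i -> forall j, m al j = (j == i).
Hypothesis m_theta : forall i, (0 < m theta i)%N.
Variable lam : 'Hom(subvs_of H, K^o).
Implicit Types (a : Pi -> int) (b : Dp -> int) (al be : Dp) (i j : Pi).

Definition pos_of i : Dp := FSetSub (Pi_Dp i).

Lemma pos_of_coef i j : m (pos_of i) j = (j == i).
Proof. exact: m_simple. Qed.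

Lemma pos_ofP al : val al \in Pi -> exists i, al = pos_of i.
Proof. by move=> alPi; exists (FSetSub alPi); apply: val_inj. Qed.

Lemma pos_of_simple i : val (pos_of i) \in Pi.
Proof. exact: valP i. Qed.

Lemma pos_of_neq_theta i : pos_of i != theta.
Proof. by apply: contraNneq theta_Pi => <-; apply: pos_of_simple. Qed.

Lemma ext0_pos_of a i : ext0 a (pos_of i) = a i.
Proof. by rewrite /ext0 [insub _](valK i). Qed.

Lemma ext0_out a al : val al \notin Pi -> ext0 a al = 0.
Proof. by move=> alPi; rewrite /ext0 insubN. Qed.

Lemma t_pos_of al i : t_ theta m al (pos_of i) = if al == theta then (m al i)%:Z else - (m al i)%:Z.
Proof. by rewrite /t_ [insub _](valK i). Qed.

Lemma t_out al be : val be \notin Pi -> t_ theta m al be = (be == al)%:Z.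
Proof. by move=> bePi; rewrite /t_ insubN. Qed.

(** The coordinates of mu_ b - lam - theta in the base Pi (mu_E). *)
Definition weight_coef b i : int :=
  - (\sum_(al | al != theta) b al * (m al i)%:Z) + b theta * (m theta i)%:Z.

Lemma mu_E b : mu_ theta lam b = \sum_(i : Pi) (weight_coef b i)%:~R *: val i + (lam + val theta).
Proof.
rewrite /mu_ addrA; congr (_ + _ + _).
have E al : val al *~ b al = \sum_(i : Pi) (b al * (m al i)%:Z)%:~R *: val i.
  rewrite {1}m_coef nat_comb_scale -scaler_int scaler_sumr; apply: eq_bigr => i _.
  by rewrite scalerA rmorphM.
rewrite (E theta) (eq_bigr _ (fun al _ => E al)) exchange_big -sumrN -big_split.
apply: eq_bigr => i _ /=; rewrite -scaler_suml -scaleNr -scalerDl; congr (_ *: _).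
by rewrite /weight_coef rmorphD rmorphN rmorph_sum.
Qed.

Lemma mu_eqP b b' : mu_ theta lam b = mu_ theta lam b' <-> weight_coef b =1 weight_coef b'.
Proof.
rewrite !mu_E; split=> [/addIr/(simple_coef_inj Pi_simple) e i|e].
  by have /eqP := e i; rewrite eqr_int => /eqP.
by congr (_ + _); apply: eq_bigr => i _; rewrite e.
Qed.

Lemma weight_coef_split b i : weight_coef b i = - b (pos_of i)
  + \sum_(al | val al \notin Pi) b al * t_ theta m al (pos_of i).
Proof.
rewrite /weight_coef (bigID (fun al => val al \in Pi)) /= opprD -addrA; congr (- _ + _).
  rewrite (bigD1 (pos_of i)) ?pos_of_neq_theta ?pos_of_simple //= pos_of_coef eqxx mulr1 big1 ?addr0 // => al.
  case/andP=> /andP[_ /pos_ofP[j ->] ]; rewrite pos_of_coef; have [->|_] := eqVneq i j.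
    by rewrite eqxx.
  by rewrite mulr0.
rewrite [RHS](bigD1 theta) //= t_pos_of eqxx [RHS]addrC; congr (_ + _).
rewrite -sumrN; apply: eq_big => [al|al /andP[ath _] ]; first by rewrite andbC.
by rewrite t_pos_of (negbTE ath) mulrN.
Qed.

Lemma weight_coef_ext0 a i : weight_coef (ext0 a) i = - a i.
Proof.
rewrite weight_coef_split ext0_pos_of big1 ?addr0 // => al alPi.
by rewrite ext0_out // mul0r.
Qed.

(** Off Pi both sides agree, as t_al is the indicator of al there. At a simple
    root the equation is that of the coordinates of the two weights. *)
Lemma mu_ext0P a b : mu_ theta lam b = mu_ theta lam (ext0 a) <->
  forall be, b be = ext0 a be + \sum_(al | val al \notin Pi) b al * t_ theta m al be.
Proof.
split=> [/mu_eqP e be|e].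
  have [/pos_ofP[i ->]|bePi] := boolP (val be \in Pi).
    have := e i; rewrite weight_coef_ext0 weight_coef_split ext0_pos_of => /eqP.
    rewrite addrC subr_eq addrC => /eqP->.
    by rewrite addrCA subrr addr0.
  rewrite ext0_out // add0r (bigD1 be) //= t_out // eqxx mulr1 big1 ?addr0 // => al.
  by case/andP=> _ albe; rewrite t_out // eq_sym (negbTE albe) mulr0.
apply/mu_eqP => i; rewrite weight_coef_ext0 weight_coef_split e ext0_pos_of opprD -addrA.
by rewrite addNr addr0.
Qed.

Lemma mu_is_ext0 b : exists a, mu_ theta lam b = mu_ theta lam (ext0 a).
Proof.
by exists (fun i => - weight_coef b i); apply/mu_eqP => i; rewrite weight_coef_ext0 opprK.
Qed.

Lemma t_theta_ge0 be : 0 <= t_ theta m theta be.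
Proof.
have [/pos_ofP[i ->]|bePi] := boolP (val be \in Pi); first by rewrite t_pos_of eqxx.
by rewrite t_out.
Qed.

Lemma shift_t_theta a n : shift_t theta m a n theta = n%:Z.
Proof. by rewrite /shift_t ext0_out // t_out // eqxx mulr1 add0r. Qed.

Lemma shift_t_sum a n be : shift_t theta m a n be =
  ext0 a be + \sum_(al | val al \notin Pi) shift_t theta m a n al * t_ theta m al be.
Proof.
rewrite {1}/shift_t (bigD1 theta) //= shift_t_theta big1 ?addr0 // => al /andP[alPi alth].
by rewrite /shift_t ext0_out // t_out // (negbTE alth) mulr0 addr0 mul0r.
Qed.

Lemma mu_shift_t a n : mu_ theta lam (shift_t theta m a n) = mu_ theta lam (ext0 a).
Proof. by apply/mu_ext0P => be; apply: shift_t_sum. Qed.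

(** As all coefficients of theta are positive, the sum of the |a i| is large
    enough. *)
Lemma least_shift_exists a : exists n, least_shift theta m a n.
Proof.
pose P n := [forall be, 0 <= shift_t theta m a n be].
have exP : exists n, P n.
  exists (\sum_i `|a i|)%N; apply/forallP => be.
  have [/pos_ofP[i ->]|bePi] := boolP (val be \in Pi); last first.
    by rewrite /shift_t ext0_out // add0r mulr_ge0 // t_theta_ge0.
  rewrite /shift_t ext0_pos_of t_pos_of eqxx -PoszM.
  have : (`|a i| <= (\sum_i `|a i|) * m theta i)%N.
    apply: leq_trans (leq_pmulr _ (m_theta i)).
    by rewrite (bigD1 i) //= leq_addr.
  rewrite -lez_nat => le; rewrite -[X in X + _]opprK addrC subr_ge0.
  apply: le_trans le; rewrite abszE -normrN; exact: ler_norm.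
case: (ex_minnP exP) => n /forallP Pn nmin; exists n; split=> // k Pk.
by apply: nmin; apply/forallP.
Qed.

(** At a simple root i, mu_ext0P gives a i + b theta * m theta i =
    b i + sum of the b al * m al i, which is nonnegative, so b theta is an
    admissible shift. *)
Lemma least_shift_le a n b : least_shift theta m a n -> (forall be, 0 <= b be) ->
  mu_ theta lam b = mu_ theta lam (ext0 a) -> n%:Z <= b theta.
Proof.
move=> [_ nmin] b0 /mu_ext0P bE; rewrite -(gez0_abs (b0 theta)) lez_nat.
apply: nmin => be; rewrite /shift_t (gez0_abs (b0 theta)).
have [/pos_ofP[i ->]|bePi] := boolP (val be \in Pi); last first.
  by rewrite ext0_out // add0r mulr_ge0 // t_theta_ge0.
have := bE (pos_of i); rewrite (bigD1 theta) //= addrA => /eqP; rewrite -subr_eq => /eqP <-.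
rewrite addr_ge0 // -sumrN sumr_ge0 // => al /andP[_ alth].
by rewrite t_pos_of (negbTE alth) mulrN opprK mulr_ge0.
Qed.

Lemma W_basis_weight a n (b : Dp -> nat) t : Lambda_plus theta m t ->
  (forall be, (b be)%:Z = shift_t theta m a n be + t be) ->
  mu_ theta lam (fun be => (b be)%:Z) = mu_ theta lam (ext0 a).
Proof.
move=> [c tE] bE; apply/mu_ext0P => be.
have bout al : val al \notin Pi -> (b al)%:Z = (c al)%:Z + n%:Z * (al == theta)%:Z.
  move=> alPi; rewrite bE tE /shift_t ext0_out // add0r t_out // addrC; congr (_ + _).
  rewrite (bigD1 al) //= t_out // eqxx mulr1 big1 ?addr0 // => ga /andP[_ gaal].
  by rewrite t_out // eq_sym (negbTE gaal) mulr0.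
rewrite bE {1}/shift_t -addrA; congr (_ + _); rewrite tE.
under [RHS]eq_bigr => al alPi do rewrite bout // mulrDl.
rewrite big_split /= addrC; congr (_ + _).
rewrite (bigD1 theta) //= eqxx mulr1 big1 ?addr0 // => al /andP[_ /negbTE->].
by rewrite mulr0 mul0r.
Qed.

(** The multiplicities in Lambda_+ are the b al, reduced by n at theta; this is
    where n <= b theta matters. *)
Lemma weight_in_basis a n (b : Dp -> nat) : least_shift theta m a n ->
  mu_ theta lam (fun be => (b be)%:Z) = mu_ theta lam (ext0 a) ->
  exists t, Lambda_plus theta m t /\
    forall be, (b be)%:Z = shift_t theta m a n be + t be.
Proof.
move=> an bmu; have nb : (n <= b theta)%N by have := least_shift_le an _ bmu; rewrite lez_nat; apply.
pose c al := if al == theta then (b theta - n)%N else b al.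
exists (fun be => \sum_(al : Dp | val al \notin Pi) (c al)%:Z * t_ theta m al be).
split=> [|be]; first by exists c.
rewrite (proj1 (mu_ext0P _ _) bmu) /shift_t -addrA; congr (_ + _).
rewrite (bigD1 theta) //= [X in _ = _ + X](bigD1 theta) //= addrA; congr (_ + _).
  by rewrite /c eqxx -mulrDl -PoszD subnKC.
by apply: eq_bigr => al /andP[_ alth]; rewrite /c (negbTE alth).
Qed.

End WeightCombinatorics.

(** * Weights of the Gelfand-Tsetlin module *)

Section GelfandTsetlin.
Variables (K : numClosedFieldType) (g : lieAlgebra K).
Hypothesis g_simple : lie_simple g.
Hypothesis g_not_sl2 : ~ lie_isog_sl2 g.
Variable H : {vspace g}.
Hypothesis H_cartan : cartan_subalgebra H.
Variables (Pi Dp : {fset 'Hom(subvs_of H, K^o)}).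
Hypothesis Pi_simple : simple_roots Pi.
Hypothesis Dp_positive : positive_roots Pi Dp.
Variable theta : Dp.
Hypothesis theta_max : maximal_root Pi (val theta).
Variable f : Dp -> g.
Hypothesis f_basis : root_basis f.
Variable m : Dp -> Pi -> nat.
Hypothesis m_coef : forall al : Dp, val al = \sum_(i : Pi) val i *+ m al i.
Variable lam : 'Hom(subvs_of H, K^o).
Local Opaque wadd wmul wopp wscale.
Local Notation W := (Wmod theta).
Implicit Types (h : subvs_of H) (b : Dp -> nat) (al be : Dp).

Definition cartan_act h (v : W) : W := Wact f lam (vsval h) v.

Definition wt b := mu_ theta lam (fun al => (b al)%:Z).

Lemma cartan_act_linear h : linear (cartan_act h).
Proof. exact: lact_linear. Qed.

Lemma simple_in_pos (i : Pi) : val i \in Dp.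
Proof.
apply/Dp_positive; split; first by case: Pi_simple => _ + _; apply; apply: valP.
exists (fun j => (j == i) : nat); rewrite (bigD1 i) //= eqxx big1 ?addr0 // => j.
by move/negbTE->.
Qed.

Definition height al := (\sum_i m al i)%N.

Lemma height_lt al be ga : val ga = val al + val be -> (height be < height ga)%N.
Proof.
move=> gaE; have mE i : m ga i = (m al i + m be i)%N.
  have e : \sum_(i : Pi) (m ga i)%:R *: val i = \sum_(i : Pi) (m al i + m be i)%:R *: val i.
    rewrite -nat_comb_scale -m_coef gaE (m_coef al) (m_coef be) -big_split.
    by apply: eq_bigr => j _ /=; rewrite -mulrnDr scaler_nat.
  by have /eqP := simple_coef_inj Pi_simple e i; rewrite eqr_nat => /eqP.
rewrite /height (eq_bigr _ (fun i _ => mE i)) big_split /= -[X in (X < _)%N]add0n ltn_add2r.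
rewrite lt0n; apply: contraNneq (pos_neq0 Dp_positive al) => /eqP.
rewrite sum_nat_eq0 => /forallP al0; rewrite m_coef big1 // => i _.
by have /eqP-> := al0 i.
Qed.

Lemma cartan_pi (mu : 'Hom(subvs_of H, K^o)) h : pi_mu f mu (vsval h) =
  \sum_(al : Dp) val al h *: (wx al * wd al) + ((mu + rho Dp) h : K)%:A.
Proof.
apply: (pi_mu_cartan f_basis _ height_lt).
- exact: (neg_rootspace_br g_simple H_cartan Pi_simple Dp_positive).
- exact: (nilneg_disjoint H_cartan Pi_simple Dp_positive).
- exact: (cartan_disjoint H_cartan Pi_simple Dp_positive).
Qed.

Lemma rho_double : rho Dp + rho Dp = \sum_(al : Dp) val al.
Proof.
by rewrite /rho -scalerDl -mulr2n -[_ *+ 2]mulr_natr mulVf ?pnatr_eq0 // scale1r.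
Qed.

(** The constant lam + rho + rho absorbs the shifts by 1 of xd_w_ and leaves
    lam + theta. *)
Lemma cartan_act_w_ h b : cartan_act h (w_ theta b) = (wt b h : K) *: w_ theta b.
Proof.
rewrite /cartan_act /Wact cartan_pi lactDl lact_suml lactZl lact1.
pose c al : K := if al == theta then (b al)%:R else - (b al).+1%:R.
have E al : lact (val al h *: (wx al * wd al)) (w_ theta b) = (val al h * c al) *: w_ theta b.
  rewrite lactZl /c -scalerA; have [->|ath] := eqVneq al theta; first by rewrite xd_theta_w_.
  by rewrite xd_w_ // scaleNr.
rewrite (eq_bigr _ (fun al _ => E al)) -scaler_suml -scalerDl; congr (_ *: _).
have -> : wt b = \sum_al c al *: val al + (lam + rho Dp + rho Dp).
  have split_th (F : Dp -> 'Hom(subvs_of H, K^o)) :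
    \sum_al F al = F theta + \sum_(al | al != theta) F al by rewrite (bigD1 theta).
  rewrite /wt /mu_ -addrA -[lam + rho Dp + _]addrA rho_double !split_th /c eqxx scaler_nat.
  have -> : \sum_(al | al != theta) (if al == theta then (b al)%:R else - (b al).+1%:R) *: val al
      = - \sum_(al | al != theta) val al *~ (b al)%:Z - \sum_(al | al != theta) val al.
    rewrite -!sumrN -big_split; apply: eq_bigr => al /negbTE->.
    by rewrite scaleNr scaler_nat mulrSr opprD.
  rewrite [LHS]addrAC -!addrA; set S := \sum_(_ | _) _; set U := \sum_(_ | _) _.
  rewrite -[val theta *~ _]/(val theta *+ b theta).
  have -> : - U + (lam + (val theta + U)) = lam + val theta.
    by rewrite addrCA [- U + _]addrCA addNr addr0.
  by rewrite [RHS]addrC -!addrA.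
rewrite !add_lfunE sum_lfunE; congr (_ + _).
by apply: eq_bigr => al _; rewrite lfunE /= mulrC.
Qed.

Lemma wcoef_sum (I : Type) (l : seq I) (c : I -> K) (F : I -> W) b :
  wcoef (\sum_(i <- l) c i *: F i) b = \sum_(i <- l) c i * wcoef (F i) b.
Proof. by elim: l => [|i l IHl]; rewrite ?big_nil ?wcoef0 // !big_cons wcoef_linear IHl. Qed.

Lemma wcoef_w_diag b : wcoef (w_ theta b) b != 0.
Proof.
have [c c0 ->] := wcoef_w_ theta b; rewrite /delta.
by case: forallP => [_|[] //]; rewrite mulr1.
Qed.

Lemma wcoef_w_out b b' : wcoef (w_ theta b) b' != 0 -> b' =1 b.
Proof.
have [c c0 ->] := wcoef_w_ theta b; rewrite /delta.
by case: forallP => [e _ al|_]; [exact/eqP | rewrite mulr0 eqxx].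
Qed.

Lemma wcoef_cartan_act h (v : W) b : wcoef (cartan_act h v) b = wt b h * wcoef v b.
Proof.
have [l [d [_ ->] ] ] := w_span_uniq v; elim: l => [|b' l IHl].
  by rewrite big_nil /cartan_act /Wact lact0 wcoef0 mulr0.
rewrite big_cons cartan_act_linear cartan_act_w_ !wcoef_linear IHl mulrDr; congr (_ + _).
have cZ c (v' : W) : wcoef (c *: v') b = c * wcoef v' b.
  by have := wcoef_linear c v' 0 b; rewrite wcoef0 !addr0.
rewrite cZ; have [->|/wcoef_w_out bb'] := eqVneq (wcoef (w_ theta b') b) 0.
  by rewrite !mulr0.
have -> : wt b = wt b' by congr mu_; apply/funext => al; rewrite bb'.
by rewrite mulrCA.
Qed.

Lemma wcoef_comb (l : seq {ffun Dp -> nat}) d (b : {ffun Dp -> nat}) : uniq l -> b \in l ->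
  wcoef (\sum_(b <- l) d b *: w_ theta b) b = d b * wcoef (w_ theta b) b.
Proof.
move=> ul bl; rewrite wcoef_sum (bigD1_seq b) //= big1 ?addr0 // => b' b'b.
apply/eqP; rewrite mulf_eq0; apply/orP; right; apply: contraNT b'b => /wcoef_w_out bb'.
by apply/eqP/ffunP => al; rewrite bb'.
Qed.

Lemma wcoef_eq0 (v : W) : (forall b, wcoef v b = 0) -> v = 0.
Proof.
have [l [d [ul ->] ] ] := w_span_uniq v => c0.
rewrite big_seq big1 // => b bl; suff -> : d b = 0 by rewrite scale0r.
by have /eqP := c0 b; rewrite wcoef_comb // mulf_eq0 (negbTE (wcoef_w_diag b)) orbF => /eqP.
Qed.

Lemma wcoef_weight mu (v : W) b : weight_space cartan_act mu v -> wcoef v b != 0 -> wt b = mu.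
Proof.
move=> vmu vb; apply/lfunP => h; apply: (mulIf vb).
by rewrite -wcoef_cartan_act vmu; have := wcoef_linear (mu h) v 0 b; rewrite wcoef0 !addr0.
Qed.

Lemma w_weight b : weight_space cartan_act (wt b) (w_ theta b).
Proof. by move=> h; rewrite cartan_act_w_. Qed.

Lemma w_neq0 b : w_ theta b != 0.
Proof. by apply: contraNneq (wcoef_w_diag b) => ->; rewrite wcoef0. Qed.

Let th_Pi := highest_root_not_simple g_simple H_cartan Pi_simple Dp_positive theta_max
  f_basis m_coef g_not_sl2.
Let m_th := highest_root_support g_simple H_cartan Pi_simple Dp_positive theta_max m_coef.
Let m_simple := simple_coef_pos Pi_simple m_coef.

Definition nat_shift (a : Pi -> int) n al : nat := `|shift_t theta m a n al|%N.

Lemma nat_shift_ge (a : Pi -> int) n k : least_shift theta m a n ->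
  forall al, (nat_shift a (n + k) al)%:Z = shift_t theta m a (n + k) al.
Proof.
move=> [n0 _] al; rewrite /nat_shift gez0_abs // /shift_t PoszD mulrDl addrA.
rewrite addr_ge0 ?mulr_ge0 //; first exact: (n0 al).
by apply: t_theta_ge0; apply: simple_in_pos.
Qed.

Lemma wt_nat_shift (a : Pi -> int) n k : least_shift theta m a n ->
  wt (nat_shift a (n + k)) = mu_ theta lam (ext0 a).
Proof.
move=> an; rewrite /wt -(mu_shift_t Pi_simple simple_in_pos th_Pi m_coef m_simple lam a (n + k)).
by congr mu_; apply/funext => al; rewrite (nat_shift_ge _ an).
Qed.

Lemma weights_of_W mu : is_weight cartan_act mu <-> exists a : Pi -> int, mu = mu_ theta lam (ext0 a).
Proof.
split=> [ [v vmu v0]|[a ->] ].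
  have [b vb] : exists b, wcoef v b != 0.
    apply/not_existsP => v0'; case/eqP: v0; apply: wcoef_eq0 => b.
    by apply/eqP; apply: contra_notT (v0' b).
  rewrite -(wcoef_weight vmu vb).
  exact: (mu_is_ext0 Pi_simple simple_in_pos th_Pi m_coef m_simple).
have [n an] := least_shift_exists simple_in_pos m_th a.
exists (w_ theta (nat_shift a (n + 0))); last exact: w_neq0.
by rewrite -(wt_nat_shift 0 an); apply: w_weight.
Qed.

Lemma weight_module_W : weight_module cartan_act.
Proof.
split=> [v|]; last by move=> s c; apply: weight_vectors_independent; apply: cartan_act_linear.
have [l [d [_ ->] ] ] := w_span_uniq v.
rewrite (sum_by_value _ (fun b : {ffun Dp -> nat} => wt b)).
exists (undup [seq wt b | b : {ffun Dp -> nat} <- l]).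
exists (fun mu => \sum_(b <- l | wt b == mu) d b *: w_ theta b); split=> // mu _ h.
rewrite (big_morph (cartan_act h) (id1 := 0) (op1 := +%R)) => [|u w|]; last exact: lact0.
  rewrite scaler_sumr; apply: eq_bigr => b /eqP <-.
  have -> : cartan_act h (d b *: w_ theta b) = d b *: cartan_act h (w_ theta b) by apply: lactZr.
  by rewrite cartan_act_w_ !scalerA mulrC.
by have := cartan_act_linear h 1 u w; rewrite !scale1r.
Qed.

(** Finitely many vectors involve finitely many exponents of x_theta. *)
Lemma wcoef_bounded (s : seq W) : exists M, forall v b, v \in s -> (M <= b theta)%N -> wcoef v b = 0.
Proof.
elim: s => [|v s [M sM] ]; first by exists 0%N.
have [Mv vM] : exists Mv, forall b, (Mv <= b theta)%N -> wcoef v b = 0.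
  have [l [d [_ ->] ] ] := w_span_uniq v; elim: l => [|b' l [N lN] ].
    by exists 0%N => b _; rewrite big_nil wcoef0.
  exists (maxn N (b' theta).+1) => b; rewrite geq_max => /andP[Nb b'b].
  rewrite big_cons wcoef_linear lN // addr0.
  have [->|/wcoef_w_out bb'] := eqVneq (wcoef (w_ theta b') b) 0; first by rewrite mulr0.
  by rewrite bb' ltnn in b'b.
exists (maxn Mv M) => w b; rewrite inE geq_max => /predU1P[->|ws] /andP[Mvb Mb]; first exact: vM.
exact: sM.
Qed.

(** The vectors w_b with b = a + (n + M) t_theta all lie in the weight space, and
    x_theta occurs in them with exponent n + M. *)
Lemma weight_space_infinite mu : is_weight cartan_act mu -> infinite_dim (weight_space cartan_act mu).
Proof.
case/weights_of_W=> a -> [s span].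
have [n an] := least_shift_exists simple_in_pos m_th a.
have [M sM] := wcoef_bounded s; pose b := nat_shift a (n + M).
have [|s' [c [s's wE] ] ] := span (w_ theta b).
  by rewrite -(wt_nat_shift M an); apply: w_weight.
have bM : (M <= b theta)%N.
  by rewrite -lez_nat /b (nat_shift_ge M an) shift_t_theta // lez_nat leq_addl.
case/eqP: (wcoef_w_diag b); rewrite wE wcoef_sum big1_seq // => x /andP[_ xs].
by rewrite (sM x b) ?mulr0 // s's.
Qed.

(** A weight vector only involves the w_b of its own weight. *)
Lemma weight_space_basis (a : Pi -> int) : exists n : nat, least_shift theta m a n /\
  subspace_basis (weight_space cartan_act (mu_ theta lam (ext0 a))) (W_basis theta m a n).
Proof.
have [n an] := least_shift_exists simple_in_pos m_th a; exists n; split=> //.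
split=> [v [t [b [tL bE ->] ] ]|s c us sB sum0 x xs|v vmu].
- rewrite -(W_basis_weight Pi_simple simple_in_pos th_Pi m_coef m_simple lam tL bE).
  exact: w_weight.
- have [t [b [_ _ xE] ] ] := sB x xs.
  have : wcoef (\sum_(y <- s) c y *: y) b = c x * wcoef x b.
    rewrite wcoef_sum (bigD1_seq x) //= big1_seq ?addr0 // => y /andP[yx ys].
    have [_ [b' [_ _ yE] ] ] := sB y ys; apply/eqP; rewrite mulf_eq0 yE; apply/orP; right.
    apply: contraNT yx => /wcoef_w_out bb'; rewrite yE xE; apply/eqP/eq_w_ => al.
    by rewrite bb'.
  rewrite sum0 wcoef0 => /esym/eqP; rewrite mulf_eq0 => /predU1P[//|].
  by rewrite xE (negbTE (wcoef_w_diag b)).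
have [l [d [ul vE] ] ] := w_span_uniq v; rewrite vE.
apply: in_span_sum => b bl db.
have wb : wt b = mu_ theta lam (ext0 a).
  by apply: wcoef_weight vmu _; rewrite vE wcoef_comb // mulf_neq0 // wcoef_w_diag.
have [t [tL bE] ] := weight_in_basis Pi_simple simple_in_pos th_Pi m_coef m_simple an wb.
by exists t, b; split.
Qed.

End GelfandTsetlin.

Theorem proposition2p5 (R : realType) (g : lieAlgebra R[i])
  (g_simple : lie_simple g) (g_not_sl2 : ~ lie_isog_sl2 g)
  (H : {vspace g}) (H_cartan : cartan_subalgebra H)
  (Pi Dp : {fset 'Hom(subvs_of H, R[i]^o)})
  (Pi_simple : simple_roots Pi) (Dp_positive : positive_roots Pi Dp)
  (theta : Dp) (theta_max : maximal_root Pi (val theta))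
  (f : Dp -> g) (f_basis : root_basis f)
  (m : Dp -> Pi -> nat)
  (m_coef : forall al : Dp, val al = \sum_(i : Pi) val i *+ m al i)
  (lambda : 'Hom(subvs_of H, R[i]^o)) :
  let act (h : subvs_of H) (v : Wmod theta) := Wact f lambda (vsval h) v in
  [/\ forall mu : 'Hom(subvs_of H, R[i]^o),
        is_weight act mu <->
        exists a : Pi -> int, mu = mu_ theta lambda (ext0 a),
      weight_module act,
      forall mu : 'Hom(subvs_of H, R[i]^o),
        is_weight act mu -> infinite_dim (weight_space act mu)
    & forall a : Pi -> int, exists n : nat,
        least_shift theta m a n /\
        subspace_basis (weight_space act (mu_ theta lambda (ext0 a)))
                       (W_basis theta m a n) ].
Proof.
move=> act; split.
- exact: (weights_of_W g_simple g_not_sl2 H_cartan Pi_simple Dp_positive theta_max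
    f_basis m_coef).
- by apply: weight_module_W; eauto.
- exact: (weight_space_infinite g_simple g_not_sl2 H_cartan Pi_simple Dp_positive
    theta_max f_basis m_coef).
exact: (weight_space_basis g_simple g_not_sl2 H_cartan Pi_simple Dp_positive theta_max
  f_basis m_coef).
Qed.
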